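(* Let $\varphi$ be an Orlicz function. (Function case) Let $w$ be a weight function on $I=[0,\gamma)$, $0<\gamma\le\infty$. If $\gamma=\infty$ and $\varphi$ does not satisfy $\Delta_2$, or $\gamma<\infty$ and $\varphi$ does not satisfy $\Delta_2^\infty$, then $(\Lambda_{\varphi,w})_a$ is a non-trivial $M$-ideal of $\Lambda_{\varphi,w}$ (with the Luxemburg norm). (Sequence case) Let $w=(w(i))$ be a weight sequence. If $\varphi$ does not satisfy $\Delta_2^0$, then $(\lambda_{\varphi,w})_a$ is a non-trivial $M$-ideal of $\lambda_{\varphi,w}$ (with the Luxemburg norm).
   Context: A closed subspace $Y$ of a Banach space $X$ is an $M$-ideal of $X$ if $Y^\perp$ is the range of a bounded projection $P:X^*\to X^*$ satisfying $\|x^*\|=\|Px^*\|+\|x^*-Px^*\|$ for all $x^*\in X^*$. It is non-trivial if $\{0\}\ne Y\ne X$. An Orlicz function is a convex function $\varphi:[0,\infty)\to[0,\infty)$ with $\varphi(0)=0$ and $\varphi(t)>0$ for $t>0$. $\varphi$ satisfies $\Delta_2$ (resp. $\Delta_2^\infty$; $\Delta_2^0$) if there exist $K>0$ (resp. $K>0$ and $u_0\ge0$; $K>0$ and $u_0>0$) such that $\varphi(2u)\le K\varphi(u)$ for all $u\ge0$ (resp. $u\ge u_0$; $0<u\le u_0$). Function case. $I=[0,\gamma)$, $0<\gamma\le\infty$, with Lebesgue measure $m$; $L^0$ is the set of (classes of) Lebesgue measurable functions $f:I\to\mathbb R$. For $f\in L^0$, $d_f(\lambda)=m\{t\in I:|f(t)|>\lambda\}$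 for $\lambda>0$, and $f^*(t)=\inf\{\lambda>0:d_f(\lambda)\le t\}$, $t\in[0,\gamma)$. A weight function $w:I\to(0,\infty)$ is decreasing (non-increasing) and locally integrable, with $W(t)=\int_0^tw<\infty$ for $t\in I$, and $W(\infty)=\infty$ if $\gamma=\infty$. Put $\rho_{\varphi,w}(f)=\int_0^\gamma\varphi(f^*(t))w(t)\,dt$. $\Lambda_{\varphi,w}$ is the set of all $f\in L^0$ with $\rho_{\varphi,w}(\lambda f)<\infty$ for some $\lambda>0$, with the Luxemburg norm $\|f\|=\inf\{\epsilon>0:\rho_{\varphi,w}(f/\epsilon)\le1\}$. Sequence case. For a real sequence $x=(x(i))$, $d_x(\lambda)=|\{i:|x(i)|>\lambda\}|$ and $x^*(i)=\inf\{\lambda>0:d_x(\lambda)<i\}$. A weight sequence $w=(w(i))$ is positive and decreasing (non-increasing) with $\sum_{i=1}^\infty w(i)=\infty$. Put $\alpha_{\varphi,w}(x)=\sum_{i=1}^\infty\varphi(x^*(i))w(i)$. $\lambda_{\varphi,w}$ is the set of real sequences $x$ with $\alpha_{\varphi,w}(\eta x)<\infty$ for some $\eta>0$, with the Luxemburg norm $\|x\|=\inf\{\epsilon>0:\alpha_{\varphi,w}(x/\epsilon)\le1\}$. For a Banach function (or sequence) lattice $X$, $X_a$ is the closed subspace of order-continuous elements: those $x\in X$ such that $\|x_n\|\downarrow0$ whenever $0\le x_n\le|x|$ and $x_n\downarrow0$ a.e. Here $(\Lambda_{\varphi,w})_a=\{f:\rho_{\varphi,w}(\lambda f)<\infty\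 \text{for all}\ \lambda>0\}$ and $(\lambda_{\varphi,w})_a=\{x:\alpha_{\varphi,w}(\eta x)<\infty\ \text{for all}\ \eta>0\}$. *)

(* Defs.v *)
From mathcomp Require Import all_boot all_order all_algebra.
From mathcomp Require Import all_classical all_reals all_analysis.
Import Order.TTheory GRing.Theory Num.Theory.
Import numFieldNormedType.Exports.

Set Implicit Arguments.
Unset Strict Implicit.
Unset Printing Implicit Defensive.

Local Open Scope classical_set_scope.
Local Open Scope ring_scope.

(** A normed space whose points are classes of vectors (here: classes of
    functions modulo equality almost everywhere) is presented by the set
    [carrier] of representatives, the set [null] of representatives of the
    class of 0, and the norm of a class computed on representatives.  The
    presented space is [carrier / null]; [banach] says that it really is a
    Banach space. *)
Record pre_space (R : realType) (V : lmodType R) := PreSpace {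
  carrier : set V;
  null : set V;
  nrm : V -> R
}.

Section Banach_space.
Context {R : realType} {V : lmodType R}.
Implicit Types (X : pre_space V) (Y A : set V).

Definition linear_subspace A :=
  A 0 /\ forall (a : R) x y, A x -> A y -> A (a *: x + y).

Definition complete_norm X :=
  forall u : nat -> V, (forall n, carrier X (u n)) ->
    (forall e : R, 0 < e ->
      exists n, forall p q, (n <= p)%N -> (n <= q)%N -> nrm X (u p - u q) < e) ->
    exists2 x, carrier X x & nrm X (u n - x) @[n --> \oo] --> (0 : R).

Definition banach X :=
  [/\ linear_subspace (carrier X),
      forall x, carrier X x -> 0 <= nrm X x /\ (nrm X x = 0 <-> null X x),
      forall (a : R) x, carrier X x -> nrm X (a *: x) = `|a| * nrm X x,
      forall x y, carrier X x -> carrier X y ->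
        nrm X (x + y) <= nrm X x + nrm X y
    & complete_norm X].

Definition closed_subspace X Y :=
  [/\ Y `<=` carrier X, linear_subspace Y
    & forall x, carrier X x ->
        (forall e : R, 0 < e -> exists2 y, Y y & nrm X (x - y) < e) -> Y x].

(** The dual [X^*].  Functionals are functions on the type [carrier X]; a
    bounded linear functional vanishes on [null X], so that these are exactly
    the bounded linear functionals of [carrier X / null X]. *)
Definition dual X : set (carrier X -> R) := [set F |
  (forall (a : R) (x y z : carrier X),
     \val z = a *: \val x + \val y -> F z = a * F x + F y) /\
  (exists C : R, forall x : carrier X, `|F x| <= C * nrm X (\val x))].

Arguments dual X : clear implicits.

Definition dual_norm X (F : carrier X -> R) : R :=
  sup [set `|F x| | x in [set x : carrier X | nrm X (\val x) <= 1]].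

Definition annihilator X Y : set (carrier X -> R) :=
  [set F | dual X F /\ forall x : carrier X, Y (\val x) -> F x = 0].

Arguments annihilator X Y : clear implicits.

Definition bounded_projection X (P : (carrier X -> R) -> (carrier X -> R)) :=
  [/\ forall F, dual X F -> dual X (P F),
      forall (a : R) F G, dual X F -> dual X G ->
        P (fun x => a * F x + G x) = (fun x => a * P F x + P G x),
      exists C : R, forall F, dual X F -> dual_norm (P F) <= C * dual_norm F
    & forall F, dual X F -> P (P F) = P F].

Definition M_ideal X Y :=
  [/\ banach X, closed_subspace X Y
    & exists P : (carrier X -> R) -> (carrier X -> R),
      [/\ bounded_projection P,
          P @` dual X = annihilator X Y
        & forall F, dual X F ->
            dual_norm F = dual_norm (P F) + dual_norm (fun x => F x - P F x)]].

Definition nontrivial_M_ideal X Y :=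
  [/\ M_ideal X Y,
      exists2 y, Y y & ~ null X y
    & exists2 x, carrier X x & ~ Y x].

End Banach_space.

(** Order-continuous elements of a lattice [X] of functions on [T], where
    [ae] is the filter of properties holding almost everywhere on [T]. *)
Definition order_continuous (R : realType) (T : Type) (ae : set_system T)
    (X : pre_space (T -> R : lmodType R)) : set (T -> R) :=
  [set x | carrier X x /\
    forall u : nat -> T -> R, (forall n, carrier X (u n)) ->
      (\forall t \near ae,
         [/\ forall n, 0 <= u n t <= `|x t|,
             nonincreasing_seq (u ^~ t)
           & u n t @[n --> \oo] --> (0 : R)]) ->
      nonincreasing_seq (fun n => nrm X (u n)) /\
      nrm X (u n) @[n --> \oo] --> (0 : R)].

Section Orlicz.
Context {R : realType}.
Implicit Type phi : R -> R.

(** Only the values of [phi] on [0, +oo[ are relevant. *)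
Definition orlicz phi :=
  [/\ convex_function (`[0, +oo[%classic : set R) phi,
      phi 0 = 0
    & forall t, 0 < t -> 0 < phi t].

Definition Delta2 phi :=
  exists2 K : R, 0 < K & forall u, 0 <= u -> phi (2 * u) <= K * phi u.

Definition Delta2_infty phi :=
  exists K u0 : R, [/\ 0 < K, 0 <= u0
    & forall u, u0 <= u -> phi (2 * u) <= K * phi u].

Definition Delta2_zero phi :=
  exists K u0 : R, [/\ 0 < K, 0 < u0
    & forall u, 0 < u -> u <= u0 -> phi (2 * u) <= K * phi u].

End Orlicz.

Section function_case.
Context {R : realType}.
Implicit Types (phi w f : R -> R) (gamma : \bar R).

Definition I_ gamma : set R := [set t | 0 <= t /\ (t%:E < gamma)%E].
Definition Io_ gamma : set R := [set t | 0 < t /\ (t%:E < gamma)%E].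

(** The real line with the sigma-algebra of Lebesgue measurable sets. *)
Definition Leb := caratheodory_type ((wlength (@idfun R))^*)%mu.

Definition Leb_measurable gamma f :=
  measurable_fun (I_ gamma : set Leb) (f : Leb -> R).

Definition ae_I gamma : set_system R :=
  fun P => \forall t \ae (@completed_lebesgue_measure R), I_ gamma t -> P t.

Definition distr gamma f (lam : R) : \bar R :=
  completed_lebesgue_measure [set t | I_ gamma t /\ lam < `|f t|].

(** The value is +oo where the infimum is over the empty set. *)
Definition rearr gamma f (t : R) : \bar R :=
  ereal_inf [set lam%:E | lam in
    [set lam : R | 0 < lam /\ (distr gamma f lam <= t%:E)%E]].

(** [w] is constrained on ]0, gamma[ only: the value [w 0] is irrelevant, and
    weights unbounded near 0 are allowed. *)
Definition weight gamma w :=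
  [/\ forall t, Io_ gamma t -> 0 < w t,
      forall s t, Io_ gamma s -> Io_ gamma t -> s <= t -> w t <= w s,
      forall t, Io_ gamma t ->
        (\int[lebesgue_measure]_(s in `]0%R, t[) (w s)%:E < +oo)%E
    & gamma = +oo%E ->
        (\int[lebesgue_measure]_(s in Io_ gamma) (w s)%:E = +oo)%E].

(** [er_map phi] is [phi] extended by [phi +oo = +oo]. *)
Definition rho phi gamma w f : \bar R :=
  (\int[lebesgue_measure]_(t in Io_ gamma)
     (er_map phi (rearr gamma f t) * (w t)%:E))%E.

Definition Lambda phi gamma w : pre_space (R -> R : lmodType R) := {|
  carrier := [set f | Leb_measurable gamma f /\
    exists2 lam : R, 0 < lam & (rho phi gamma w (lam *: f) < +oo)%E];
  null := [set f | \forall t \near ae_I gamma, f t = 0];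
  nrm := fun f =>
    inf [set e : R | 0 < e /\ (rho phi gamma w (e^-1 *: f) <= 1)%E]
|}.

Definition Lambda_a phi gamma w : set (R -> R) :=
  order_continuous (ae_I gamma) (Lambda phi gamma w).

End function_case.

(** Sequences are indexed from 0: [x i] stands for the term of index [i.+1]. *)
Section sequence_case.
Context {R : realType}.
Implicit Types (phi : R -> R) (w x : nat -> R).

Definition distr_seq x (lam : R) : \bar R :=
  counting [set i | lam < `|x i|].

Definition rearr_seq x (i : nat) : \bar R :=
  ereal_inf [set lam%:E | lam in
    [set lam : R | 0 < lam /\ (distr_seq x lam < i.+1%:R%:E)%E]].

Definition weight_seq w :=
  [/\ forall i, 0 < w i,
      nonincreasing_seq w
    & (\sum_(0 <= i <oo) (w i)%:E = +oo)%E].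

Definition alpha phi w x : \bar R :=
  (\sum_(0 <= i <oo) (er_map phi (rearr_seq x i) * (w i)%:E))%E.

Definition lambda phi w : pre_space (nat -> R : lmodType R) := {|
  carrier := [set x |
    exists2 eta : R, 0 < eta & (alpha phi w (eta *: x) < +oo)%E];
  null := [set x | forall i, x i = 0];
  nrm := fun x => inf [set e : R | 0 < e /\ (alpha phi w (e^-1 *: x) <= 1)%E]
|}.

Definition lambda_a phi w : set (nat -> R) :=
  order_continuous (globally [set: nat]) (lambda phi w).

End sequence_case.

(* Main.v *)
(** Let E be the order-continuous part of the space.  A functional G is the sum
    of its continuous part, the limit of G (f \1_C) along the sets C with
    f \1_C in E, and of a singular part, which vanishes on E; the projection
    sends G to its singular part.  If f and g have modular at most 1, then
    (1 - e) f \1_B + g \1_(~` B) has modular at most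
    (1 - e) + rho (g \1_(~` B)), and the last term tends to 0 along sets B
    with f \1_B and g \1_B in E: hence the norms of both parts add up.

    The Orlicz-Lorentz modular is the double integral over r, l > 0 of
    min (|{w > r}|, |{phi |f| > l}|).  For fixed r the integral over l is the
    minimum over c >= 0 of |{w > r}| c + \int (phi |f| - c)^+, which makes the
    modular convex without any rearrangement inequality.

    If Delta2 fails, there are u_n and sets A_n such that phi u_n * W |A_n| is
    about 2^-n while phi (2 u_n) * W |A_n| is unbounded: the supremum of the
    functions u_n \1_(A_n) belongs to the space, but not to E. *)
From HB Require Import structures.
Require Import Defs.
From mathcomp Require Import all_boot all_order all_algebra.
From mathcomp Require Import all_classical all_reals all_analysis.
From mathcomp Require Import measurable_realfun ring lra.
Import Order.TTheory GRing.Theory Num.Theory.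
Import numFieldNormedType.Exports.

Set Implicit Arguments.
Unset Strict Implicit.
Unset Printing Implicit Defensive.

Local Open Scope classical_set_scope.
Local Open Scope ring_scope.

(** * M-ideals in modular spaces of functions *)

Set Bullet Behavior "Strict Subproofs".

(** No formula splits the Luxemburg norm over disjoint sets; only its closed unit ball, where the
    modular is at most 1, is accessible. The factor [1 - e] frees in this ball the room taken by the
    modular of the tail, while the norm of the tail need not be small. The argument thus rests on a
    short list of properties of the modular, and one abstract theorem serves functions and
    sequences. The sets B are essentially {1/n < |f| <= n}: f is bounded there, and a finite modular
    makes them of finite measure, because the weight has infinite integral when the domain has
    infinite measure. Both modulars are instances of one integral over an index space with a
    position function [kappa]. The supremum of the [u_n \1_(A_n)] must be finite at each point.
    Small [u_n] are bounded by 1; for large [u_n] the [A_n] are initial intervals shrinking to 0, so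
    each point meets finitely many of them. A nonempty set of integers has weight at least that of
    one term, so sequences need small values [u_n], which the failure of [Delta2_zero] provides. The
    sets are found by halving or by adding terms, not by inverting W, which costs a factor 2. *)

Lemma cvge0_near_lt (R : realType) (u : nat -> \bar R) (e : \bar R) :
  u n @[n --> \oo] --> 0%E -> (0 < e)%E -> \forall n \near \oo, (u n < e)%E.
Proof.
move=> c e0; have /c : nbhs (0%E : \bar R) [set x | (x < e)%E].
  by apply: open_nbhs_nbhs; split => //; exact: open_ereal_lt_ereal.
by [].
Qed.

Section modular.
Context d (T : measurableType d) (R : realType) (D : set T).
Variables (N : set_system T) (rho : (T -> R) -> \bar R).
Implicit Types (f g : T -> R) (B C : set T).

Local Notation M := (@measurable_fun _ _ T R D).

Definition modular_carrier : set (T -> R) :=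
  [set f | M f /\ exists2 lam : R, 0 < lam & (rho (lam *: f) < +oo)%E].

Definition modular_space : pre_space (T -> R : lmodType R) := {|
  carrier := modular_carrier;
  null := [set f | \forall t \near N, f t = 0];
  nrm := fun f => inf [set e : R | 0 < e /\ (rho (e^-1 *: f) <= 1)%E]
|}.

Definition modular_finite : set (T -> R) :=
  [set f | M f /\ forall c : R, (rho (c *: f) < +oo)%E].

Definition exhaustion (B : nat -> set T) :=
  [/\ forall n, measurable (B n), nondecreasing_seq B
    & forall t, exists n, B n t].

(** All that the M-ideal theorem uses of the modular. [modular_fatou] makes the unit ball closed and
    the space complete, [modular_dominated] gives order continuity and small tails, and
    [modular_exhaustion] provides enough truncations with all multiples of finite modular. *)
Record lattice_modular : Prop := LatticeModular {
  modular_meas : measurable D;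
  modular_filter : Filter N;
  modular_ge0 : forall f, (0 <= rho f)%E;
  modular_eq0 : forall f, M f ->
    rho f = 0%E <-> \forall t \near N, f t = 0;
  modular_le : forall f g, M f -> M g ->
    (\forall t \near N, `|f t| <= `|g t|) -> (rho f <= rho g)%E;
  modular_convex : forall (a : R) f g, M f -> M g -> 0 <= a <= 1 ->
    (rho (a *: f + (1 - a) *: g)%R <= a%:E * rho f + (1 - a)%:E * rho g)%E;
  modular_disjoint : forall f g, M f -> M g ->
    (forall t, f t = 0 \/ g t = 0) -> (rho (f + g)%R <= rho f + rho g)%E;
  modular_fatou : forall (u : nat -> T -> R) f, (forall n, M (u n)) -> M f ->
    (\forall t \near N, u n t @[n --> \oo] --> f t) ->
    (forall n, (rho (u n) <= 1)%E) -> (rho f <= 1)%E;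
  modular_dominated : forall (u : nat -> T -> R) f, (forall n, M (u n)) -> M f ->
    (\forall t \near N, [/\ forall n, 0 <= u n t <= `|f t|,
       nonincreasing_seq (u ^~ t) & u n t @[n --> \oo] --> (0 : R)]) ->
    (rho f < +oo)%E -> rho (u n) @[n --> \oo] --> 0%E;
  modular_exhaustion : forall f, modular_carrier f ->
    exists2 B, exhaustion B & forall n, modular_finite (f \* \1_(B n))
}.

Hypothesis rhoP : lattice_modular.

Let mD : measurable D := modular_meas rhoP.
#[local] Instance modular_filter_instance : Filter N := modular_filter rhoP.

Local Notation X := modular_space.
Local Notation norm := (nrm modular_space).
Local Notation E := modular_finite.

Let M0 : M (0 : T -> R). Proof. exact: measurable_cst. Qed.

Let MZ (a : R) f : M f -> M (a *: f).
Proof. by move=> mf; apply: (@measurable_funM _ _ _ D (cst a) f). Qed.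

Let MD f g : M f -> M g -> M (f + g).
Proof. by move=> mf mg; apply: measurable_funD. Qed.

Let MI f B : measurable B -> M f -> M (f \* \1_B).
Proof. by move=> mB mf; apply: measurable_funM => //; exact: measurable_indic. Qed.

Let Mnorm f : M f -> M (fun t => `|f t|).
Proof. by move=> mf; apply: measurableT_comp. Qed.

(** * The Luxemburg norm of a lattice modular *)

Lemma modular0 : rho 0 = 0%E.
Proof. by apply/(modular_eq0 rhoP) => //; apply: nearW. Qed.

Lemma modular_scale (a : R) f : M f -> 0 <= a <= 1 ->
  (rho (a *: f) <= a%:E * rho f)%E.
Proof.
move=> mf a01; have := modular_convex rhoP mf M0 a01.
by rewrite scaler0 addr0 modular0 mule0 adde0.
Qed.

Lemma modular_leT f g : M f -> M g -> (forall t, `|f t| <= `|g t|) ->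
  (rho f <= rho g)%E.
Proof. by move=> mf mg fg; apply: (modular_le rhoP) => //; apply: nearW. Qed.

Lemma modular_carrier_le f g : M f -> carrier X g ->
  (\forall t \near N, `|f t| <= `|g t|) -> carrier X f.
Proof.
move=> mf [mg [a a0 ga]] fg; split=> //; exists a => //.
apply: le_lt_trans ga; apply: (modular_le rhoP); [exact: MZ|exact: MZ|].
apply: filterS fg => t fgt; rewrite !normrM.
by apply: ler_wpM2l fgt.
Qed.

Lemma modular_carrier_linear (a : R) f g : carrier X f -> carrier X g ->
  carrier X (a *: f + g).
Proof.
move=> [mf [b b0 fb]] [mg [c c0 gc]].
have mafg : M (a *: f + g) by apply: MD => //; exact: MZ.
(* The choice gives [2 * k * |a| <= b] and [2 * k <= c], so [k *: (a *: f + g)] is the midpoint of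
   two functions of finite modular; the [+ 1] covers [a = 0]. *)
split=> //; set k := Num.min (b / (2 * (`|a| + 1))) (c / 2).
have a1 : 0 < `|a| + 1 by rewrite ltr_wpDl.
have k0 : 0 < k by rewrite lt_min !divr_gt0 ?mulr_gt0.
exists k => //.
have -> : k *: (a *: f + g) =
  2^-1 *: ((2 * k * a) *: f) + (1 - 2^-1) *: ((2 * k) *: g).
  apply/funext => t /=; rewrite /GRing.scale /=.
  rewrite !fctE/=.
  by rewrite /GRing.scale/=; field.
apply: le_lt_trans (modular_convex rhoP _ _ _) _; [exact: MZ|exact: MZ|lra|].
apply: lte_add_pinfty.
  apply: lte_mul_pinfty; rewrite ?lee_fin//.
  apply: le_lt_trans fb; apply: modular_leT; [exact: MZ|exact: MZ|] => t.
  rewrite !normrM; apply: ler_wpM2r => //.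
  rewrite normr_nat (gtr0_norm b0) (gtr0_norm k0).
  have : k <= b / (2 * (`|a| + 1)) by rewrite ge_min lexx.
  rewrite ler_pdivlMr ?mulr_gt0// => kb.
  apply: le_trans kb; have -> : k * (2 * (`|a| + 1)) = 2 * k * `|a| + 2 * k by ring.
  by rewrite lerDl mulr_ge0 // ltW.
apply: lte_mul_pinfty; rewrite ?lee_fin//; first lra.
apply: le_lt_trans gc; apply: modular_leT; [exact: MZ|exact: MZ|] => t.
rewrite !normrM; apply: ler_wpM2r => //.
rewrite normr_nat (gtr0_norm c0) (gtr0_norm k0).
have : k <= c / 2 by rewrite ge_min lexx orbT.
by lra.
Qed.

Lemma norm_has_inf f : carrier X f ->
  has_inf [set e : R | 0 < e /\ (rho (e^-1 *: f) <= 1)%E].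
Proof.
move=> [mf [lam lam0 flam]]; split; last by exists 0 => e [/ltW].
have [r rE] : exists r : R, rho (lam *: f) = r%:E.
  exists (fine (rho (lam *: f))); rewrite fineK// ge0_fin_numE//.
  exact: (modular_ge0 rhoP).
have r0 : 0 <= r by rewrite -lee_fin -rE; exact: (modular_ge0 rhoP).
(* By convexity, dividing [lam *: f] by [r + 1] brings its modular down to at most [r / (r + 1)]. *)
exists ((r + 1) / lam); split; first by rewrite divr_gt0// ltr_wpDl.
have -> : ((r + 1) / lam)^-1 *: f = (r + 1)^-1 *: (lam *: f).
  by rewrite scalerA invf_div mulrC.
have r1 : 0 < r + 1 by rewrite ltr_wpDl.
apply: le_trans (modular_scale _ _) _; first exact: MZ.
  by rewrite invr_ge0 (ltW r1) /= invf_le1// lerDr.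
rewrite rE -EFinM lee_fin mulrC ler_pdivrMr// mul1r; lra.
Qed.

Lemma norm_le f (e : R) : 0 < e -> (rho (e^-1 *: f) <= 1)%E -> norm f <= e.
Proof.
move=> e0 fe; apply: ge_inf; last by split.
by exists 0 => x [/ltW].
Qed.

Lemma norm_ge0 f : 0 <= norm f.
Proof.
(* Outside the carrier [S] may be empty; [inf S] is then 0 by convention. *)
rewrite /nrm /=; set S := (X in inf X); have [->|/set0P S0] := eqVneq S set0.
  by rewrite inf0.
by apply: lb_le_inf => // x [/ltW].
Qed.

Lemma norm_lt_modular f (e : R) : carrier X f -> norm f < e ->
  (rho (e^-1 *: f) <= 1)%E.
Proof.
move=> Xf fe; have [e' [e'0 fe'] e'e] := inf_lt (norm_has_inf Xf).1 fe.
apply: le_trans fe'; apply: modular_leT; [apply: MZ; exact: Xf.1..|] => t.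
rewrite !normrM; apply: ler_wpM2r => //.
have e0 : 0 < e by exact: lt_trans e'e.
by rewrite !gtr0_norm ?invr_gt0// lef_pV2 ?posrE// ltW.
Qed.

(** The infimum defining the norm is attained: the modular is at most 1 at the scales [e + 1/(n+1)],
    and the Fatou property passes to the limit. *)
Lemma norm_modular f (e : R) : carrier X f -> 0 < e ->
  norm f <= e <-> (rho (e^-1 *: f) <= 1)%E.
Proof.
move=> Xf e0; split; last exact: norm_le.
move=> fe; apply: (modular_fatou rhoP
  (u := fun n => (e + n.+1%:R^-1)^-1 *: f)).
- by move=> n; apply: MZ; exact: Xf.1.
- by apply: MZ; exact: Xf.1.
- apply: nearW => t; apply: cvgMl; apply: cvgV; first by rewrite gt_eqF.
  rewrite -[X in _ --> X]addr0; apply: cvgD; first exact: cvg_cst.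
  exact: cvg_harmonic.
- by move=> n; apply: norm_lt_modular => //; rewrite (le_lt_trans fe)// ltrDl.
Qed.

Lemma norm_le_ae f g : M f -> carrier X g ->
  (\forall t \near N, `|f t| <= `|g t|) -> norm f <= norm g.
Proof.
move=> mf Xg fg; apply/ler_addgt0Pr => e e0.
have g0 : 0 < norm g + e by rewrite ltr_wpDl// norm_ge0.
apply: norm_le => //; apply: le_trans (norm_lt_modular Xg (_ : _ < norm g + e)).
  apply: (modular_le rhoP); [exact: MZ|apply: MZ; exact: Xg.1|].
  apply: filterS fg => t fgt; rewrite !normrM.
  by apply: ler_wpM2l fgt.
by rewrite ltrDl.
Qed.

Lemma normZ (a : R) f : carrier X f -> norm (a *: f) = `|a| * norm f.
Proof.
(* One inequality for all nonzero scalars suffices: applied to [a^-1] and [a *: f], it yields the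
   other. *)
have le (b : R) g : carrier X g -> b != 0 -> norm (b *: g) <= `|b| * norm g.
  move=> Xg b0; have nb : 0 < `|b| by rewrite normr_gt0.
  rewrite mulrC -ler_pdivrMr//; apply/ler_addgt0Pr => e e0.
  rewrite ler_pdivrMr//.
  have g0 : 0 < norm g + e by rewrite ltr_wpDl// norm_ge0.
  apply: norm_le; first exact: mulr_gt0.
  apply: le_trans (norm_lt_modular Xg (_ : _ < norm g + e)); last by rewrite ltrDl.
  apply: modular_leT; [apply/MZ/MZ; exact: Xg.1|apply: MZ; exact: Xg.1|] => t.
  rewrite !normrM !mulrA ler_wpM2r// !normfV normrM (normr_id b).
  by rewrite invfM -mulrA (mulVf _) ?normr_eq0// mulr1.
move=> Xf; have [->|a0] := eqVneq a 0.
  rewrite normr0 mul0r; apply/eqP; rewrite eq_le norm_ge0 andbT.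
  apply/ler_addgt0Pr => e e0; rewrite add0r; apply: norm_le => //.
  by rewrite scale0r scaler0 modular0.
apply/eqP; rewrite eq_le le//=.
have Xaf : carrier X (a *: f).
  have X0 : carrier X 0.
    by split; [exact: M0|exists 1 => //; rewrite scaler0 modular0].
  by have := modular_carrier_linear a Xf X0; rewrite addr0.
have := le a^-1 _ Xaf; rewrite invr_eq0 => /(_ a0).
rewrite scalerA mulVf// scale1r normfV mulrC ler_pdivlMr ?normr_gt0//.
by rewrite mulrC.
Qed.

Lemma normD f g : carrier X f -> carrier X g -> norm (f + g) <= norm f + norm g.
Proof.
move=> Xf Xg; apply/ler_addgt0Pr => e e0.
set a := norm f + e / 2; set b := norm g + e / 2.
have a0 : 0 < a by rewrite ltr_wpDl ?norm_ge0// divr_gt0.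
have b0 : 0 < b by rewrite ltr_wpDl ?norm_ge0// divr_gt0.
have ab0 : 0 < a + b by rewrite addr_gt0.
have -> : norm f + norm g + e = a + b by rewrite /a /b; field.
apply: norm_le => //.
have -> : (a + b)^-1 *: (f + g) =
    (a / (a + b)) *: (a^-1 *: f) + (1 - a / (a + b)) *: (b^-1 *: g).
  rewrite !scalerA scalerDr; congr (_ *: _ + _ *: _); field.
    by rewrite ?gt_eqF.
  by rewrite ?gt_eqF.
have ab1 : 0 <= a / (a + b) <= 1.
  by rewrite divr_ge0 ?(ltW a0) ?(ltW ab0)//= ler_pdivrMr// mul1r lerDl ltW.
have mfa : M (a^-1 *: f) by apply: MZ; exact: Xf.1.
have mgb : M (b^-1 *: g) by apply: MZ; exact: Xg.1.
apply: le_trans (modular_convex rhoP mfa mgb ab1) _.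
have : (rho (a^-1 *: f) <= 1)%E.
  by apply: norm_lt_modular => //; rewrite ltrDl divr_gt0.
have : (rho (b^-1 *: g) <= 1)%E.
  by apply: norm_lt_modular => //; rewrite ltrDl divr_gt0.
move=> gb fa; have -> : 1%E = ((a / (a + b))%:E * 1 + (1 - a / (a + b))%:E * 1)%E.
  by rewrite !mule1 -EFinD addrC subrK.
by apply: leeD; apply: lee_pmul => //; rewrite ?lee_fin ?subr_ge0;
  case/andP: ab1 => //; rewrite ?(modular_ge0 rhoP).
Qed.

(** If the norm is 0, then [f / k] has modular at most 1 for every small [k > 0], and convexity
    bounds [rho f] by [k]. *)
Lemma norm_eq0 f : carrier X f -> norm f = 0 <-> null X f.
Proof.
move=> Xf; split=> [f0|nf].
  apply/(modular_eq0 rhoP); first exact: Xf.1.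
  apply/eqP; rewrite eq_le (modular_ge0 rhoP) andbT.
  apply/lee_addgt0Pr => e e0; rewrite add0e.
  set k := Num.min e 1.
  have k0 : 0 < k by rewrite lt_min e0 ltr01.
  have k1 : 0 <= k <= 1 by rewrite (ltW k0) ge_min lexx orbT.
  have -> : f = k *: (k^-1 *: f) by rewrite scalerA divff ?scale1r// gt_eqF.
  apply: le_trans (modular_scale _ k1) _; first by apply: MZ; exact: Xf.1.
  apply: (@le_trans _ _ (k%:E * 1)%E).
    apply: lee_pmul => //; rewrite ?lee_fin ?(ltW k0)// ?(modular_ge0 rhoP)//.
    by apply: norm_lt_modular => //; rewrite f0.
  by rewrite mule1 lee_fin ge_min lexx.
apply/eqP; rewrite eq_le norm_ge0 andbT.
apply/ler_addgt0Pr => e e0; rewrite add0r; apply: norm_le => //.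
rewrite (_ : rho _ = 0)%E//; apply/(modular_eq0 rhoP); first by apply: MZ; exact: Xf.1.
by apply: filterS nf => t /= ft; rewrite /GRing.scale /= /GRing.scale /= ft mulr0.
Qed.

(* A divergent sum of increments would make the carrier contain arbitrarily
   large multiples of the indicator of the divergence set, with norm at most 1. *)
Lemma summable_increments_ae_cvg (v : nat -> T -> R) :
  (forall n, carrier X (v n)) ->
  (forall n, norm (v n.+1 - v n) <= 2^-1 ^+ n.+1) ->
  \forall t \near N, cvgn (v ^~ t).
Proof.
move=> Xv vle.
pose G k t : R := \sum_(0 <= i < k) `|v i.+1 t - v i t|.
have mG k : M (G k).
  apply: (@measurable_sum _ _ R D _ _ (fun i t => `|v i.+1 t - v i t|)) => i.
  apply: measurableT_comp => //; apply: measurable_funB; [exact: (Xv _).1|exact: (Xv _).1].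
have G0 k t : 0 <= G k t by apply: sumr_ge0.
have ndG t : nondecreasing_seq (G ^~ t).
  by move=> n m nm; rewrite /G (big_cat_nat (leq0n n) nm)//= lerDl sumr_ge0.
have Xd n : carrier X (v n.+1 - v n).
  by rewrite -[- v n]scaleN1r addrC; apply: modular_carrier_linear.
have XG k : carrier X (G k) /\ norm (G k) <= 1 - 2^-1 ^+ k.
  elim: k => [|k [Xk nk]].
    have -> : G 0%N = 0 by apply/funext => t; rewrite /G big_nil.
    have X0 : carrier X 0.
      by split; [exact: M0|exists 1 => //; rewrite scaler0 modular0].
    split=> //; rewrite expr0 subrr (_ : norm 0 = 0)//.
    by apply/norm_eq0 => //; apply: nearW.
  have -> : G k.+1 = G k + (fun t => `|v k.+1 t - v k t|).
    by apply/funext => t; rewrite /G big_nat_recr.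
  have Xa : carrier X (fun t => `|v k.+1 t - v k t|).
    apply: modular_carrier_le (Xd k) _; first by apply: Mnorm; exact: (Xd k).1.
    by apply: nearW => t; rewrite normr_id.
  split; first by rewrite -[G k]scale1r; apply: modular_carrier_linear.
  apply: le_trans (normD Xk Xa) _.
  have : norm (fun t => `|v k.+1 t - v k t|) <= 2^-1 ^+ k.+1.
    apply: le_trans (vle k); apply: norm_le_ae (Xd k) _.
      by apply: Mnorm; exact: (Xd k).1.
    by apply: nearW => t; rewrite normr_id.
  by rewrite exprS; lra.
(* The upper limit in the extended reals exists at every point and is measurable, so the divergence
   set [A] has a measurable indicator. *)
pose L t := limn_esup (fun k => (G k t)%:E).
have LE t : L t = +oo%E <-> ~ cvgn (G ^~ t).
  have [cG|dG] := pselect (cvgn (G ^~ t)).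
    split=> // LT; exfalso; have : (fun k => (G k t)%:E) @ \oo --> (limn (G ^~ t))%:E.
      by apply: cvg_EFin => //; apply: nearW.
    by move=> /cvg_limn_einf_sup [_]; rewrite -/(L t) LT.
  split=> // _.
  have : (fun k => (G k t)%:E) @ \oo --> +oo%E.
    apply/cvgeryP/nondecreasing_dvgn_lt => //.
  by move=> /cvg_limn_einf_sup [_].
pose A := [set t | L t = +oo%E].
have mA : M (\1_A).
  have -> : \1_A = \1_[set +oo%E] \o L :> (T -> R).
    by apply/funext => t; rewrite /= !indicE; congr (_%:R); apply/idP/idP => /[!inE].
  apply: measurableT_comp; first by apply: measurable_indic; exact: emeasurable_set1.
  apply: measurable_fun_limn_esup => n; apply/measurable_EFinP; exact: mG.
(* [c *: \1_A] is the pointwise limit of [min (G k) c * \1_A], which lies below [G k] and hence in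
   the unit ball. *)
have Ac (c : R) : 0 < c -> (rho (c *: (\1_A : T -> R)) <= 1)%E.
{ move=> c0; apply: (modular_fatou rhoP
      (u := fun k t => Num.min (G k t) c * \1_A t)).
  - by move=> n; apply: measurable_funM => //; apply: measurable_minr.
  - exact: MZ.
  - apply: nearW => t /=; rewrite /GRing.scale /= /GRing.scale /= indicE.
    have [At|nAt] := boolP (t \in A); last first.
      by rewrite mulr0; under eq_fun do rewrite mulr0; exact: cvg_cst.
    rewrite mulr1; under eq_fun do rewrite mulr1; apply: cvg_near_cst.
    move: At; rewrite inE => /LE/(nondecreasing_dvgn_lt (ndG t))/cvgryPge/(_ c).
    by apply: filterS => n /min_idPr.
  - move=> n; apply: (@le_trans _ _ (rho (1^-1 *: G n))).
      rewrite invr1 scale1r; apply: modular_leT => // [|t].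
        by apply: measurable_funM => //; apply: measurable_minr.
      have m0 : 0 <= Num.min (G n t) c by rewrite le_min G0 ltW.
      rewrite indicE normrM (ger0_norm m0) (ger0_norm (G0 n t)) normr_nat.
      by case: (_ \in _); rewrite ?mulr1 ?mulr0// ge_min lexx.
    apply/norm_modular => //; first exact: (XG n).1.
    by apply: le_trans (XG n).2 _; rewrite gerBl exprn_ge0. }
have XA : carrier X (\1_A : T -> R).
  by split=> //; exists 1 => //; apply: le_lt_trans (Ac _ ltr01) _; rewrite ltry.
have : null X (\1_A : T -> R).
  apply/norm_eq0 => //; apply/eqP; rewrite eq_le norm_ge0 andbT.
  apply/ler_addgt0Pr => e e0; rewrite add0r; apply: norm_le => //.
  by apply: Ac; rewrite invr_gt0.
apply: filterS => t /=; rewrite indicE => tA.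
have {tA} : ~ L t = +oo%E.
  by move=> At; move: tA; rewrite mem_set//= => /eqP; rewrite oner_eq0.
rewrite LE => /contrapT cG.
have : cvgn [normed series (telescope (v ^~ t))].
  exact: cG.
move/normed_cvg; rewrite -[X in _ -> cvgn X](_ : (fun k => v 0%N t + series (telescope (v ^~ t)) k) = _).
  by move=> c; apply: is_cvgD => //; exact: is_cvg_cst.
by apply/funext => k; rewrite -eq_sum_telescope.
Qed.

Lemma modular_complete : complete_norm X.
Proof.
move=> u Xu cauchy.
have Xd m n : carrier X (u m - u n).
  by rewrite -[- u n]scaleN1r addrC; apply: modular_carrier_linear.
have /choice[k kP] (i : nat) : exists n, forall p q, (n <= p)%N -> (n <= q)%N ->
  norm (u p - u q) < 2^-1 ^+ i.+1 by apply: cauchy; rewrite exprn_gt0.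
(* Summing the thresholds and adding [i] gives a strictly increasing sequence with [k i <= K i]. *)
pose K i := (\sum_(j < i.+1) k j + i)%N.
have kK i : (k i <= K i)%N by rewrite /K big_ord_recr /= -addnA addnCA leq_addr.
have KS i : (K i < K i.+1)%N.
  by rewrite /K [X in (_ < X + _)%N]big_ord_recr /= addnS ltnS -addnA leq_add2l leq_addl.
have Ki i : (i <= K i)%N by rewrite leq_addl.
have := summable_increments_ae_cvg (v := u \o K) _ _.
move=> /(_ (fun n => Xu _)) cK.
have {}cK : \forall t \near N, cvgn (fun n => u (K n) t).
  apply: cK => n; apply/ltW/kP => //.
  by apply: leq_trans (kK n) (ltnW (KS n)).
(* An upper limit is measurable without regard to the null set where the subsequence diverges; there
   the value of [x] is immaterial. *)
pose x t : R := fine (limn_esup (fun n => (u (K n) t)%:E)).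
have mx : M x.
  apply: measurableT_comp => //.
  by apply: measurable_fun_limn_esup => n; apply/measurable_EFinP; exact: (Xu _).1.
have cx : \forall t \near N, u (K n) t @[n --> \oo] --> x t.
  apply: filterS cK => t ct.
  have : (u (K n) t)%:E @[n --> \oo] --> (limn (fun n => u (K n) t))%:E.
    by apply: cvg_EFin => //; apply: nearW.
  by move=> /cvg_limn_einf_sup [_ xE]; rewrite /x xE.
(* The Fatou property, applied along the subsequence to [u p - u (K (n + j))], turns almost
   everywhere convergence into convergence in norm of the whole sequence. *)
have near_x (e : R) : 0 < e -> exists n, forall p, (n <= p)%N ->
    (rho (e^-1 *: (u p - x)) <= 1)%E.
{ move=> e0; have [n nP] := cauchy _ e0; exists n => p np.
  apply: (modular_fatou rhoP (u := fun j => e^-1 *: (u p - u (K (n + j)%N)))).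
  - by move=> j; apply: MZ; exact: (Xd _ _).1.
  - by apply: MZ; apply: measurable_funB => //; exact: (Xu _).1.
  - apply: filterS cx => t ct; apply: cvgM; first exact: cvg_cst.
    apply: cvgB; first exact: cvg_cst.
    by under eq_fun do rewrite addnC; move: ct; rewrite -(cvg_shiftn n).
  - move=> j; apply: norm_lt_modular => //; apply: nP => //.
    by apply: leq_trans (Ki _); rewrite leq_addr. }
have Xx : carrier X x.
  have [n /(_ n (leqnn n)) nP] := near_x 1 ltr01.
  have Xux : carrier X (u n - x).
    split; first by apply: measurable_funB => //; exact: (Xu _).1.
    by exists 1 => //; rewrite -invr1 (le_lt_trans nP)// ltry.
  by have := modular_carrier_linear (-1) Xux (Xu n); rewrite scaleN1r opprB subrK.
exists x => //; apply/cvgrPdist_le => e e0.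
have [n nP] := near_x e e0; near=> p.
rewrite sub0r normrN ger0_norm ?norm_ge0//; apply: norm_le => //; apply: nP.
by near: p; exists n.
Unshelve. all: by end_near. Qed.

Lemma modular_banach : banach X.
Proof.
split.
- split; last exact: modular_carrier_linear.
  by split; [exact: M0|exists 1 => //; rewrite scaler0 modular0].
- by move=> x Xx; split; [exact: norm_ge0|exact: norm_eq0].
- exact: normZ.
- exact: normD.
- exact: modular_complete.
Qed.

(** * Functions all of whose multiples have finite modular *)

Lemma modular_finite_carrier : E `<=` carrier X.
Proof. by move=> f [mf fE]; split=> //; exists 1 => //; exact: fE. Qed.

Lemma modular_halves f g : M f -> M g -> (rho (2 *: f) < +oo)%E ->
  (rho (2 *: g) < +oo)%E -> (rho (f + g)%R < +oo)%E.
Proof.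
move=> mf mg ff gg.
have -> : f + g = 2^-1 *: (2 *: f) + (1 - 2^-1) *: (2 *: g).
  rewrite !scalerA mulVf// scale1r; congr (_ + _).
  by rewrite (_ : (1 - 2^-1) * 2 = 1) ?scale1r//; field.
apply: le_lt_trans (modular_convex rhoP _ _ _) _; [exact: MZ|exact: MZ|lra|].
by apply: lte_add_pinfty; apply: lte_mul_pinfty; rewrite ?lee_fin//; lra.
Qed.

Lemma modular_finite_linear : linear_subspace E.
Proof.
split; first by split=> // c; rewrite scaler0 modular0 ltry.
move=> a f g [mf fE] [mg gE]; split=> [|c]; first by apply: MD => //; exact: MZ.
rewrite scalerDr; apply: modular_halves; rewrite ?scalerA; [|exact: MZ|exact: fE|exact: gE].
exact: MZ.
Qed.

Lemma modular_finite_le f g : M f -> E g ->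
  (\forall t \near N, `|f t| <= `|g t|) -> E f.
Proof.
move=> mf [mg gE] fg; split=> // c; apply: le_lt_trans (gE c).
apply: (modular_le rhoP); [exact: MZ|exact: MZ|].
by apply: filterS fg => t fgt; rewrite !normrM; apply: ler_wpM2l fgt.
Qed.

(** To control [c *: x], approximate [x] by [y] in [E] within [1 / (2 * |c| + 1)]: then
    [2 * c *: (x - y)] has modular at most 1, and [c *: x] is the midpoint of [2 * c *: (x - y)] and
    [2 * c *: y]. *)
Lemma modular_finite_closed x : carrier X x ->
  (forall e : R, 0 < e -> exists2 y, E y & norm (x - y) < e) -> E x.
Proof.
move=> Xx xE; split=> [|c]; first exact: Xx.1.
have k0 : 0 < 2 * `|c| + 1 by rewrite ltr_wpDl// mulr_ge0.
have [|y [my yE] xy] := xE (2 * `|c| + 1)^-1; first by rewrite invr_gt0.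
have mxy : M (x - y) by apply: measurable_funB => //; exact: Xx.1.
have -> : c *: x = c *: (x - y) + c *: y by rewrite -scalerDr subrK.
apply: modular_halves; [exact: MZ|exact: MZ| |by rewrite scalerA; exact: yE].
have Xxy : carrier X (x - y).
  rewrite addrC -scaleN1r; apply: modular_carrier_linear => //.
  by apply: modular_finite_carrier; split.
apply: le_lt_trans (ltry 1); apply: le_trans (norm_lt_modular Xxy xy).
apply: modular_leT => [| |t]; [exact/MZ/MZ|exact: MZ|].
rewrite invrK scalerA !normrM ler_wpM2r// normr_nat (gtr0_norm k0).
by rewrite lerDl.
Qed.

Lemma modular_finite_dominated f (u : nat -> T -> R) : E f ->
  (forall n, carrier X (u n)) ->
  (\forall t \near N, [/\ forall n, 0 <= u n t <= `|f t|,
     nonincreasing_seq (u ^~ t) & u n t @[n --> \oo] --> (0 : R)]) ->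
  norm (u n) @[n --> \oo] --> (0 : R).
Proof.
move=> [mf fE] Xu uP; apply/cvgrPdist_le => e e0.
have : rho (e^-1 *: u n) @[n --> \oo] --> 0%E.
{ apply: (modular_dominated rhoP (u := fun n => e^-1 *: u n) (f := e^-1 *: f)) => //.
  - by move=> n; apply: MZ; exact: (Xu n).1.
  - exact: MZ.
  - apply: filterS uP => t [uf ndu u0]; split.
  + move=> n; rewrite normrM (gtr0_norm (_ : 0 < e^-1)) ?invr_gt0//.
    have ie : 0 <= e^-1 by rewrite invr_ge0 ltW.
    have /andP[u1 u2] := uf n.
    by apply/andP; split; [exact: mulr_ge0|exact: ler_wpM2l].
  + by move=> m n mn; apply: ler_wpM2l; [rewrite invr_ge0 ltW|exact: ndu].
  + by rewrite -(mulr0 e^-1); apply: cvgM => //; exact: cvg_cst. }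
move=> /cvge0_near_lt/(_ lte01).
apply: filterS => n rn; rewrite sub0r normrN ger0_norm ?norm_ge0//.
by apply: norm_le => //; exact: ltW.
Qed.

Lemma indicC_fun (B : set T) t : \1_(~` B) t = 1 - \1_B t :> R.
Proof. by rewrite !indicE in_setC; case: (_ \in _); rewrite ?subrr ?subr0. Qed.

Lemma indic_split f (B : set T) : f = f \* \1_B + f \* \1_(~` B).
Proof.
apply/funext => t; transitivity (f t * \1_B t + f t * \1_(~` B) t) => //.
by rewrite indicC_fun; ring.
Qed.

Lemma normr_indic_le f (B : set T) t : `|(f \* \1_B) t| <= `|f t|.
Proof.
rewrite /= normrM ler_piMr// indicE normr_nat.
by case: (_ \in _).
Qed.

Lemma modular_carrier_indic f B : measurable B -> carrier X f ->
  carrier X (f \* \1_B).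
Proof.
move=> mB Xf; apply: modular_carrier_le (Xf) _; first by apply: MI => //; exact: Xf.1.
by apply: nearW => t; exact: normr_indic_le.
Qed.

Lemma norm_indic_le f B : measurable B -> carrier X f ->
  norm (f \* \1_B) <= norm f.
Proof.
move=> mB Xf; apply: norm_le_ae (Xf) _; first by apply: MI => //; exact: Xf.1.
by apply: nearW => t; exact: normr_indic_le.
Qed.

Lemma exhaustion_tail f (B : nat -> set T) t : exhaustion B ->
  [/\ forall n, 0 <= `|(f \* \1_(~` B n)) t| <= `|f t|,
     nonincreasing_seq (fun n => `|(f \* \1_(~` B n)) t|)
   & `|(f \* \1_(~` B n)) t| @[n --> \oo] --> (0 : R)].
Proof.
move=> [mB ndB cB]; split.
- by move=> n; rewrite normr_ge0 normr_indic_le.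
- move=> m n mn; rewrite /= !normrM ler_wpM2l// !indicE !normr_nat ler_nat.
  have [|nB] := boolP (t \in ~` B n); last by [].
  rewrite !inE => Bn; rewrite mem_set// => Bm; apply: Bn.
  by have /subsetPset := ndB _ _ mn; apply.
- have [n Bn] := cB t; apply: cvg_near_cst; exists n => // m nm /=.
  rewrite indicE memNset ?mulr0 ?normr0//; apply; have /subsetPset := ndB _ _ nm.
  by apply.
Qed.

Lemma exhaustion_tail_cvg0 f (B : nat -> set T) : E f -> exhaustion B ->
  norm (f \* \1_(~` B n)) @[n --> \oo] --> (0 : R).
Proof.
move=> fE Bex; have Xf := modular_finite_carrier fE.
have mB n : measurable (B n) by case: Bex.
have Xu n : carrier X (f \* \1_(~` B n)).
  by apply: modular_carrier_indic => //; exact: measurableC.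
have Xv n : carrier X (fun t => `|(f \* \1_(~` B n)) t|).
  apply: modular_carrier_le (Xu n) _; first by apply: Mnorm; exact: (Xu n).1.
  by apply: nearW => t; rewrite normr_id.
have := modular_finite_dominated fE Xv.
have /[swap]/[apply] : \forall t \near N,
    [/\ forall n, 0 <= `|(f \* \1_(~` B n)) t| <= `|f t|,
     nonincreasing_seq (fun n => `|(f \* \1_(~` B n)) t|)
   & `|(f \* \1_(~` B n)) t| @[n --> \oo] --> (0 : R)].
  by apply: nearW => t; exact: exhaustion_tail.
apply: (@squeeze_cvgr _ _ _ _ (cst 0)) => //; last exact: cvg_cst.
apply: nearW => n; rewrite norm_ge0 /=; apply: norm_le_ae (Xv n) _; first exact: (Xu n).1.
by apply: nearW => t; rewrite normr_id.
Qed.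

(** For an order-continuous [x], the tails of [|x|] off an exhaustion decrease to 0, so their norms
    tend to 0 and [x] is a limit of its truncations in the closed subspace [E]. The converse is
    dominated convergence at every scale. *)
Lemma modular_order_continuousE : order_continuous N X = E.
Proof.
apply/seteqP; split=> [x [Xx xP]|x xE].
  have [B Bex BE] := modular_exhaustion rhoP Xx.
  have mB n : measurable (B n) by case: Bex.
  have Xu n : carrier X (x \* \1_(~` B n)).
    by apply: modular_carrier_indic => //; exact: measurableC.
  have Xv n : carrier X (fun t => `|(x \* \1_(~` B n)) t|).
    apply: modular_carrier_le (Xu n) _; first by apply: Mnorm; exact: (Xu n).1.
    by apply: nearW => t; rewrite normr_id.
  have [|_ c0] := xP _ Xv; first by apply: nearW => t; exact: exhaustion_tail.
  apply: modular_finite_closed => // e e0.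
  have /cvgrPdist_lt/(_ e e0)[n _ /(_ n (leqnn n))] := c0.
  rewrite sub0r normrN ger0_norm ?norm_ge0// => nP.
  exists (x \* \1_(B n)) => //; apply: le_lt_trans nP.
  rewrite {1}(indic_split x (B n)) addrAC subrr add0r.
  apply: norm_le_ae (Xv n) _; first exact: (Xu n).1.
  by apply: nearW => t; rewrite normr_id.
split; first exact: modular_finite_carrier.
move=> u Xu uP; split; last exact: modular_finite_dominated uP.
move=> m n mn; apply: norm_le_ae (Xu m) _; first exact: (Xu n).1.
apply: filterS uP => t [u0 ndu _]; have /andP[n0 _] := u0 n; have /andP[m0 _] := u0 m.
by rewrite !ger0_norm//; exact: ndu.
Qed.

Lemma exhaustionI (A B : nat -> set T) : exhaustion A -> exhaustion B ->
  exhaustion (fun n => A n `&` B n).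
Proof.
move=> [mA ndA cA] [mB ndB cB]; split.
- by move=> n; exact: measurableI.
- move=> m n mn; apply/subsetPset; apply: setISS; apply/subsetPset; [exact: ndA|exact: ndB].
- move=> t; have [i Ai] := cA t; have [j Bj] := cB t; exists (maxn i j); split.
    by have /subsetPset := ndA _ _ (leq_maxl i j); apply.
  by have /subsetPset := ndB _ _ (leq_maxr i j); apply.
Qed.

Lemma modular_finite_indic f B : measurable B -> E f -> E (f \* \1_B).
Proof.
move=> mB fE; apply: modular_finite_le (fE) _; first by apply: MI => //; exact: fE.1.
by apply: nearW => t; exact: normr_indic_le.
Qed.

Lemma mulr_indicI f (A B : set T) : (f \* \1_A) \* \1_B = f \* \1_(A `&` B).
Proof. by apply/funext => t /=; rewrite indicI /= mulrA. Qed.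

(** * Continuous parts of functionals *)

Definition bounded_linear_on (G : (T -> R) -> R) :=
  (forall (a : R) f g, carrier X f -> carrier X g ->
     G (a *: f + g) = a * G f + G g) /\
  exists2 c : R, 0 <= c & forall f, carrier X f -> `|G f| <= c * norm f.

(* The order-continuous part of G: the limit of G (f \* \1_C) along the sets C
   such that f \* \1_C is order continuous. *)
Definition continuous_part (G : (T -> R) -> R) f : R :=
  let S := [set G (f \* \1_C) | C in
              [set C | measurable C /\ E (f \* \1_C)]] in
  sup S + inf S.

Section functional.
Variable G : (T -> R) -> R.
Hypothesis GP : bounded_linear_on G.

Lemma functionalD f g : carrier X f -> carrier X g -> G (f + g) = G f + G g.
Proof. by move=> Xf Xg; rewrite -[f]scale1r GP.1// mul1r scale1r. Qed.

Lemma functional_indic_split f B : carrier X f -> measurable B ->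
  G f = G (f \* \1_B) + G (f \* \1_(~` B)).
Proof.
move=> Xf mB; rewrite {1}(indic_split f B) functionalD//.
  exact: modular_carrier_indic.
by apply: modular_carrier_indic => //; exact: measurableC.
Qed.

Lemma functional_exhaustion f (B : nat -> set T) : E f -> exhaustion B ->
  G (f \* \1_(B n)) @[n --> \oo] --> G f.
Proof.
move=> fE Bex; have [_ [c c0 Gc]] := GP; have mB n : measurable (B n) by case: Bex.
have Xf := modular_finite_carrier fE.
have : c * norm (f \* \1_(~` B n)) @[n --> \oo] --> (0 : R).
  rewrite -(mulr0 c); apply: cvgM; first exact: cvg_cst.
  exact: exhaustion_tail_cvg0.
move=> /cvgrPdist_le tail; apply/cvgrPdist_le => e /tail; apply: filterS => n.
rewrite sub0r normrN (functional_indic_split Xf (mB n)) addrAC subrr add0r.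
apply: le_trans; apply: le_trans (ler_norm _); apply: Gc.
by apply: modular_carrier_indic => //; exact: measurableC.
Qed.

(** The map [C |-> G (f \* \1_C)] is additive, and as in a Hahn decomposition its supremum and
    infimum are its positive and negative masses. If [C1] nearly attains the supremum, then [G] is
    nearly [sup S] on the part of [B n] in [C1] and at least [inf S] on the rest, which bounds the
    value at [B n] below; a set [C2] near the infimum bounds it above. The limit does not depend on
    the exhaustion. *)
Lemma continuous_part_cvg f (B : nat -> set T) : carrier X f ->
  exhaustion B -> (forall n, E (f \* \1_(B n))) ->
  G (f \* \1_(B n)) @[n --> \oo] --> continuous_part G f.
Proof.
move=> Xf Bex BE; have [_ [c c0 Gc]] := GP; have mB n : measurable (B n) by case: Bex.
rewrite /continuous_part; set S := (X in sup X + inf X).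
have S0 : S !=set0 by exists (G (f \* \1_(B 0%N))), (B 0%N).
have Sb : forall y : R, S y -> `|y| <= c * norm f.
  move=> _ [C [mC CE] <-]; apply: le_trans (Gc _ _) _; first exact: modular_carrier_indic.
  by apply: ler_wpM2l => //; exact: norm_indic_le.
have Ssup : has_sup S.
  by split=> //; exists (c * norm f) => y /Sb; rewrite ler_norml => /andP[].
have Sinf : has_inf S.
  by split=> //; exists (- (c * norm f)) => y /Sb; rewrite ler_norml => /andP[].
have leS C : measurable C -> E (f \* \1_C) -> inf S <= G (f \* \1_C) <= sup S.
  move=> mC CE; have SG : S (G (f \* \1_C)) by exists C.
  by apply/andP; split; [apply: ge_inf (proj2 Sinf) _ _|apply: ub_le_sup (proj2 Ssup) _ _].
apply/cvgrPdist_le => e e0; have e20 : 0 < e / 2 by rewrite divr_gt0.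
have [_ [C1 [mC1 C1E] <-] C1S] := sup_adherent e20 Ssup.
have [_ [C2 [mC2 C2E] <-] C2S] := inf_adherent e20 Sinf.
have /cvgrPdist_le/(_ _ e20) n1 := functional_exhaustion C1E Bex.
have /cvgrPdist_le/(_ _ e20) n2 := functional_exhaustion C2E Bex.
near=> n.
have : `|G (f \* \1_C1) - G ((f \* \1_C1) \* \1_(B n))| <= e / 2 by near: n.
have : `|G (f \* \1_C2) - G ((f \* \1_C2) \* \1_(B n))| <= e / 2 by near: n.
have part C : measurable C -> G (f \* \1_(B n)) =
    G ((f \* \1_C) \* \1_(B n)) + G (f \* \1_(B n `&` ~` C)).
  move=> mC; rewrite (functional_indic_split _ mC); last exact: modular_carrier_indic.
  by rewrite !mulr_indicI setIC.
have mCB C : measurable C -> measurable (B n `&` ~` C).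
  by move=> mC; apply: measurableI => //; exact: measurableC.
have CBE C : measurable C -> E (f \* \1_(B n `&` ~` C)).
  by move=> mC; rewrite -mulr_indicI; apply: modular_finite_indic => //; exact: measurableC.
have := leS _ (mCB _ mC1) (CBE _ mC1); have := leS _ (mCB _ mC2) (CBE _ mC2).
have := part _ mC1; have := part _ mC2.
rewrite !ler_norml => p2 p1 /andP[a1 a2] /andP[b1 b2] /andP[c1 c2] /andP[d1 d2].
by apply/andP; split; lra.
Unshelve. all: by end_near. Qed.

Lemma continuous_part_finite f : E f -> continuous_part G f = G f.
Proof.
move=> fE; have Xf := modular_finite_carrier fE.
have [B Bex BE] := modular_exhaustion rhoP Xf.
have c1 := continuous_part_cvg Xf Bex BE; have c2 := functional_exhaustion fE Bex.
exact: cvg_unique c1 c2.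
Qed.

(** The expression [sup S + inf S] is not visibly linear in [f]; linearity comes from the limits
    along an exhaustion common to [f] and [g]. *)
Lemma continuous_part_linear (a : R) f g : carrier X f -> carrier X g ->
  continuous_part G (a *: f + g) = a * continuous_part G f + continuous_part G g.
Proof.
move=> Xf Xg; have [A Aex AE] := modular_exhaustion rhoP Xf.
have [B Bex BE] := modular_exhaustion rhoP Xg.
have ABex := exhaustionI Aex Bex.
have fE n : E (f \* \1_(A n `&` B n)).
  by rewrite -mulr_indicI; apply: modular_finite_indic => //; case: Bex.
have gE n : E (g \* \1_(A n `&` B n)).
  by rewrite setIC -mulr_indicI; apply: modular_finite_indic => //; case: Aex.
have fgB C : (a *: f + g) \* \1_C = a *: (f \* \1_C) + g \* \1_C.
  apply/funext => t; transitivity ((a * f t + g t) * \1_C t) => //.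
  transitivity (a * (f t * \1_C t) + g t * \1_C t) => //; ring.
have fgE n : E ((a *: f + g) \* \1_(A n `&` B n)).
  by rewrite fgB; apply: modular_finite_linear.2.
have := continuous_part_cvg (modular_carrier_linear a Xf Xg) ABex fgE.
rewrite (_ : (fun n => G _) = fun n =>
    a * G (f \* \1_(A n `&` B n)) + G (g \* \1_(A n `&` B n))); last first.
  apply/funext => n; rewrite fgB GP.1//; exact: modular_finite_carrier.
move=> c1; apply: cvg_unique c1 _ => //; apply: cvgD.
  by apply: cvgM; [exact: cvg_cst|exact: continuous_part_cvg].
exact: continuous_part_cvg.
Qed.

Lemma continuous_part_bounded : bounded_linear_on (continuous_part G).
Proof.
have [_ [c c0 Gc]] := GP.
split; first exact: continuous_part_linear.
exists c => // f Xf; have [B Bex BE] := modular_exhaustion rhoP Xf.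
have cB : `|G (f \* \1_(B n))| @[n --> \oo] --> `|continuous_part G f|.
  by apply: cvg_norm; exact: continuous_part_cvg.
rewrite -(cvg_lim _ cB)//; apply: limr_le; first by apply/cvg_ex; eexists; exact: cB.
apply: nearW => n; have mB : measurable (B n) by case: Bex.
apply: le_trans (Gc _ (modular_finite_carrier (BE n))) _.
by apply: ler_wpM2l => //; exact: norm_indic_le.
Qed.

(* The functions (1 - e) f \1_B + g \1_(~` B) nearly have modular at most 1 when
   B is large; they carry both the continuous part of f and the singular
   part of g. *)
Lemma functional_split_norm (f g : T -> R) (K : R) : carrier X f -> carrier X g ->
  norm f <= 1 -> norm g <= 1 ->
  (forall h, carrier X h -> norm h <= 1 -> G h <= K) ->
  continuous_part G f + (G g - continuous_part G g) <= K.
Proof.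
move=> Xf Xg f1 g1 GK; have [A Aex AE] := modular_exhaustion rhoP Xf.
have [B Bex BE] := modular_exhaustion rhoP Xg.
have ABex := exhaustionI Aex Bex; have [mAB ndAB cAB] := ABex.
have fE n : E (f \* \1_(A n `&` B n)).
  by rewrite -mulr_indicI; apply: modular_finite_indic => //; case: Bex.
have gE n : E (g \* \1_(A n `&` B n)).
  by rewrite setIC -mulr_indicI; apply: modular_finite_indic => //; case: Aex.
have rho1 h : carrier X h -> norm h <= 1 -> (rho h <= 1)%E.
  by move=> Xh /(norm_modular Xh ltr01); rewrite invr1 scale1r.
have Xtail n : carrier X (g \* \1_(~` (A n `&` B n))).
  by apply: modular_carrier_indic => //; exact: measurableC.
(* Only the modular of the tail is claimed to vanish; [g] is merely in the carrier, and the norms of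
   its tails may stay away from 0. *)
have tail0 : rho (g \* \1_(~` (A n `&` B n))) @[n --> \oo] --> 0%E.
  have c0 : rho (fun t => `|(g \* \1_(~` (A n `&` B n))) t|) @[n --> \oo] --> 0%E.
  { apply: (modular_dominated rhoP (u := fun n t => `|(g \* \1_(~` (A n `&` B n))) t|)
       (f := g)).
    - by move=> n; apply: Mnorm; exact: (Xtail n).1.
    - exact: Xg.1.
    - by apply: nearW => t; exact: exhaustion_tail.
    - by apply: le_lt_trans (rho1 _ Xg g1) _; rewrite ltry. }
  rewrite (_ : (fun n => rho (g \* _)) =
      fun n => rho (fun t => `|(g \* \1_(~` (A n `&` B n))) t|))//.
  apply/funext => n; apply/eqP; rewrite eq_le; apply/andP; split.
    apply: modular_leT; [exact: (Xtail n).1|by apply: Mnorm; exact: (Xtail n).1|].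
    by move=> t; rewrite normr_id.
  apply: modular_leT; [by apply: Mnorm; exact: (Xtail n).1|exact: (Xtail n).1|].
  by move=> t; rewrite normr_id.
have main (e : R) : 0 < e < 1 ->
    (1 - e) * continuous_part G f + (G g - continuous_part G g) <= K.
{ move=> /andP[e0 e1].
  have cv : (1 - e) * G (f \* \1_(A n `&` B n)) + (G g - G (g \* \1_(A n `&` B n)))
      @[n --> \oo] --> (1 - e) * continuous_part G f + (G g - continuous_part G g).
    apply: cvgD; first by apply: cvgM; [exact: cvg_cst|exact: continuous_part_cvg].
    by apply: cvgB; [exact: cvg_cst|exact: continuous_part_cvg].
  rewrite -(cvg_lim _ cv)//; apply: limr_le; first by apply/cvg_ex; eexists; exact: cv.
  have e0E : (0 < e%:E)%E by rewrite lte_fin.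
  have := cvge0_near_lt tail0 e0E; apply: filterS => n ne.
  have Gg : G g - G (g \* \1_(A n `&` B n)) = G (g \* \1_(~` (A n `&` B n))).
    by rewrite (functional_indic_split Xg (mAB n)) addrAC subrr add0r.
  have XfAB := modular_finite_carrier (fE n).
  rewrite Gg -GP.1//; apply: GK; first exact: modular_carrier_linear.
  apply: norm_le => //; rewrite invr1 scale1r.
  apply: le_trans (modular_disjoint rhoP _ _ _) _.
  - by apply: MZ; exact: XfAB.1.
  - exact: (Xtail n).1.
  - move=> t; have [tAB|tAB] := boolP (t \in A n `&` B n).
      by right; rewrite /= indicC_fun indicE tAB subrr mulr0.
    left; transitivity ((1 - e) * (f t * \1_(A n `&` B n) t)) => //.
    by rewrite indicE (negbTE tAB) !mulr0.
  - apply: (@le_trans _ _ ((1 - e)%:E * 1 + e%:E)%E); last first.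
      by rewrite mule1 -EFinD subrK.
    apply: leeD; last exact: ltW.
    apply: le_trans (modular_scale _ _) _; [exact: XfAB.1|lra|].
    apply: lee_pmul => //; first (by rewrite lee_fin subr_ge0 ltW); first exact: (modular_ge0 rhoP).
    by apply: rho1 => //; apply: le_trans f1; exact: norm_indic_le. }
set a := continuous_part G f in main *; set b := (X in _ + X <= _).
rewrite leNgt; apply/negP => Kab.
have m : 0 < `|a| + 1 by rewrite ltr_wpDl.
(* If [a + b] exceeded [K], this [e] would make the loss [e * |a|] at most half of the gap, against
   [main]. *)
pose e := Num.min (2^-1) ((a + b - K) / (2 * (`|a| + 1))).
have e0 : 0 < e by rewrite lt_min invr_gt0 ltr0n/= divr_gt0 ?subr_gt0 ?mulr_gt0.
have e1 : e < 1 by rewrite gt_min; apply/orP; left; lra.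
have := main e; rewrite e0 e1 => /(_ isT).
have : e * (2 * (`|a| + 1)) <= a + b - K.
  by rewrite -ler_pdivlMr ?mulr_gt0// ge_min lexx orbT.
have : e * a <= e * `|a| by apply: ler_wpM2l; [exact: ltW|exact: ler_norm].
have : 0 <= e * `|a| by apply: mulr_ge0; [exact: ltW|].
rewrite -/b; nra.
Qed.

End functional.

(** * The dual space and the projection onto singular parts *)

Let Xspace (x : carrier X) : carrier X (\val x).
Proof. exact: set_valP. Qed.

Let X0 : carrier X 0. Proof. by case: modular_banach => [[]]. Qed.

Let norm0 : norm 0 = 0.
Proof. by apply/norm_eq0 => //; exact: nearW. Qed.

(** Elements of the dual are functions on the carrier seen as a type; extension by 0 makes them
    functions on all of [T -> R], to which [continuous_part] applies. *)
Definition on_vectors (F : carrier X -> R) f : R := oapp F 0 (insub f).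

Lemma on_vectorsE (F : carrier X -> R) (x : carrier X) : on_vectors F (\val x) = F x.
Proof. by rewrite /on_vectors valK. Qed.

Lemma carrier_val f : carrier X f -> exists x : carrier X, \val x = f.
Proof. by move=> Xf; exists (SigSub (mem_set Xf)). Qed.

Local Notation Xdual := (@dual R (T -> R : lmodType R) X).

Lemma dual_on_vectors F : Xdual F -> bounded_linear_on (on_vectors F).
Proof.
move=> [Flin [c Fc]]; split.
  move=> a f g /carrier_val[x <-] /carrier_val[y <-].
  have [z zE] := carrier_val (modular_carrier_linear a (Xspace x) (Xspace y)).
  by rewrite -zE !on_vectorsE; exact: Flin.
exists (Num.max c 0); first by rewrite le_max lexx orbT.
move=> f /carrier_val[x <-]; rewrite on_vectorsE; apply: le_trans (Fc x) _.
by apply: ler_wpM2r; [exact: norm_ge0|rewrite le_max lexx].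
Qed.

Lemma dual_restrict G : bounded_linear_on G -> Xdual (fun x => G (\val x)).
Proof.
move=> [Glin [c c0 Gc]]; split; last by exists c => x; exact: Gc.
by move=> a x y z ->; exact: Glin.
Qed.

Lemma dualB F H : Xdual F -> Xdual H -> Xdual (fun x => F x - H x).
Proof.
move=> [Fl [c Fc]] [Hl [k Hk]]; split.
  by move=> a x y z zE; rewrite (Fl _ _ _ _ zE) (Hl _ _ _ _ zE); ring.
exists (c + k) => x; apply: le_trans (ler_normB _ _) _.
by rewrite mulrDl lerD.
Qed.

Lemma dual_norm_ub F (x : carrier X) : Xdual F -> norm (\val x) <= 1 -> `|F x| <= dual_norm F.
Proof.
move=> [_ [c Fc]] x1; apply: ub_le_sup; last by exists x.
exists (Num.max c 0) => _ [y /= y1 <-]; apply: le_trans (Fc y) _.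
apply: (@le_trans _ _ (Num.max c 0 * norm (\val y))).
  by apply: ler_wpM2r; [exact: norm_ge0|rewrite le_max lexx].
by rewrite -[leRHS]mulr1; apply: ler_wpM2l => //; rewrite le_max lexx orbT.
Qed.

Lemma dual_norm_le F (K : R) : (forall x : carrier X, norm (\val x) <= 1 -> `|F x| <= K) ->
  dual_norm F <= K.
Proof.
move=> FK; apply: sup_le_ub; last by move=> _ [x x1 <-]; exact: FK.
have [x xE] := carrier_val X0.
have nx : norm (\val x) <= 1 by rewrite xE norm0.
by exists `|F x|; exists x.
Qed.

Let P (F : carrier X -> R) := fun x : carrier X =>
  F x - continuous_part (on_vectors F) (\val x).

Let dualP F : Xdual F -> Xdual (P F).
Proof.
move=> FX; apply: dualB => //; apply: dual_restrict.
by apply: continuous_part_bounded; exact: dual_on_vectors.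
Qed.

Let P_annihilates F (x : carrier X) : Xdual F -> E (\val x) -> P F x = 0.
Proof.
move=> FX xE; rewrite /P continuous_part_finite ?on_vectorsE ?subrr//.
exact: dual_on_vectors.
Qed.

(** A functional that vanishes on [E] vanishes on all truncations of [x], so its continuous part is
    a limit of zeros. *)
Let P_id F : @annihilator R (T -> R : lmodType R) X E F -> P F = F.
Proof.
move=> [FX FE]; apply/funext => x; rewrite /P.
have [B Bex BE] := modular_exhaustion rhoP (Xspace x).
have := continuous_part_cvg (dual_on_vectors FX) (Xspace x) Bex BE.
rewrite (_ : (fun n => on_vectors F _) = cst 0).
  by move=> c; rewrite (cvg_unique _ c (cvg_cst _)) ?subr0.
apply/funext => n; have [y yE] := carrier_val (modular_finite_carrier (BE n)).
by rewrite -yE on_vectorsE FE// yE.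
Qed.

(** Subadditivity gives one inequality. For the other, the two suprema run over independent points
    [y] and [x]; signs [s] and [t] turn absolute values into values, and [functional_split_norm]
    applies to [t *: x] and [s *: y]. *)
Let P_norm F : Xdual F ->
  dual_norm F = dual_norm (P F) + dual_norm (fun x => F x - P F x).
Proof.
move=> FX; have FG := dual_on_vectors FX; set G := on_vectors F in FG *.
have HE : (fun x => F x - P F x) = fun x => continuous_part G (\val x).
  by apply/funext => x; rewrite /P opprB addrC subrK.
have HX : Xdual (fun x => continuous_part G (\val x)).
  by apply: dual_restrict; exact: continuous_part_bounded.
apply/eqP; rewrite eq_le; apply/andP; split.
  apply: dual_norm_le => x x1.
  rewrite -(subrK (P F x) (F x)) addrC; apply: le_trans (ler_normD _ _) _.
  apply: lerD; first by apply: dual_norm_ub => //; exact: dualP.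
  by apply: (dual_norm_ub (F := fun x => F x - P F x)) => //; rewrite HE.
rewrite HE -lerBrDr; apply: dual_norm_le => y y1.
rewrite lerBrDl -lerBrDr; apply: dual_norm_le => x x1.
rewrite lerBrDl.
have sgn (r : R) : exists2 s : R, `|s| = 1 & `|r| = s * r.
  have [r0|r0] := leP 0 r; first by exists 1; rewrite ?normr1 ?ger0_norm ?mul1r.
  by exists (-1); rewrite ?normrN1 ?ltr0_norm ?mulN1r.
have [s s1 ->] := sgn (P F y); have [t t1 ->] := sgn (continuous_part G (\val x)).
have scale (a : R) (z : carrier X) : `|a| = 1 -> norm (\val z) <= 1 ->
    carrier X (a *: \val z) /\ norm (a *: \val z) <= 1.
  move=> a1 z1; split; last by rewrite normZ// a1 mul1r.
  by rewrite -[_ *: _]addr0; exact: modular_carrier_linear.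
have [Xy ny] := scale _ _ s1 y1; have [Xx nx] := scale _ _ t1 x1.
have GZ (H : (T -> R) -> R) (a : R) (z : carrier X) : bounded_linear_on H ->
    H (a *: \val z) = a * H (\val z).
  move=> HP; have H0 : H 0 = 0.
    have := HP.1 1 0 0 X0 X0; rewrite scale1r addr0 mul1r => /eqP.
    by rewrite -subr_eq subrr eq_sym => /eqP.
  by rewrite -[_ *: _]addr0 HP.1// H0 addr0.
have := functional_split_norm FG Xx Xy nx ny (K := dual_norm F).
rewrite !GZ//; try exact: continuous_part_bounded.
rewrite -mulrBr /P -on_vectorsE -/G addrC; apply => h /carrier_val[z <-] z1.
by rewrite /G on_vectorsE; apply: le_trans (ler_norm _) _; exact: dual_norm_ub.
Qed.

Theorem modular_M_ideal : M_ideal X (order_continuous N X).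
Proof.
rewrite modular_order_continuousE; split; first exact: modular_banach.
  split; [exact: modular_finite_carrier|exact: modular_finite_linear|].
  exact: modular_finite_closed.
exists P; split.
- split.
  + exact: dualP.
  (* Linearity of the continuous part in the functional is again read off the limits along one
     exhaustion for [x]. *)
  + move=> a F H FX HX; apply/funext => x; rewrite /P.
    have [B Bex BE] := modular_exhaustion rhoP (Xspace x).
    have cF := continuous_part_cvg (dual_on_vectors FX) (Xspace x) Bex BE.
    have cH := continuous_part_cvg (dual_on_vectors HX) (Xspace x) Bex BE.
    have FHX : Xdual (fun x => a * F x + H x).
      have [Fl [c Fc]] := FX; have [Hl [k Hk]] := HX; split.
        by move=> b y z t tE; rewrite (Fl _ _ _ _ tE) (Hl _ _ _ _ tE); ring.
      exists (`|a| * c + k) => y; apply: le_trans (ler_normD _ _) _.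
      by rewrite normrM mulrDl -mulrA lerD// ler_wpM2l.
    have cFH := continuous_part_cvg (dual_on_vectors FHX) (Xspace x) Bex BE.
    rewrite (cvg_unique _ cFH (_ : _ --> a * continuous_part (on_vectors F) (\val x)
       + continuous_part (on_vectors H) (\val x))) //; first by ring.
    rewrite (_ : (fun n => on_vectors (fun x => a * F x + H x) _) =
       (fun n => a * on_vectors F (\val x \* \1_(B n)) + on_vectors H (\val x \* \1_(B n)))).
      by apply: cvgD => //; apply: cvgM => //; exact: cvg_cst.
    apply/funext => n; have [y <-] := carrier_val (modular_finite_carrier (BE n)).
    by rewrite !on_vectorsE.
  + exists 1 => F FX; rewrite mul1r (P_norm FX) lerDl.
    have [x xE] := carrier_val X0.
    apply: le_trans (normr_ge0 _) (dual_norm_ub (x := x) _ _); last by rewrite xE norm0.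
    by apply: dualB => //; exact: dualP.
  + by move=> F FX; apply: P_id; split; [exact: dualP|move=> x; exact: P_annihilates].
- apply/seteqP; split=> [_ [F FX <-]|F FE].
    by split; [exact: dualP|move=> x; exact: P_annihilates].
  by exists F; [exact: FE.1|exact: P_id].
- exact: P_norm.
Qed.

Theorem modular_nontrivial_M_ideal :
  (exists2 y, E y & ~ null X y) -> (exists2 x, carrier X x & ~ E x) ->
  nontrivial_M_ideal X (order_continuous N X).
Proof.
move=> Ey xE; split; first exact: modular_M_ideal.
- by rewrite modular_order_continuousE.
- by rewrite modular_order_continuousE.
Qed.

End modular.

(** The rearrangement modular will be identified with a Choquet integral on measurable functions
    only, while [modular_ge0] speaks of all functions: hence the two separate hypotheses on
    [rho']. *)
Lemma eq_lattice_modular d (T : measurableType d) (R : realType) (D : set T)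
    (N : set_system T) (rho rho' : (T -> R) -> \bar R) :
  lattice_modular D N rho -> (forall f, (0 <= rho' f)%E) ->
  (forall f, measurable_fun D f -> rho' f = rho f) -> lattice_modular D N rho'.
Proof.
move=> rhoP rho'0 E.
have MZ (a : R) (f : T -> R) : measurable_fun D f -> measurable_fun D (a *: f).
  by move=> mf; apply: measurable_funM.
have MD (f g : T -> R) : measurable_fun D f -> measurable_fun D g -> measurable_fun D (f + g).
  by move=> mf mg; apply: measurable_funD.
split.
- exact: modular_meas rhoP.
- exact: modular_filter rhoP.
- exact: rho'0.
- by move=> f mf; rewrite E//; exact: (modular_eq0 rhoP).
- by move=> f g mf mg fg; rewrite !E//; exact: (modular_le rhoP).
- move=> a f g mf mg a01; rewrite !E//; first exact: (modular_convex rhoP).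
  by apply: MD; exact: MZ.
- by move=> f g mf mg fg; rewrite !E//; [exact: (modular_disjoint rhoP)|exact: MD].
- move=> u f mu mf uf u1; rewrite E//; apply: (modular_fatou rhoP mu mf uf) => n.
  by rewrite -E.
- move=> u f mu mf uf; rewrite E// => /(modular_dominated rhoP mu mf uf).
  by rewrite [X in _ -> X @ _ --> _](_ : _ = rho \o u)//; apply/funext => n /=; rewrite E.
- move=> f [mf [lam lam0 flam]].
  have [|B Bex BE] := modular_exhaustion rhoP (f := f).
    by split=> //; exists lam => //; rewrite -E//; exact: MZ.
  exists B => // n; have [mfB fB] := BE n; split=> // c.
  by rewrite E//; exact: MZ.
Qed.

Set Bullet Behavior "None".

(** * Level sets and Choquet integrals *)

Lemma integral_sections d1 d2 (T1 : measurableType d1) (T2 : measurableType d2)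
    (R : realType) (m1 : {sigma_finite_measure set T1 -> \bar R})
    (m2 : {sigma_finite_measure set T2 -> \bar R}) (A : set (T1 * T2)) :
  measurable A ->
  (\int[m1]_x m2 (xsection A x) = \int[m2]_y m1 (ysection A y))%E.
Proof.
move=> mA.
have mf : measurable_fun setT (EFin \o (\1_A : T1 * T2 -> R)).
  by apply/measurable_EFinP; exact: measurable_indic.
have := fubini_tonelli (m1 := m1) (m2 := m2) (EFin \o \1_A) mf.
have f0 z : (0 <= (EFin \o (\1_A : T1 * T2 -> R)) z)%E by rewrite lee_fin indicE.
move=> /(_ f0).
have -> : (fun x => \int[m2]_y (EFin \o (\1_A : T1 * T2 -> R)) (x, y))%E = fun x => m2 (xsection A x).
  apply/funext => x; rewrite -(setIT (xsection A x)) -integral_indic//; last exact: measurable_xsection.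
  by apply: eq_integral => y _; rewrite /= !indicE mem_xsection.
have -> : (fun y => \int[m1]_x (EFin \o (\1_A : T1 * T2 -> R)) (x, y))%E = fun y => m1 (ysection A y).
  apply/funext => y; rewrite -(setIT (ysection A y)) -integral_indic//; last exact: measurable_ysection.
  by apply: eq_integral => x _; rewrite /= !indicE mem_ysection.
by [].
Qed.

Lemma mem_set_itv (R : realType) (i : interval R) (l : R) :
  (l \in [set` i]) = (l \in i).
Proof. by apply/idP/idP => [/set_mem//|?]; exact/mem_set. Qed.

Section levels.
Context d (T : measurableType d) (R : realType).
Variables (mu : {sigma_finite_measure set T -> \bar R}) (D : set T).
Hypothesis mD : measurable D.
Local Notation leb := (@lebesgue_measure R).
Local Notation M := (@measurable_fun _ _ T R D).
Implicit Types (h g : T -> R) (s : \bar R).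

(** The condition [0 < l] makes this vanish for nonpositive levels, so that integrals over levels
    can run over the whole line. *)
Definition overlevel h (l : R) : \bar R := mu [set t | D t /\ 0 < l < h t].

Lemma measurable_hypograph h (c : R) : M h ->
  measurable [set z : T * measurableTypeR R | D z.1 /\ c < z.2 < h z.1].
Proof.
move=> mh; pose k := h \_ D.
have mk : measurable_fun setT k by apply/(measurable_restrictT _ _).1.
have m1 : measurable_fun setT (k \o fst : T * measurableTypeR R -> R).
  exact: measurableT_comp.
have m2 : measurable_fun setT (snd : T * measurableTypeR R -> R) by exact: measurable_snd.
have mA : measurable [set z : T * measurableTypeR R | z.2 < k z.1].
  have := measurable_lte measurableT (f := EFin \o snd) (g := EFin \o (k \o fst)).
  rewrite setTI; apply; exact/measurable_EFinP.
have mB : measurable [set z : T * measurableTypeR R | c < z.2].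
  have := measurable_lte measurableT (f := cst c%:E : T * measurableTypeR R -> \bar R) (g := EFin \o snd).
  rewrite setTI; apply; [exact: measurable_cst|exact/measurable_EFinP].
have mC : measurable (D `*` [set: measurableTypeR R]) by apply: measurableX.
rewrite (_ : [set z | _] = D `*` setT `&` [set z | z.2 < k z.1] `&` [set z | c < z.2]).
  by apply: measurableI => //; exact: measurableI.
apply/seteqP; split=> [[t l]|[t l]] /=.
  by move=> [Dt /andP[cl lh]]; rewrite /k patchE mem_set.
by move=> [[[Dt _]]]; rewrite /k patchE mem_set// => lh ->.
Qed.

Lemma overlevel_ysection h l :
  overlevel h l = mu (ysection [set z : T * measurableTypeR R | D z.1 /\ 0 < z.2 < h z.1] l).
Proof. by congr (mu _); apply/seteqP; split => t; rewrite /ysection/= inE. Qed.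

Lemma measurable_overlevel h : M h ->
  measurable_fun setT (overlevel h : measurableTypeR R -> \bar R).
Proof.
move=> mh; rewrite (_ : overlevel h = fun l => mu (ysection
  [set z : T * measurableTypeR R | D z.1 /\ 0 < z.2 < h z.1] l)).
  exact: measurable_fun_ysection (measurable_hypograph 0 mh).
by apply/funext => l; exact: overlevel_ysection.
Qed.

Lemma overlevel_set_measurable h (l : R) : M h ->
  measurable [set t | D t /\ 0 < l < h t].
Proof.
move=> mh; have := measurable_ysection l (measurable_hypograph 0 mh).
rewrite (_ : ysection _ _ = [set t | D t /\ 0 < l < h t])//.
by apply/seteqP; split => t; rewrite /ysection/= inE.
Qed.

Lemma overlevel_le h g l : M h -> M g ->
  (\forall t \ae mu, D t -> h t <= g t) -> (overlevel h l <= overlevel g l)%E.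
Proof.
move=> mh mg [N [mN N0 subN]].
have mhl := overlevel_set_measurable l mh; have mgl := overlevel_set_measurable l mg.
apply: (@le_trans _ _ (mu ([set t | D t /\ 0 < l < g t] `|` N))).
  apply: le_measure; rewrite ?inE//; first exact: measurableU.
  move=> t [Dt /andP[l0 lh]]; have [hg|hg] := pselect (h t <= g t).
    by left; split=> //; rewrite l0 (lt_le_trans lh).
  by right; apply: subN => /(_ Dt).
apply: le_trans (measureU2 _ _ _) _ => //.
by rewrite [X in (_ + X)%E](_ : _ = 0%E) ?adde0//; exact: N0.
Qed.

Lemma overlevel_decr h (k l : R) : M h -> 0 < k -> k <= l ->
  (overlevel h l <= overlevel h k)%E.
Proof.
move=> mh k0 kl; apply: le_measure; rewrite ?inE; [exact: overlevel_set_measurable..|].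
by move=> t [Dt /andP[_ lh]]; split=> //; rewrite k0 (le_lt_trans kl).
Qed.

Lemma overlevel_npos h (l : R) : l <= 0 -> overlevel h l = 0%E.
Proof.
move=> l0; rewrite /overlevel (_ : [set t | _] = set0) ?measure0//.
by apply/seteqP; split=> // t [_ /andP[]]; rewrite ltNge l0.
Qed.

(** Both sides are the measure of the region between the height [c] and the graph of [h], computed
    by sections in the two directions. *)
Lemma layer_cake h (c : R) : 0 <= c -> M h ->
  (\int[leb]_(l in `]c, +oo[) overlevel h l =
   \int[mu]_(t in D) (Num.max (h t - c) 0)%:E)%E.
Proof.
move=> c0 mh; pose A := [set z : T * measurableTypeR R | D z.1 /\ c < z.2 < h z.1].
have mA : measurable A by exact: measurable_hypograph.
have := integral_sections mu leb mA => E.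
rewrite [LHS]integral_mkcond [RHS]integral_mkcond; transitivity (\int[leb]_y mu (ysection A y))%E.
  apply: eq_integral => l _; rewrite patchE.
  rewrite mem_set_itv in_itv/= andbT; case: ifPn => cl.
    congr (mu _); apply/seteqP; split=> t; rewrite /ysection/= inE /A /=.
      by move=> [Dt /andP[_ ->]]; rewrite cl.
    by move=> [Dt /andP[_ ->]]; rewrite (le_lt_trans c0).
  rewrite (_ : ysection _ _ = set0) ?measure0//; apply/seteqP; split=> // t.
  by rewrite /ysection/= inE /A /= => -[_ /andP[cl' _]]; move: cl; rewrite cl'.
rewrite -E; apply: eq_integral => t _; rewrite patchE; case: ifPn => [|] Dt.
  rewrite (_ : xsection A t = `]c, h t[%classic); last first.
    rewrite inE in Dt; apply/seteqP; split=> l; rewrite /xsection/= inE /A /= in_itv/=.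
      by move=> [].
    by split.
  rewrite /= lebesgue_measure_itv /= lte_fin; have [ch|hc] := ltP c (h t).
    by rewrite -EFinB max_l// subr_ge0 ltW.
  by rewrite max_r// subr_le0.
rewrite (_ : xsection A t = set0) ?measure0//; apply/seteqP; split=> // l.
by rewrite /xsection/= inE /A /= => -[Dt' _]; move: Dt; rewrite mem_set.
Qed.

(* In rearrangement terms, this is the integral of the decreasing rearrangement
   of h over ]0, s[. *)
Definition truncated_levels s h : \bar R :=
  (\int[leb]_l mine s (overlevel h l))%E.

Local Notation K := truncated_levels.

Let ov0 h l : (0 <= overlevel h l)%E. Proof. exact: measure_ge0. Qed.

Let mov h s : M h -> measurable_fun setT (fun l : measurableTypeR R => mine s (overlevel h l)).
Proof. by move=> mh; apply: measurable_mine => //; exact: measurable_overlevel. Qed.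

(** The minimum is bounded by [s] for levels up to [c] and by the level measure beyond; the latter
    part is a layer cake. *)
Lemma truncated_levels_le s h (c : R) : (0 <= s)%E -> 0 <= c -> M h ->
  (K s h <= s * c%:E + \int[mu]_(t in D) (Num.max (h t - c) 0)%:E)%E.
Proof.
move=> s0 c0 mh; rewrite -layer_cake//.
have -> : (s * c%:E = \int[leb]_l (cst s \_ `]0%R, c]) l)%E.
  rewrite -integral_mkcond integral_cst//= lebesgue_measure_itv /= lte_fin.
  by have [//|c0'] := ltP 0 c; [rewrite sube0|rewrite (@le_anti _ _ c 0) ?c0' ?c0// mule0].
rewrite [X in (_ + X)%E]integral_mkcond -ge0_integralD//; first last.
- apply/(measurable_restrictT _ _).1 => //; apply: measurable_funTS.
  exact: measurable_overlevel.
- by move=> l _; apply: erestrict_ge0.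
- by apply/(measurable_restrictT _ _).1.
- by move=> l _; apply: erestrict_ge0.
apply: ge0_le_integral => //.
- by move=> l _; rewrite le_min s0 ov0.
- exact: mov.
- apply: emeasurable_funD; first by apply/(measurable_restrictT _ _).1.
  by apply/(measurable_restrictT _ _).1 => //; apply: measurable_funTS; exact: measurable_overlevel.
move=> l _; rewrite !patchE !mem_set_itv !in_itv/= andbT; have [l0|l0] := leP l 0.
  by rewrite overlevel_npos// (min_r s0) /= adde_ge0//; case: ifPn.
have [lc|cl] := leP l c; rewrite /= ?adde0 ?add0e ?ge_min ?lexx ?orbT//.
Qed.

(** The optimal [c] is the infimum of the levels [l] with [overlevel h l <= s]: the minimum is [s]
    below it and the level measure above it. For [s = +oo] the minimum is always the level measure,
    and [c = 0]. *)
Lemma truncated_levels_ge s h : (0 < s)%E -> M h -> (K s h < +oo)%E ->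
  exists2 c : R, 0 <= c &
  (s * c%:E + \int[mu]_(t in D) (Num.max (h t - c) 0)%:E <= K s h)%E.
Proof.
move=> s0 mh Kfin; have [->|soo] := eqVneq s +oo%E.
  exists 0 => //; rewrite mule0 add0e -layer_cake// integral_mkcond.
  apply: ge0_le_integral => //.
  - by move=> l _; apply: erestrict_ge0.
  - apply/(measurable_restrictT _ _).1 => //; apply: measurable_funTS.
    exact: measurable_overlevel.
  - exact: mov.
  by move=> l _; rewrite patchE min_r ?leey//; case: ifPn => // _; exact: ov0.
pose L := [set l : R | 0 < l /\ (overlevel h l <= s)%E].
(* Were [L] empty, the integrand would be [s > 0] on the whole half line, and [K s h] infinite. *)
have L0 : L !=set0.
  apply/set0P/eqP => L0; move: Kfin; rewrite ltNge => /negP; apply.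
  have : (\int[leb]_(l in `]0%R, +oo[) cst s l <= K s h)%E.
    rewrite integral_mkcond; apply: ge0_le_integral => //.
    - by move=> l _; apply: erestrict_ge0 => *; exact: ltW.
    - by apply/(measurable_restrictT _ _).1.
    - exact: mov.
    move=> l _; rewrite patchE mem_set_itv in_itv/= andbT; case: ifPn => l0; last first.
      by rewrite le_min ov0 ltW.
    rewrite le_min lexx /= leNgt; apply/negP => ols.
    by have : L l; [split=> //; exact: ltW|rewrite L0].
  apply: le_trans; rewrite integral_cst//= lebesgue_measure_itv/= ltry.
  by rewrite gt0_muley.
have Lb : has_lbound L by exists 0 => l [/ltW].
pose c := inf L; have c0 : 0 <= c by apply: lb_le_inf => // l [/ltW].
exists c => //; rewrite -layer_cake//.
have -> : (s * c%:E = \int[leb]_l (cst s \_ `]0%R, c[) l)%E.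
  rewrite -integral_mkcond integral_cst//= lebesgue_measure_itv /= lte_fin.
  by have [//|c0'] := ltP 0 c; [rewrite sube0|rewrite (@le_anti _ _ c 0) ?c0' ?c0// mule0].
rewrite [X in (_ + X)%E]integral_mkcond -ge0_integralD//; first last.
- apply/(measurable_restrictT _ _).1 => //; apply: measurable_funTS.
  exact: measurable_overlevel.
- by move=> l _; apply: erestrict_ge0.
- by apply/(measurable_restrictT _ _).1.
- by move=> l _; apply: erestrict_ge0 => *; exact: ltW.
apply: ge0_le_integral => //.
- move=> l _; apply: adde_ge0; first by apply: erestrict_ge0 => *; exact: ltW.
  by apply: erestrict_ge0.
- apply: emeasurable_funD; first by apply/(measurable_restrictT _ _).1.
  by apply/(measurable_restrictT _ _).1 => //; apply: measurable_funTS; exact: measurable_overlevel.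
- exact: mov.
move=> l _; rewrite !patchE !mem_set_itv !in_itv/= andbT.
have m0 : (0 <= mine s (overlevel h l))%E by rewrite le_min ov0 ltW.
have [l0|l0] := leP l 0.
  by rewrite /= add0e ltNge (le_trans l0 c0).
have [lc|cl] := ltP l c.
  rewrite /= ltNge (ltW lc) adde0 le_min lexx /= leNgt; apply/negP => ols.
  by move: lc; rewrite ltNge => /negP; apply; apply: ge_inf => //; split=> //; exact: ltW.
rewrite /= add0e; case: ifPn => // {}cl; rewrite le_min lexx andbT.
have [k [k0 ks] kl] := inf_lt L0 cl.
by apply: le_trans ks; apply: overlevel_decr => //; exact: ltW.
Qed.

(* truncated_levels s h is the minimum over c >= 0 of the convex functionals
   s * c + \int (h - c)^+ of h. *)
Lemma truncated_levels_convex s h g (a b : R) : (0 <= s)%E -> 0 < a -> 0 < b ->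
  M h -> M g ->
  (K s (fun t => a * h t + b * g t)%R <= a%:E * K s h + b%:E * K s g)%E.
Proof.
move=> s0 a0 b0 mh mg.
have K0 k : (0 <= K s k)%E by apply: integral_ge0 => l _; rewrite le_min s0 ov0.
have aK k : (0 <= a%:E * K s k)%E by apply: mule_ge0 => //; rewrite lee_fin ltW.
have bK k : (0 <= b%:E * K s k)%E by apply: mule_ge0 => //; rewrite lee_fin ltW.
have mahbg : M (fun t => a * h t + b * g t).
  by apply: measurable_funD; apply: measurable_funM.
have [s0E|/eqP sgt] := pselect (s = 0%E).
  rewrite [leLHS](_ : _ = 0%E); last first.
    by apply: integral0_eq => l _; rewrite s0E min_l.
  exact: adde_ge0.
have {sgt}s0' : (0 < s)%E by rewrite lt_def sgt s0.
have [hoo|hfin] := eqVneq (K s h) +oo%E.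
  by rewrite hoo gt0_muley ?lte_fin// addye ?leey// -ltNye; exact: lt_le_trans (ltNyr 0) (bK g).
have [goo|gfin] := eqVneq (K s g) +oo%E.
  by rewrite goo gt0_muley ?lte_fin// addey ?leey// -ltNye; exact: lt_le_trans (ltNyr 0) (aK h).
have [c c0 cK] : exists2 c : R, 0 <= c &
  (s * c%:E + \int[mu]_(t in D) (Num.max (h t - c) 0)%:E <= K s h)%E.
  by apply: truncated_levels_ge => //; rewrite ltey.
have [k k0 kK] : exists2 c : R, 0 <= c &
  (s * c%:E + \int[mu]_(t in D) (Num.max (g t - c) 0)%:E <= K s g)%E.
  by apply: truncated_levels_ge => //; rewrite ltey.
(* The functional is jointly convex in the pair (h, c), so the optimal constants are combined with
   the same coefficients as the functions. *)
have ack0 : 0 <= a * c + b * k by rewrite addr_ge0// mulr_ge0// ltW.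
apply: le_trans (truncated_levels_le s0 ack0 mahbg) _.
have mpos f (e : R) : M f -> measurable_fun D (fun t => (Num.max (f t - e) 0)%:E).
  by move=> mf; apply/measurable_EFinP; apply: measurable_maxr => //; exact: measurable_funB.
have pos0 f (e : R) t : (0 <= (Num.max (f t - e) 0)%:E)%E.
  by rewrite lee_fin le_max lexx orbT.
apply: (@le_trans _ _ (a%:E * (s * c%:E + \int[mu]_(t in D) (Num.max (h t - c) 0)%:E)
    + b%:E * (s * k%:E + \int[mu]_(t in D) (Num.max (g t - k) 0)%:E))%E); last first.
  by apply: leeD; apply: lee_wpmul2l => //; rewrite lee_fin ltW.
have I0 f (e : R) : (0 <= \int[mu]_(t in D) (Num.max (f t - e) 0)%:E)%E.
  by apply: integral_ge0 => t _; exact: pos0.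
have sc0 (e : R) : 0 <= e -> (0 <= s * e%:E)%E by move=> e0; apply: mule_ge0.
rewrite (ge0_muleDr _ (sc0 _ c0) (I0 _ _)) (ge0_muleDr _ (sc0 _ k0) (I0 _ _)).
rewrite addeACA; apply: leeD.
  have [a0' b0'] := (ltW a0, ltW b0).
  rewrite EFinD ge0_muleDr ?lee_fin ?mulr_ge0//.
  by apply: leeD; rewrite EFinM muleCA.
rewrite -!ge0_integralZl ?lee_fin ?(ltW a0) ?(ltW b0)//; try exact: mpos.
rewrite -ge0_integralD//; first last.
- by apply: measurable_funeM; exact: mpos.
- by move=> t _; apply: mule_ge0 => //; rewrite lee_fin ltW.
- by apply: measurable_funeM; exact: mpos.
- by move=> t _; apply: mule_ge0 => //; rewrite lee_fin ltW.
apply: ge0_le_integral => //.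
- exact: mpos.
- by apply: emeasurable_funD; apply: measurable_funeM; exact: mpos.
move=> t _; rewrite -!EFinM -EFinD lee_fin ge_max; apply/andP; split; last first.
  by apply: addr_ge0; apply: mulr_ge0; rewrite ?(ltW a0) ?(ltW b0)// le_max lexx orbT.
have : h t - c <= Num.max (h t - c) 0 by rewrite le_max lexx.
have : g t - k <= Num.max (g t - k) 0 by rewrite le_max lexx.
by nra.
Qed.

End levels.

(** * Lower limits of extended real sequences *)

Section limn_einf.
Context {R : realType}.
Implicit Types (u : (\bar R)^nat) (c : \bar R).

Lemma limn_einfE u : limn_einf u = ereal_sup (range (einfs u)).
Proof. by rewrite limn_einf_lim; apply/cvg_lim => //; exact: cvg_einfs_sup. Qed.

Lemma einfs_le u n k : (n <= k)%N -> (einfs u n <= u k)%E.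
Proof. by move=> nk; apply: ereal_inf_lbound; exists k. Qed.

Lemma einfs_le_limn_einf u n : (einfs u n <= limn_einf u)%E.
Proof. by rewrite limn_einfE; apply: ereal_sup_ubound; exists n. Qed.

Lemma near_le_limn_einf u c : (\forall n \near \oo, c <= u n)%E ->
  (c <= limn_einf u)%E.
Proof.
move=> [n _ nP]; apply: le_trans (einfs_le_limn_einf u n).
by apply: le_ereal_inf_tmp => _ [k /= nk <-]; exact: nP.
Qed.

Lemma limn_einf_le u c : (forall n, u n <= c)%E -> (limn_einf u <= c)%E.
Proof.
move=> uc; rewrite limn_einfE; apply: ge_ereal_sup => _ [n _ <-].
exact: le_trans (einfs_le u (leqnn n)) (uc n).
Qed.

(** If some tail infimum reaches [c], so does the truncated one; otherwise truncation at [c] leaves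
    all tail infima below [c] unchanged. *)
Lemma mine_limn_einf u c : (mine c (limn_einf u) <= limn_einf (fun n => mine c (u n)))%E.
Proof.
have step n : (mine c (einfs u n) <= limn_einf (fun k => mine c (u k)))%E.
  apply: le_trans (einfs_le_limn_einf _ n).
  apply: le_ereal_inf_tmp => _ [k /= nk <-].
  by rewrite le_min ge_min lexx /= ge_min einfs_le ?orbT.
have [[n cn]|nc] := pselect (exists n, c <= einfs u n)%E.
  by apply: le_trans (step n); rewrite (min_l cn) ge_min lexx.
rewrite ge_min; apply/orP; right; rewrite [leLHS]limn_einfE.
apply: ge_ereal_sup => _ [n _ <-]; apply: le_trans (step n).
by rewrite min_r// ltW// ltNge; apply/negP => cn; apply: nc; exists n.
Qed.

End limn_einf.

Section choquet.
Context d (T : measurableType d) (R : realType).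
Variables (mu : {sigma_finite_measure set T -> \bar R}) (D : set T).
Hypothesis mD : measurable D.
Local Notation leb := (@lebesgue_measure R : {sigma_finite_measure set (measurableTypeR R) -> \bar R}).
Local Notation M := (@measurable_fun _ _ T R D).
Variable m : measurableTypeR R -> \bar R.
Hypothesis mm : measurable_fun setT m.
Hypothesis m0 : forall r, (0 <= m r)%E.
Implicit Types (h g : T -> R) (s : \bar R).

Local Notation ov := (overlevel mu D).

(* For m r the length of the set where a weight exceeds r, this is the integral
   of the decreasing rearrangement of h against the weight. *)
Definition choquet h : \bar R :=
  (\int[(leb \x leb)%E]_z mine (m z.1) (ov h z.2))%E.

(** For the level lengths [m] of a decreasing weight, this is the primitive W(s) of the weight, by
    the layer cake formula on an initial segment. *)
Definition weight_integral s : \bar R := (\int[leb]_r mine (m r) s)%E.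

Let ov0 h l : (0 <= ov h l)%E. Proof. exact: measure_ge0. Qed.

Let F0 h z : (0 <= mine (m z.1) (ov h z.2))%E.
Proof. by rewrite le_min m0 ov0. Qed.

Let mF h : M h -> measurable_fun setT
  (fun z : measurableTypeR R * measurableTypeR R => mine (m z.1) (ov h z.2)).
Proof.
move=> mh; apply: measurable_mine.
  by apply: measurableT_comp => //; exact: measurable_fst.
by apply: measurableT_comp; [exact: measurable_overlevel|exact: measurable_snd].
Qed.

Lemma choquetE h : M h ->
  choquet h = (\int[leb]_r truncated_levels mu D (m r) h)%E.
Proof. by move=> mh; rewrite /choquet fubini_tonelli1//; exact: mF. Qed.

Let mK h : M h -> measurable_fun setT (fun r => truncated_levels mu D (m r) h).
Proof.
by move=> mh; exact: (measurable_fun_fubini_tonelli_F (m2 := leb) _ (mF mh)).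
Qed.

Lemma choquet_ge0 h : (0 <= choquet h)%E.
Proof. exact: integral_ge0. Qed.

Lemma choquet_le h g : M h -> M g -> (\forall t \ae mu, D t -> h t <= g t) ->
  (choquet h <= choquet g)%E.
Proof.
move=> mh mg hg; apply: ge0_le_integral => //; [exact: mF|exact: mF|].
move=> z _; rewrite le_min ge_min lexx /= ge_min; apply/orP; right.
exact: overlevel_le.
Qed.

Lemma choquet_convex h g (a b : R) : 0 < a -> 0 < b -> M h -> M g ->
  (choquet (fun t => a * h t + b * g t)%R <= a%:E * choquet h + b%:E * choquet g)%E.
Proof.
move=> a0 b0 mh mg; have mahbg : M (fun t => a * h t + b * g t).
  by apply: measurable_funD; apply: measurable_funM.
have K0 k r : (0 <= truncated_levels mu D (m r) k)%E.
  by apply: integral_ge0 => l _; rewrite le_min m0 ov0.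
have [a0' b0'] := (ltW a0, ltW b0).
rewrite !choquetE// -!ge0_integralZl ?lee_fin//; try exact: mK.
rewrite -ge0_integralD//; first last.
- by apply: measurable_funeM; exact: mK.
- by move=> r _; apply: mule_ge0.
- by apply: measurable_funeM; exact: mK.
- by move=> r _; apply: mule_ge0.
apply: ge0_le_integral => //; first exact: mK.
  by apply: emeasurable_funD; apply: measurable_funeM; exact: mK.
by move=> r _; exact: truncated_levels_convex.
Qed.

Let mW s : measurable_fun setT (fun r => mine (m r) s).
Proof. exact: measurable_mine. Qed.

Lemma weight_integral_ge0 s : (0 <= s)%E -> (0 <= weight_integral s)%E.
Proof. by move=> s0; apply: integral_ge0 => r _; rewrite le_min m0. Qed.

Lemma weight_integral_le s s' : (0 <= s)%E -> (s <= s')%E ->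
  (weight_integral s <= weight_integral s')%E.
Proof.
move=> s0 ss; apply: ge0_le_integral => //; first by move=> r _; rewrite le_min m0.
by move=> r _; rewrite le_min ge_min lexx /= ge_min ss orbT.
Qed.

Lemma weight_integral_subadditive s s' : (0 <= s)%E -> (0 <= s')%E ->
  (weight_integral (s + s') <= weight_integral s + weight_integral s')%E.
Proof.
move=> s0 s0'; rewrite -ge0_integralD//; first last.
- by move=> r _; rewrite le_min m0.
- by move=> r _; rewrite le_min m0.
apply: ge0_le_integral => //.
- by move=> r _; rewrite le_min m0 adde_ge0.
- by apply: emeasurable_funD; exact: mW.
move=> r _; have [ms|sm] := leP (m r) s.
  by rewrite ge_min; apply/orP; left; apply: lee_paddr => //; rewrite le_min m0.
have [ms|sm'] := leP (m r) s'.
  by rewrite ge_min; apply/orP; left; apply: lee_paddl => //; exact: ltW.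
by rewrite ge_min lexx orbT.
Qed.

(** Written as a double integral over a strip of levels, [b * W s] can be compared with [choquet h]
    pointwise. *)
Let box_integral s (b : R) : (0 <= s)%E -> 0 <= b ->
  (b%:E * weight_integral s =
   \int[(leb \x leb)%E]_z ((fun z => mine (m z.1) s) \_ (setT `*` `]0%R, b[)) z)%E.
Proof.
move=> s0 b0.
have mB : measurable (setT `*` `]0%R, b[%classic : set (measurableTypeR R * measurableTypeR R)).
  by apply: measurableX.
rewrite fubini_tonelli1//; first last.
- by apply: erestrict_ge0 => z _; rewrite le_min m0.
- apply/(measurable_restrictT _ _).1 => //; apply: measurable_funTS.
  apply: measurable_mine => //.
  by apply: measurableT_comp => //; exact: measurable_fst.
rewrite /weight_integral -ge0_integralZl ?lee_fin//; last first.
  by move=> r _; rewrite le_min m0.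
apply: eq_integral => r _; rewrite /fubini_F.
rewrite (_ : (fun y : measurableTypeR R => _) = cst (mine (m r) s) \_ `]0%R, b[); last first.
  apply/funext => l; rewrite !patchE.
  rewrite (_ : ((r, l) \in setT `*` `]0%R, b[%classic) = (l \in `]0%R, b[%classic))//.
  by apply/idP/idP; rewrite !inE/= => // -[].
rewrite -integral_mkcond integral_cst//= lebesgue_measure_itv/= lte_fin.
have [b0'|b0'] := ltP 0 b; first by rewrite sube0 muleC.
by rewrite (@le_anti _ _ b 0) ?b0 ?b0'// mul0e mule0.
Qed.

Let mbox s (b : R) : measurable_fun setT ((fun z : measurableTypeR R * measurableTypeR R =>
  mine (m z.1) s) \_ (setT `*` `]0%R, b[)).
Proof.
apply/(measurable_restrictT _ _).1; first by apply: measurableX.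
apply: measurable_funTS; apply: measurable_mine => //.
by apply: measurableT_comp => //; exact: measurable_fst.
Qed.

Let mem_box (b : R) (z : measurableTypeR R * measurableTypeR R) :
  (z \in setT `*` `]0%R, b[%classic) = (0 < z.2 < b).
Proof.
by rewrite in_setX in_setT/= mem_set_itv in_itv.
Qed.

(** Markov's inequality: on the strip of levels between 0 and [l], the level measure is at least its
    value at [l]. *)
Lemma choquet_ge_level h (l : R) : M h -> 0 <= l ->
  (l%:E * weight_integral (ov h l) <= choquet h)%E.
Proof.
move=> mh l0; rewrite box_integral//; apply: ge0_le_integral => //.
- by move=> z _; apply: erestrict_ge0 => *; rewrite le_min m0 ov0.
- exact: mbox.
- exact: mF.
move=> z _; rewrite patchE mem_box; case: ifPn => [/andP[z0 zl]|_]; last exact: F0.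
rewrite le_min ge_min lexx /= ge_min; apply/orP; right.
by apply: overlevel_decr => //; exact: ltW.
Qed.

Lemma choquet_le_bound h (b : R) (A : set T) : M h -> 0 <= b -> measurable A ->
  (forall t, D t -> h t <= b) -> (forall t, D t -> 0 < h t -> A t) ->
  (choquet h <= b%:E * weight_integral (mu A))%E.
Proof.
move=> mh b0 mA hb hA; rewrite box_integral//; apply: ge0_le_integral => //.
- exact: mF.
- exact: mbox.
move=> z _; rewrite patchE mem_box; case: ifPn => [_|].
  rewrite le_min ge_min lexx /= ge_min; apply/orP; right.
  apply: le_measure; rewrite ?inE//; first exact: overlevel_set_measurable.
  by move=> t [Dt /andP[z0 zh]]; apply: hA => //; exact: lt_trans zh.
rewrite negb_and -!leNgt => zb; rewrite ge_min; apply/orP; right.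
rewrite (_ : ov h z.2 = 0%E)//.
case/orP: zb => zb; first exact: overlevel_npos.
rewrite /overlevel (_ : [set t | _] = set0) ?measure0//.
apply/seteqP; split=> // t [Dt /andP[_ zh]].
by have := lt_le_trans zh (hb _ Dt); rewrite ltNge zb.
Qed.

(** Because level sets are defined by strict inequalities, [l < h t] forces [l < h_ n t] eventually:
    the indicator of the limit set lies below the lower limit of the indicators. *)
Lemma overlevel_fatou (h_ : nat -> T -> R) h (l : R) : (forall n, M (h_ n)) -> M h ->
  (\forall t \ae mu, D t -> h_ n t @[n --> \oo] --> h t) ->
  (ov h l <= limn_einf (fun n => ov (h_ n) l))%E.
Proof.
move=> mh_ mh hh.
pose A g := [set t | D t /\ 0 < l < g t].
have mA g : M g -> measurable (A g) by exact: overlevel_set_measurable.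
have ovE g : M g -> ov g l = (\int[mu]_t (\1_(A g) t)%:E)%E.
  by move=> mg; rewrite integral_indic// ?setIT//; exact: mA.
have mi g : M g -> measurable_fun setT (fun t => (\1_(A g) t : R)%:E).
  by move=> mg; apply/measurable_EFinP; apply: measurable_indic; exact: mA.
rewrite ovE// (_ : (fun n => ov (h_ n) l) = fun n => (\int[mu]_t (\1_(A (h_ n)) t)%:E)%E); last first.
  by apply/funext => n; exact: ovE.
apply: (@le_trans _ _ (\int[mu]_t limn_einf (fun n => (\1_(A (h_ n)) t)%:E))%E); last first.
  by apply: fatou => // n; exact: mi.
apply: ae_ge0_le_integral => //.
- exact: mi.
- by move=> t _; apply: near_le_limn_einf; apply: nearW => n; rewrite lee_fin indicE.
- apply: measurableT_comp => //; apply: measurable_fun_limn_esup => n.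
  by apply: measurableT_comp => //; exact: mi.
apply: filterS hh => t ht _; apply: near_le_limn_einf.
have [tA|tA] := boolP (t \in A h); last first.
  by apply: nearW => n; rewrite !indicE (negbTE tA) lee_fin.
move: (tA); rewrite inE => -[Dt /andP[l0 lh]].
have : \forall n \near \oo, l < h_ n t by apply: cvgr_gt lh; exact: ht.
apply: filterS => n ln; rewrite !indicE tA mem_set ?lexx//.
by split=> //; rewrite l0.
Qed.

Lemma choquet_fatou (h_ : nat -> T -> R) h : (forall n, M (h_ n)) -> M h ->
  (\forall t \ae mu, D t -> h_ n t @[n --> \oo] --> h t) ->
  (choquet h <= limn_einf (fun n => choquet (h_ n)))%E.
Proof.
move=> mh_ mh hh.
apply: (@le_trans _ _ (\int[(leb \x leb)%E]_z
    limn_einf (fun n => mine (m z.1) (ov (h_ n) z.2)))%E); last first.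
  by apply: fatou => //; move=> n; exact: mF.
apply: ge0_le_integral => //.
- exact: mF.
- apply: measurableT_comp => //; apply: measurable_fun_limn_esup => n.
  by apply: measurableT_comp => //; exact: mF.
move=> z _; apply: le_trans (mine_limn_einf _ _).
rewrite le_min ge_min lexx /= ge_min; apply/orP; right.
exact: overlevel_fatou.
Qed.

Lemma overlevel_dominated (h_ : nat -> T -> R) h (l : R) : (forall n, M (h_ n)) -> M h ->
  (\forall t \ae mu, D t -> (forall n, h_ n t <= h t) /\ h_ n t @[n --> \oo] --> (0 : R)) ->
  (ov h l < +oo)%E -> ov (h_ n) l @[n --> \oo] --> 0%E.
Proof.
move=> mh_ mh hh ovfin.
pose A g := [set t | D t /\ 0 < l < g t].
have mA g : M g -> measurable (A g) by exact: overlevel_set_measurable.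
have ovE g : M g -> ov g l = (\int[mu]_t (\1_(A g) t)%:E)%E.
  by move=> mg; rewrite integral_indic// ?setIT//; exact: mA.
have mi g : M g -> measurable_fun setT (fun t => (\1_(A g) t : R)%:E).
  by move=> mg; apply/measurable_EFinP; apply: measurable_indic; exact: mA.
rewrite (_ : (fun n => ov (h_ n) l) = fun n => (\int[mu]_t (\1_(A (h_ n)) t)%:E)%E); last first.
  by apply/funext => n; exact: ovE.
have := @dominated_convergence _ _ _ mu setT measurableT
  (fun n t => (\1_(A (h_ n)) t)%:E) (cst 0%E) (fun t => (\1_(A h) t)%:E).
have -> : (\int[mu]_(x in setT) cst 0%E x = 0)%E by apply: integral0_eq.
case => //.
- by move=> n; exact: mi.
- apply: filterS hh => t ht _; apply: cvg_near_cst.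
  have [Dt|nDt] := pselect (D t); last first.
    by apply: nearW => n; rewrite indicE memNset// => -[].
  have [l0|l0] := leP l 0.
    by apply: nearW => n; rewrite indicE memNset// => -[_ /andP[]]; rewrite ltNge l0.
  have : \forall n \near \oo, h_ n t < l by apply: cvgr_lt l0; exact: (ht Dt).2.
  apply: filterS => n nl; rewrite indicE memNset// => -[_ /andP[_]].
  by rewrite ltNge ltW.
- apply/integrableP; split; first exact: mi.
  rewrite (_ : (\int[mu]_x `|(\1_(A h) x)%:E|)%E = ov h l)// ovE//.
  by apply: eq_integral => t _; rewrite gee0_abs// lee_fin indicE.
- apply: filterS hh => t ht n _; rewrite gee0_abs ?lee_fin ?indicE//.
  have [tA|tA] := boolP (t \in A (h_ n)); last by [].
  move: tA; rewrite inE => -[Dt /andP[l0 lh]].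
  rewrite mem_set//; split=> //; rewrite l0 /=; apply: lt_le_trans lh _.
  by have [+ _] := ht Dt; apply.
Qed.

(** Dominated convergence is used twice: finiteness of the measure at each level of [h] gives
    convergence of the level measures, and finiteness of [choquet h] dominates the double
    integral. *)
Lemma choquet_dominated (h_ : nat -> T -> R) h : (forall n, M (h_ n)) -> M h ->
  (\forall t \ae mu, D t -> (forall n, h_ n t <= h t) /\ h_ n t @[n --> \oo] --> (0 : R)) ->
  (forall l, ov h l < +oo)%E -> (choquet h < +oo)%E ->
  choquet (h_ n) @[n --> \oo] --> 0%E.
Proof.
move=> mh_ mh hh ovfin cfin.
have := @dominated_convergence _ _ _ (leb \x leb)%E setT measurableT
  (fun n z => mine (m z.1) (ov (h_ n) z.2)) (cst 0%E) (fun z => mine (m z.1) (ov h z.2)).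
have -> : (\int[(leb \x leb)%E]_(x in setT) cst 0%E x = 0)%E by apply: integral0_eq.
case => //.
- by move=> n; exact: mF.
- apply: aeW => z _; apply: (@squeeze_cvge _ _ _ _ (cst 0%E) _ (fun n => ov (h_ n) z.2)).
  + by apply: nearW => n; rewrite F0 ge_min lexx orbT.
  + exact: cvg_cst.
  + exact: (overlevel_dominated mh_ mh hh (ovfin _)).
- apply/integrableP; split; first exact: mF.
  rewrite (_ : (\int[_]_x `|_|)%E = choquet h)//.
  by apply: eq_integral => z _; rewrite gee0_abs.
- apply: aeW => z n _; rewrite gee0_abs//.
  rewrite le_min ge_min lexx /= ge_min; apply/orP; right.
  apply: overlevel_le => //; apply: filterS hh => t ht Dt.
  by have [+ _] := ht Dt; apply.
Qed.

End choquet.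

(** * The Orlicz modular of a Choquet integral *)

Section orlicz_functions.
Context (R : realType) (phi : R -> R).
Hypothesis phiP : orlicz phi.

Lemma orlicz0 : phi 0 = 0. Proof. by case: phiP. Qed.

Lemma orlicz_gt0 (x : R) : 0 < x -> 0 < phi x. Proof. by case: phiP => _ _; apply. Qed.

Lemma orlicz_ge0 (x : R) : 0 <= x -> 0 <= phi x.
Proof.
by rewrite le_eqVlt => /predU1P[<-|/orlicz_gt0/ltW//]; rewrite orlicz0.
Qed.

Lemma orlicz_convex (a x y : R) : 0 <= a <= 1 -> 0 <= x -> 0 <= y ->
  phi (a * x + (1 - a) * y) <= a * phi x + (1 - a) * phi y.
Proof.
move=> /andP[a0 a1] x0 y0; have [cvx _ _] := phiP.
have := cvx (Itv01 a0 a1) x y.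
by apply; rewrite inE/= in_itv/= andbT.
Qed.

Lemma orlicz_le (x y : R) : 0 <= x -> x <= y -> phi x <= phi y.
Proof.
move=> x0 xy; have [y0|y0] := eqVneq y 0.
  by rewrite (@le_anti _ _ x y) ?xy// y0 x0.
have {}y0 : 0 < y by rewrite lt_def y0 (le_trans x0).
have xy1 : x / y <= 1 by rewrite ler_pdivrMr// mul1r.
have xy0 : 0 <= x / y by apply: divr_ge0 => //; exact: ltW.
rewrite -[x in phi x](divfK (lt0r_neq0 y0)) -[_ * y]addr0 -(mulr0 (1 - x / y)).
apply: le_trans (orlicz_convex _ _ _) _ => //; [by rewrite xy0|exact: ltW|].
by rewrite orlicz0 mulr0 addr0 ler_piMl// orlicz_ge0// ltW.
Qed.

(** On [0, L] the slopes of [phi] are bounded by chords ending at [2 * L]: [y] is a convex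
    combination of [x] and [2 * L] with weight at most [(y - x) / L]. The absolute value makes a
    continuous function on the whole line out of the values on [0, +oo[. *)
Lemma orlicz_norm_continuous : continuous (fun x : R => phi `|x|).
Proof.
move=> p; set L := `|p| + 1; have L0 : 0 < L by rewrite ltr_wpDl.
have lip (x y : R) : 0 <= x -> x <= y -> y <= L ->
    phi y - phi x <= (y - x) * (phi (2 * L) / L).
  move=> x0 xy yL; have d0 : 0 < 2 * L - x by lra.
  set a := (y - x) / (2 * L - x).
  have a0 : 0 <= a by apply: divr_ge0; [rewrite subr_ge0|exact: ltW].
  have a1 : a <= 1 by rewrite ler_pdivrMr// mul1r; lra.
  have yE : y = a * (2 * L) + (1 - a) * x by rewrite /a; field; rewrite gt_eqF.
  have P0 : 0 <= phi (2 * L) by apply: orlicz_ge0; lra.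
  have px0 : 0 <= phi x by exact: orlicz_ge0.
  have aL : a * phi (2 * L) <= (y - x) * (phi (2 * L) / L).

    have -> : (y - x) * (phi (2 * L) / L) = (y - x) / L * phi (2 * L) by ring.
    apply: ler_wpM2r => //; apply: ler_wpM2l; first by rewrite subr_ge0.
    by rewrite lef_pV2 ?posrE//; lra.
  have : phi y <= a * phi (2 * L) + (1 - a) * phi x.
    by rewrite {1}yE; apply: orlicz_convex; rewrite ?a0//; lra.
  nra.
set C := phi (2 * L) / L.
have C0 : 0 <= C by apply: divr_ge0; [apply: orlicz_ge0; lra|exact: ltW].
have lip' (x y : R) : 0 <= x -> 0 <= y -> x <= L -> y <= L ->
    `|phi x - phi y| <= `|x - y| * C.
  move=> x0 y0 xL yL; have [xy|yx] := leP x y.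
    rewrite distrC [`|x - y|]distrC !ger0_norm ?subr_ge0//; first exact: lip.
    exact: orlicz_le.
  have {}yx := ltW yx; rewrite !ger0_norm ?subr_ge0//; first exact: lip.
  exact: orlicz_le.
apply/cvgrPdist_le => e e0.
have eC : 0 < e / (C + 1) by rewrite divr_gt0// ltr_wpDl.
near=> x.
have xp : `|p - x| <= e / (C + 1) by near: x; exact: cvgr_dist_le.
have x1 : `|p - x| <= 1 by near: x; exact: cvgr_dist_le.
apply: le_trans (lip' _ _ _ _ _ _) _ => //.
- by rewrite lerDl.
- by rewrite -(subrK p x) addrC; apply: le_trans (ler_normD _ _) _; rewrite lerD2l distrC.
apply: (@le_trans _ _ (e / (C + 1) * C)).
  by apply: ler_wpM2r => //; apply: le_trans xp; exact: ler_dist_dist.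
rewrite -mulrA; apply: ler_piMr; first exact: ltW.
by rewrite ler_pdivrMl ?ltr_wpDl// mulr1 lerDl.
Unshelve. all: by end_near. Qed.

Lemma orlicz_norm_le (x y : R) : `|x| <= `|y| -> phi `|x| <= phi `|y|.
Proof. exact: orlicz_le. Qed.

End orlicz_functions.

Section orlicz_modular.
Context d (T : measurableType d) (R : realType).
Variables (mu : {sigma_finite_measure set T -> \bar R}) (D : set T).
Hypothesis mD : measurable D.
Variable phi : R -> R.
Hypothesis phiP : orlicz phi.
Variable m : measurableTypeR R -> \bar R.
Hypothesis mm : measurable_fun setT m.
Hypothesis m0 : forall r, (0 <= m r)%E.

Local Notation M := (@measurable_fun _ _ T R D).
Local Notation W := (weight_integral m).
Local Notation ov := (overlevel mu D).
Local Notation J := (choquet mu D m).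

Hypothesis W_fin : forall s, (0 <= s < +oo)%E -> (W s < +oo)%E.
Hypothesis W_pos : forall s, (0 < s)%E -> (0 < W s)%E.
Hypothesis W_infty : mu D = +oo%E -> W +oo = +oo%E.

Definition rho_choquet (f : T -> R) : \bar R := J (fun t => phi `|f t|).

Definition ae_on : set_system T := fun P => \forall t \ae mu, D t -> P t.

Let near_ae_on P : (\forall t \near ae_on, P t) -> \forall t \ae mu, D t -> P t.
Proof. by []. Qed.

Let ae_on_filter : Filter ae_on.
Proof.
split.
- by apply: aeW => t.
- move=> P Q /near_ae_on PP /near_ae_on QQ; have : \forall t \ae mu, (D t -> P t) /\ (D t -> Q t) by exact: filterI.
  apply: filterS => t [Pt Qt] Dt.
  by split; [exact: Pt|exact: Qt].
- by move=> P Q PQ /near_ae_on; apply: filterS => t Pt Dt; apply: PQ; exact: Pt.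
Qed.

Let mpsi f : M f -> M (fun t => phi `|f t|).
Proof.
move=> mf; apply: (@measurableT_comp _ _ _ _ _ _ (fun x : R => phi `|x|) D f) => //.
by apply: continuous_measurable_fun; exact: orlicz_norm_continuous.
Qed.

(** A level set of infinite measure would force [mu D = +oo], hence [W +oo = +oo], and Markov's
    inequality would make the modular infinite. *)
Lemma rho_choquet_level f (l : R) : M f -> (rho_choquet f < +oo)%E -> 0 < l ->
  (ov (fun t => phi `|f t|) l < +oo)%E.
Proof.
move=> mf ffin l0; rewrite ltey; apply/negP => /eqP ovoo.
have muD : mu D = +oo%E.
  apply/eqP; rewrite -leye_eq -ovoo; apply: le_measure; rewrite ?inE//.
    by apply: overlevel_set_measurable => //; exact: mpsi.
  by move=> t [].
have := choquet_ge_level mu mD mm m0 (mpsi mf) (ltW l0).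
by rewrite ovoo W_infty// gt0_muley ?lte_fin// leNgt ffin.
Qed.

Let rho_le f g : M f -> M g -> (\forall t \near ae_on, `|f t| <= `|g t|) ->
  (rho_choquet f <= rho_choquet g)%E.
Proof.
move=> mf mg fg; apply: choquet_le => //; [exact: mpsi|exact: mpsi|].
by apply: filterS (near_ae_on fg) => t fgt Dt; apply: orlicz_norm_le => //; exact: fgt.
Qed.

Let rho0 : rho_choquet (fun=> 0) = 0%E.
Proof.
apply: integral0_eq => z _; rewrite (_ : ov _ _ = 0%E) ?min_r//.
rewrite /overlevel (_ : [set t | _] = set0) ?measure0//.
apply/seteqP; split=> // t [_ /andP[l0]].
by rewrite normr0 orlicz0// ltNge ltW.
Qed.

(** With modular 0, Markov's inequality and positivity of [W] make every level set at [1/(n+1)]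
    null; these sets exhaust the points of [D] where [f] is nonzero. *)
Let rho_eq0 f : M f -> rho_choquet f = 0%E <-> \forall t \near ae_on, f t = 0.
Proof.
move=> mf; split=> [f0|f0]; last first.
  apply/eqP; rewrite eq_le choquet_ge0// andbT -rho0; apply: rho_le => //.
  by apply: filterS (near_ae_on f0) => t ft Dt; rewrite ft// normr0.
have step (n : nat) : mu.-negligible [set t | D t /\ 0 < (n.+1%:R^-1 : R) < phi `|f t|].
  apply/negligibleP; first by apply: overlevel_set_measurable => //; exact: mpsi.
  have n0 : 0 < n.+1%:R^-1 :> R by rewrite invr_gt0.
  have := choquet_ge_level mu mD mm m0 (mpsi mf) (ltW n0); rewrite -/(rho_choquet f) f0.
  apply: contraPP => /eqP; rewrite neq_lt ltNge measure_ge0/= => /W_pos W0.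
  by apply/negP; rewrite -ltNge mule_gt0 ?lte_fin.
have := negligible_bigcup step; apply: negligibleS => t /=.
move=> /not_implyP[Dt /eqP ft].
have pf : 0 < phi `|f t| by apply: orlicz_gt0 => //; rewrite normr_gt0.
exists (Num.truncn (phi `|f t|)^-1) => //=; split=> //.
rewrite invr_gt0 ltr0n/= -[ltRHS]invrK ltf_pV2 ?posrE ?invr_gt0 ?ltr0n//.
exact: truncnS_gt.
Qed.

Let rho_convex (a : R) f g : M f -> M g -> 0 <= a <= 1 ->
  (rho_choquet (a *: f + (1 - a) *: g)%R <=
   a%:E * rho_choquet f + (1 - a)%:E * rho_choquet g)%E.
Proof.
move=> mf mg /andP[a0 a1].
have [->|an0] := eqVneq a 0.
  by rewrite scale0r add0r subr0 scale1r mul0e add0e mul1e.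
have [->|an1] := eqVneq a 1.
  by rewrite subrr scale0r addr0 scale1r mul0e adde0 mul1e.
have {an0}a0' : 0 < a by rewrite lt_def an0 a0.
have {an1}a1' : 0 < 1 - a by rewrite subr_gt0 lt_def eq_sym an1 a1.
have [mpf mpg] := (mpsi mf, mpsi mg).
apply: le_trans (choquet_convex mu mD mm m0 a0' a1' mpf mpg).
apply: choquet_le => //.
- by apply: mpsi; apply: measurable_funD; apply: measurable_funM.
- by apply: measurable_funD; apply: measurable_funM.
apply: aeW => t Dt.
apply: le_trans (orlicz_convex phiP _ (normr_ge0 (f t)) (normr_ge0 (g t))); last by rewrite a0.
apply: orlicz_le => //; apply: le_trans (ler_normD _ _) _.
by rewrite !normrM (ger0_norm a0) (gtr0_norm a1').
Qed.

(** [choquet_convex] with both coefficients equal to 1 is subadditivity; where one of [f], [g]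
    vanishes, [phi |f + g|] is the sum of [phi |f|] and [phi |g|]. *)
Let rho_subadditive f g : M f -> M g ->
  (forall t, f t = 0 \/ g t = 0) ->
  (rho_choquet (f + g)%R <= rho_choquet f + rho_choquet g)%E.
Proof.
move=> mf mg fg; have [mpf mpg] := (mpsi mf, mpsi mg).
have := choquet_convex mu mD mm m0 (ltr01 : 0 < (1 : R)) ltr01 mpf mpg.
rewrite !mul1e; apply: le_trans; apply: choquet_le => //.
- by apply: mpsi; exact: measurable_funD.
- by apply: measurable_funD; apply: measurable_funM.
apply: aeW => t Dt; rewrite !mul1r; have -> : (f + g) t = f t + g t by [].
by case: (fg t) => ->; rewrite ?addr0 ?add0r normr0 orlicz0// ?addr0 ?add0r.
Qed.

Let rho_fatou (u : nat -> T -> R) f : (forall n, M (u n)) -> M f ->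
  (\forall t \near ae_on, u n t @[n --> \oo] --> f t) ->
  (forall n, (rho_choquet (u n) <= 1)%E) -> (rho_choquet f <= 1)%E.
Proof.
move=> mu_ mf uf u1.
apply: le_trans (limn_einf_le u1).
apply: (choquet_fatou mD mm m0 (h_ := fun n t => phi `|u n t|)).
- by move=> n; exact: mpsi.
- exact: mpsi.
apply: filterS (near_ae_on uf) => t ut Dt.
by apply: (continuous_cvg _ (@orlicz_norm_continuous _ _ phiP (f t))); exact: ut.
Qed.

Let rho_dominated (u : nat -> T -> R) f : (forall n, M (u n)) -> M f ->
  (\forall t \near ae_on, [/\ forall n, 0 <= u n t <= `|f t|,
     nonincreasing_seq (u ^~ t) & u n t @[n --> \oo] --> (0 : R)]) ->
  (rho_choquet f < +oo)%E -> rho_choquet (u n) @[n --> \oo] --> 0%E.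
Proof.
move=> mu_ mf uf ffin.
apply: (choquet_dominated mD mm m0 (h_ := fun n t => phi `|u n t|)
  (h := fun t => phi `|f t|)) => //.
- by move=> n; exact: mpsi.
- exact: mpsi.
- apply: filterS (near_ae_on uf) => t ut Dt; have [uft _ u0] := ut Dt; split.
    move=> n; apply: orlicz_le => //; have /andP[un0 unf] := uft n.
    by rewrite ger0_norm.
  have -> : 0 = phi `|0 : R| by rewrite normr0 orlicz0.
  by apply: (continuous_cvg _ (@orlicz_norm_continuous _ _ phiP 0)); exact: u0.
- move=> l; have [l0|l0] := leP l 0; first by rewrite overlevel_npos// ltry.
  exact: rho_choquet_level.
Qed.

Lemma rho_choquet_bounded f (b : R) (A : set T) : M f -> measurable A ->
  (mu A < +oo)%E -> (forall t, D t -> `|f t| <= b) ->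
  (forall t, D t -> f t != 0 -> A t) -> (rho_choquet f < +oo)%E.
Proof.
move=> mf mA Afin fb fA.
have [D0|/set0P[t0 Dt0]] := eqVneq D set0.
  rewrite (_ : rho_choquet f = 0%E) ?ltry//; apply/rho_eq0 => //.
  by apply: aeW => t; rewrite D0.
have b0 : 0 <= b by exact: le_trans (normr_ge0 _) (fb _ Dt0).
have : (rho_choquet f <= (phi b)%:E * W (mu A))%E.
  apply: choquet_le_bound => //; [exact: mpsi|exact: orlicz_ge0| |].
    by move=> t Dt; apply: orlicz_le => //; exact: fb.
  move=> t Dt pf; apply: fA => //; apply: contraTneq pf => ->.
  by rewrite normr0 orlicz0// ltxx.
move=> /le_lt_trans; apply.
apply: lte_mul_pinfty; rewrite ?lee_fin ?orlicz_ge0//.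
by apply: W_fin; rewrite measure_ge0.
Qed.

Let rho_exhaustion f : modular_carrier D rho_choquet f ->
  exists2 B, exhaustion B & forall n, modular_finite D rho_choquet (f \* \1_(B n)).
Proof.
move=> [mf [lam lam0 flam]].
pose k := (fun t => `|f t|) \_ D.
have mk : measurable_fun setT k.
  by apply/(measurable_restrictT _ _).1 => //; apply: measurableT_comp.
(* The zero set of [k], which contains the complement of [D], is included so that the sets [B n]
   cover all of [T]. *)
pose B (n : nat) := k @^-1` [set 0] `|` k @^-1` `]n.+1%:R^-1, n%:R].
exists B.
  split.
  - move=> n; apply: measurableU; rewrite -[_ @^-1` _]setTI; apply: mk => //.
  - move=> i j ij; apply/subsetPset => t [k0|/=]; first by left.
    rewrite !in_itv/= => /andP[ik ki]; right; rewrite /= in_itv/=.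
    rewrite (le_trans ki) ?ler_nat// andbT; apply: le_lt_trans ik.
    by rewrite lef_pV2 ?posrE ?ltr0n// ler_nat.
  - move=> t; have [kt|kt] := eqVneq (k t) 0; first by exists 0%N; left.
    have kt0 : 0 < k t.
      by rewrite lt_def kt /= /k patchE; case: ifPn.
    exists (maxn (Num.truncn (k t)^-1) (Num.truncn (k t)).+1); right; rewrite /= in_itv/=.
    apply/andP; split.
      rewrite -[ltRHS]invrK ltf_pV2 ?posrE ?invr_gt0 ?ltr0n//.
      by apply: lt_le_trans (truncnS_gt _) _; rewrite ler_nat ltnS leq_maxl.
    by apply: le_trans (ltW (truncnS_gt _)) _; rewrite ler_nat leq_maxr.
move=> n; have mB : measurable (B n).
  by apply: measurableU; rewrite -[_ @^-1` _]setTI; apply: mk.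
have mfB : M (f \* \1_(B n)).
  by apply: measurable_funM => //; exact: measurable_indic.
split=> // c.
(* On [B n] a nonzero value of [f] exceeds [1/(n+1)], so [phi (lam * |f|)] is at least [2 * l] and
   strictly above [l]: the support of the truncation lies in a level set of finite measure. *)
set l := phi (lam / n.+1%:R) / 2.
have pl : 0 < phi (lam / n.+1%:R) by apply: orlicz_gt0 => //; rewrite divr_gt0.
have l0 : 0 < l by rewrite divr_gt0.
have mlf : M (lam *: f) by apply: measurable_funM.
have := rho_choquet_level mlf flam l0.
have := overlevel_set_measurable mD l (mpsi mlf).
rewrite /overlevel; set A := [set t | _] => mA Afin.
apply: (@rho_choquet_bounded _ (`|c| * n%:R) A) => //.
- by apply: measurable_funM.
- move=> t Dt; rewrite normrM; apply: ler_wpM2l => //.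
  rewrite /= normrM indicE normr_nat.
  have [|_] := boolP (t \in B n); last by rewrite mulr0.
  rewrite inE mulr1 => -[|]; rewrite /= /k patchE mem_set//; first by move=> ->.
  by rewrite in_itv/= => /andP[].
- move=> t Dt; have [tB|tB] := boolP (t \in B n); last first.
    by rewrite /GRing.scale /= /GRing.scale /= indicE (negbTE tB) !mulr0 eqxx.
  move=> fB0; split=> //; rewrite l0 /=.
  have ft : f t != 0.
    by apply: contra_neq fB0 => ft; rewrite /GRing.scale /= /GRing.scale /= ft mul0r mulr0.
  move: tB; rewrite inE => -[|]; rewrite /= /k patchE mem_set//.
    by move=> /eqP; rewrite normr_eq0 (negbTE ft).
  rewrite in_itv/= => /andP[nf _].
  apply: (@lt_le_trans _ _ (phi (lam / n.+1%:R))).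
    by rewrite /l ltr_pdivrMr// ltr_pMr// ltr1n.
  apply: orlicz_le => //; first by rewrite divr_ge0 ?ltW.
  by rewrite /GRing.scale /= normrM (gtr0_norm lam0); apply: ler_wpM2l; apply: ltW.
Qed.

Lemma rho_choquet_lattice_modular : lattice_modular D ae_on rho_choquet.
Proof.
split.
- exact: mD.
- exact: ae_on_filter.
- by move=> f; exact: choquet_ge0.
- exact: rho_eq0.
- exact: rho_le.
- exact: rho_convex.
- exact: rho_subadditive.
- exact: rho_fatou.
- exact: rho_dominated.
- exact: rho_exhaustion.
Qed.

(* The supremum of the functions u n \1_(A n) has modular at most 1, while its
   double has infinite modular. *)
Theorem rho_choquet_nontrivial_M_ideal (rho : (T -> R) -> \bar R)
    (u w : nat -> R) (A : nat -> set T) :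
  (forall f, (0 <= rho f)%E) ->
  (forall f, M f -> rho f = rho_choquet f) ->
  (forall n, 0 <= u n) ->
  (forall n, [/\ measurable (A n), A n `<=` D, (mu (A n) < +oo)%E
    & W (mu (A n)) = (w n)%:E]) ->
  (forall n, phi (u n) * w n <= 2^-1 ^+ n.+1) ->
  (forall n, n.*2%:R <= phi (2 * u n) * w n) ->
  (forall t, exists b, forall n, A n t -> u n <= b) ->
  let X := modular_space D ae_on rho in
  nontrivial_M_ideal X (order_continuous ae_on X).
Proof.
move=> rho_ge0 rhoE u0 AP small large bnd X.
have mA n : measurable (A n) by case: (AP n).
have AD n : A n `<=` D by case: (AP n).
have Afin n : (mu (A n) < +oo)%E by case: (AP n).
have WA n : W (mu (A n)) = (w n)%:E by case: (AP n).
apply: (modular_nontrivial_M_ideal (eq_lattice_modular rho_choquet_lattice_modular rho_ge0 rhoE)).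
  (* The index is 1 because the lower bound [large] is trivial at 0; at 1 it forces [W (mu (A 1))]
     to be nonzero, so [A 1] is not null. *)
  exists (\1_(A 1%N)).
    have mi : M (\1_(A 1%N)) by exact: measurable_indic.
    split=> // c; rewrite rhoE; last by apply: measurable_funM.
    apply: (@rho_choquet_bounded _ `|c| (A 1%N)) => //.
    - by apply: measurable_funM.
    - move=> t Dt; rewrite normrM ler_piMr// indicE normr_nat.
      by case: (_ \in _).
    - move=> t Dt; rewrite /GRing.scale /= /GRing.scale /= indicE.
      by have [|_] := boolP (t \in A 1%N); rewrite ?inE// mulr0 eqxx.
  move=> /near_ae_on nul; have : mu (A 1%N) = 0%E.
    apply/negligibleP => //; apply: negligibleS nul => t At /=.
    move=> /(_ (AD _ _ At)); rewrite indicE mem_set// => /eqP.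
    by rewrite oner_eq0.
  move=> A0; have W0 : W 0%E = 0%E.
    by apply: integral0_eq => r _; rewrite min_r.
  have := WA 1%N; rewrite A0 W0 => -[w0]; have := large 1%N.
  by rewrite -w0 mulr0 leNgt ltr0n.
(* Running maxima of the [u i * \1_(A i)]. Since [phi] of a maximum is at most the sum of the values
   of [phi], subadditivity bounds their modulars by partial sums of [2^-(i+1)]. *)
pose F := fix F n : T -> R := match n with
  | 0%N => fun=> 0 | n.+1 => fun t => Num.max (F n t) (u n * \1_(A n) t) end.
have mv n : M (fun t => u n * \1_(A n) t).
  by apply: measurable_funM => //; exact: measurable_indic.
have mF n : M (F n).
  elim: n => [|n IHn] /=; first exact: measurable_cst.
  exact: measurable_maxr.
have F0 n t : 0 <= F n t.
  by elim: n => [|n IHn] //=; rewrite le_max IHn.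
have ndF t : nondecreasing_seq (F ^~ t).
  by apply/nondecreasing_seqP => n /=; rewrite le_max lexx.
have Fcvg t : cvgn (F ^~ t).
  apply: nondecreasing_is_cvgn => //; have [b bP] := bnd t.
  exists (Num.max b 0) => _ [n _ <-]; elim: n => [|n IHn] /=; first by rewrite le_max lexx orbT.
  rewrite ge_max IHn /= le_max indicE; have [|_] := boolP (t \in A n).
    by rewrite inE mulr1 => /bP ->.
  by rewrite mulr0 lexx orbT.
pose f t := limn (F ^~ t).
have mf : M f by apply: (measurable_fun_cvg (h := F)) => // t _; exact: Fcvg.
have phi_le_v n t : phi `|u n * \1_(A n) t| <= phi (u n).
  apply: orlicz_le => //; rewrite normrM (ger0_norm (u0 n)) ler_piMr// indicE normr_nat.
  by case: (_ \in _).
have rhov n : (rho_choquet (fun t => u n * \1_(A n) t)%R <= (2^-1 ^+ n.+1)%:E)%E.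
  apply: (@le_trans _ _ ((phi (u n))%:E * W (mu (A n)))%E); last first.
    by rewrite WA -EFinM lee_fin; exact: small.
  apply: choquet_le_bound => //; [exact: (mpsi (mv n))|exact: orlicz_ge0|].
  move=> t Dt; rewrite indicE; have [|_] := boolP (t \in A n); first by rewrite inE.
  by rewrite mulr0 normr0 orlicz0// ltxx.
have rhoF n : (rho_choquet (F n) <= (1 - 2^-1 ^+ n)%:E)%E.
  elim: n => [|n IHn]; first by rewrite /= rho0 expr0 subrr.
  have := choquet_convex mu mD mm m0 (ltr01 : 0 < (1 : R)) ltr01 (mpsi (mF n)) (mpsi (mv n)).
  rewrite !mul1e => cvx.
  apply: (@le_trans _ _ (rho_choquet (F n) + rho_choquet (fun t => u n * \1_(A n) t)%R)%E).
    apply: le_trans cvx; apply: choquet_le => //.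
    - exact: (mpsi (mF n.+1)).
    - by apply: measurable_funD; apply: measurable_funM => //; [exact: (mpsi (mF n))|exact: (mpsi (mv n))].
    apply: aeW => t Dt; rewrite !mul1r /=.
    have p0 x : 0 <= phi `|x| by apply: orlicz_ge0.
    by have [_|_] := leP (F n t) (u n * \1_(A n) t); rewrite ?lerDl ?lerDr.
  apply: le_trans (leeD IHn (rhov n)) _; rewrite -EFinD lee_fin exprS; lra.
exists f.
  split=> //; exists 1 => //; rewrite scale1r rhoE//.
  apply: le_lt_trans (ltry 1); apply: (rho_fatou mF mf).
    by apply: aeW => t Dt; exact: Fcvg.
  by move=> n; apply: le_trans (rhoF n) _; rewrite lee_fin gerBl exprn_ge0.
have m2f : M (2 *: f) by apply: measurable_funM.
move=> [_ /(_ 2)]; rewrite rhoE// ltey => /negP; apply; apply/eqP.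
have f_ge n t : A n t -> u n <= f t.
  move=> At; apply: le_trans (_ : F n.+1 t <= _).
    by rewrite /= indicE mem_set// mulr1 le_max lexx orbT.
  exact: (nondecreasing_cvgn_le (ndF t) (Fcvg t) n.+1).
apply/eqyP => r r0.
have [n rn] : exists n : nat, r <= n%:R.
  by exists (Num.truncn r).+1; apply/ltW/truncnS_gt.
apply: (@le_trans _ _ n%:R%:E); first by rewrite lee_fin.
have [->|n0] := posnP n; first exact: choquet_ge0.
have P2 : 0 <= phi (2 * u n) by apply: orlicz_ge0 => //; rewrite mulr_ge0.
(* Level sets are strict, so the level is half of the value taken on [A n]; the doubled [n] in
   [large] compensates. *)
set l := phi (2 * u n) / 2.
have l0 : 0 <= l by rewrite divr_ge0.
have := choquet_ge_level mu mD mm m0 (mpsi m2f) l0; apply: le_trans.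
have lw : (n%:R%:E <= l%:E * W (mu (A n)))%E.
  rewrite WA -EFinM lee_fin /l mulrAC ler_pdivlMr//.
  by apply: le_trans (large n); rewrite -mul2n natrM mulrC.
apply: le_trans lw _; apply: lee_wpmul2l; first by rewrite lee_fin.
have P20 : 0 < phi (2 * u n).
  rewrite lt_def P2 andbT; apply: contraTneq (large n) => ->.
  by rewrite mul0r -ltNge ltr0n double_gt0.
apply: weight_integral_le => //; apply: le_measure; rewrite ?inE//.
  by apply: overlevel_set_measurable => //; exact: mpsi.
move=> t At; split; first exact: AD At.
rewrite divr_gt0//=; apply: (@lt_le_trans _ _ (phi (2 * u n))).
  by rewrite /l ltr_pdivrMr// ltr_pMr// ltr1n.
apply: orlicz_le => //; first by rewrite mulr_ge0.
rewrite /GRing.scale /= normrM normr_nat ler_wpM2l//.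
by apply: le_trans (f_ge _ _ At) (ler_norm _).
Qed.

End orlicz_modular.

(** * Decreasing rearrangements *)

Section product_measure.
Context d1 d2 (T1 : measurableType d1) (T2 : measurableType d2) (R : realType).
Variables (m1 : {sigma_finite_measure set T1 -> \bar R}).
Variables (m2 : {sigma_finite_measure set T2 -> \bar R}).

(** Needed to exchange an integral over the index space with one over the plane of levels
    [(r, l)]. *)
Lemma product_measure_sigma_finite : sigma_finite setT (m1 \x m2)%E.
Proof.
have /sigma_finiteP[F [FT ndF Ffin]] := sigma_finiteT m1.
have /sigma_finiteP[G [GT ndG Gfin]] := sigma_finiteT m2.
exists (fun n => F n `*` G n) => [|n].
  apply/seteqP; split=> // -[x y] _.
  have [i _ Fx] : (\bigcup_n F n) x by rewrite -FT.
  have [j _ Gy] : (\bigcup_n G n) y by rewrite -GT.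
  exists (maxn i j) => //; split => /=.
    exact: (subsetPset _ _ (ndF _ _ (leq_maxl i j))).
  exact: (subsetPset _ _ (ndG _ _ (leq_maxr i j))).
have [[mF finF] [mG finG]] := (Ffin n, Gfin n).
split; first exact: measurableX.
by rewrite product_measure1E// lte_mul_pinfty// ge0_fin_numE.
Qed.

Definition sigma_finite_product :
    {sigma_finite_measure set (T1 * T2)%type -> \bar R} :=
  HB.pack (m1 \x m2)%E
    (Measure_isSigmaFinite.Build _ _ _ (m1 \x m2)%E product_measure_sigma_finite).

End product_measure.

(* With s = t%:E, this is the decreasing rearrangement of f at t. *)
Definition rearrangement (R : realType) (T : Type) (mu : set T -> \bar R) (D : set T)
    (f : T -> R) (s : \bar R) : \bar R :=
  ereal_inf [set c%:E | c in
    [set c : R | 0 < c /\ (mu [set t | D t /\ (c < `|f t|)%R] <= s)%E]].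

Section rearrangement.
Context d (T : measurableType d) (R : realType).
Variables (mu : {sigma_finite_measure set T -> \bar R}) (D : set T).
Hypothesis mD : measurable D.
Variable phi : R -> R.
Hypothesis phiP : orlicz phi.
Local Notation M := (@measurable_fun _ _ T R D).
Local Notation ov := (overlevel mu D).

Lemma orlicz_lt (x y : R) : 0 <= x -> x < y -> phi x < phi y.
Proof.
move=> x0 xy; have y0 : 0 < y by exact: le_lt_trans xy.
have xy1 : x / y < 1 by rewrite ltr_pdivrMr// mul1r.
have xy0 : 0 <= x / y by apply: divr_ge0 => //; exact: ltW.
rewrite -[x in phi x](divfK (lt0r_neq0 y0)) -[_ * y]addr0 -(mulr0 (1 - x / y)).
apply: le_lt_trans (orlicz_convex phiP _ _ _) _ => //; [by rewrite xy0 ltW|exact: ltW|].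
by rewrite orlicz0// mulr0 addr0 -[ltRHS]mul1r ltr_pM2r// orlicz_gt0.
Qed.

Lemma orlicz_ge_linear (x : R) : 1 <= x -> x * phi 1 <= phi x.
Proof.
move=> x1; have x0 : 0 < x by exact: lt_le_trans x1.
have : phi (x^-1 * x + (1 - x^-1) * 0) <= x^-1 * phi x + (1 - x^-1) * phi 0.
  by apply: orlicz_convex => //; [rewrite invr_ge0 invf_le1// ltW|exact: ltW].
by rewrite mulVf ?gt_eqF// orlicz0// !mulr0 !addr0 ler_pdivlMl.
Qed.

Lemma orlicz_le_linear (x : R) : 0 <= x <= 1 -> phi x <= x * phi 1.
Proof.
move=> x01; have : phi (x * 1 + (1 - x) * 0) <= x * phi 1 + (1 - x) * phi 0.
  exact: orlicz_convex.
by rewrite orlicz0// !mulr0 !addr0 mulr1.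
Qed.

(** Intermediate values on [0, b], where linear growth beyond 1 ensures [l <= phi b]. *)
Lemma orlicz_surjective (l : R) : 0 < l -> exists2 c, 0 < c & phi c = l.
Proof.
move=> l0; have p1 : 0 < phi 1 by exact: orlicz_gt0.
set b := Num.max 1 (l / phi 1); have b1 : 1 <= b by rewrite le_max lexx.
have lb : l <= phi b.
  apply: le_trans (orlicz_ge_linear b1); rewrite -ler_pdivrMr//.
  by rewrite le_max lexx orbT.
have b0 : 0 <= b by exact: le_trans b1.
have := @IVT R (fun x => phi `|x|) 0 b l b0.
rewrite normr0 (ger0_norm b0) orlicz0// => /(_ _ _)[||c].
- by apply: continuous_subspaceT; exact: orlicz_norm_continuous.
- by rewrite ge_min le_max (ltW l0) lb orbT.
rewrite in_itv/= => /andP[c0 _] cl; exists c; last by rewrite -cl ger0_norm.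
rewrite lt_def c0 andbT; apply/eqP => c00; move: cl l0.
by rewrite c00 normr0 orlicz0// => <-; rewrite ltxx.
Qed.

Lemma er_map_rearrangement_ge0 f (s : \bar R) :
  (0 <= er_map phi (rearrangement mu D f s))%E.
Proof.
rewrite /rearrangement; set I := ereal_inf _.
have : (0 <= I)%E by apply: le_ereal_inf_tmp => _ [e [e0 _] <-]; rewrite lee_fin ltW.
by case: I => [i| |//] //=; rewrite !lee_fin; exact: orlicz_ge0.
Qed.

(** The level sets of the rearranged function are initial segments with the length of the original
    level sets. Let [phi c = l]. If the measure at [c] is at most [s], then [c] competes in the
    infimum. Otherwise continuity of the measure from below gives some [c' > c] whose level set
    still exceeds [s], and every competitor is at least [c']. *)
Lemma er_map_rearrangement_level f (s : \bar R) (l : R) : M f -> 0 < l ->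
  (l%:E < er_map phi (rearrangement mu D f s))%E =
  (s < ov (fun t => phi `|f t|) l)%E.
Proof.
move=> mf l0; have [c c0 cl] := orlicz_surjective l0.
pose Dc (e : R) := mu [set t | D t /\ e < `|f t|].
have mDc (e : R) : measurable [set t | D t /\ e < `|f t|].
  rewrite (_ : [set t | _] = D `&` (fun t => `|f t|) @^-1` `]e, +oo[).
    by apply: (measurableT_comp (f := @Num.norm R R) _ mf) => //.
  by apply/seteqP; split=> t /=; rewrite in_itv/= andbT.
have -> : ov (fun t => phi `|f t|) l = Dc c.
  congr (mu _); apply/seteqP; split=> t /= [Dt].
    move=> /andP[_]; rewrite -cl => cf; split=> //; rewrite ltNge; apply/negP => fc.
    by have := orlicz_le phiP (normr_ge0 (f t)) fc; rewrite leNgt cf.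
  by move=> cf; split=> //; rewrite l0 /= -cl orlicz_lt// ltW.
rewrite /rearrangement; set I := ereal_inf _.
have I0 : (0 <= I)%E by apply: le_ereal_inf_tmp => _ [e [e0 _] <-]; rewrite lee_fin ltW.
apply/idP/idP => [lI|sc]; last first.
  have : exists n : nat, (s < Dc (c + n.+1%:R^-1)%R)%E.
    apply: contrapT => nP.
    have cv : Dc (c + n.+1%:R^-1) @[n --> \oo] --> Dc c.
      have -> : Dc c = mu (\bigcup_n [set t | D t /\ c + n.+1%:R^-1 < `|f t|]).
        congr (mu _); apply/seteqP; split=> t /=.
          move=> [Dt cf]; exists (Num.truncn (`|f t| - c)^-1) => //; split=> //.
          rewrite -ltrBrDl -[ltRHS]invrK ltf_pV2 ?posrE ?invr_gt0 ?ltr0n ?subr_gt0//.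
          exact: truncnS_gt.
        by move=> [n _ [Dt cf]]; split=> //; apply: le_lt_trans cf; rewrite lerDl.
      apply: nondecreasing_cvg_mu => //.
        by apply: bigcup_measurable => n _; exact: mDc.
      move=> i j ij; apply/subsetPset => t /= [Dt it]; split=> //.
      by apply: le_lt_trans it; rewrite lerD2l lef_pV2 ?posrE ?ltr0n// ler_nat.
    have : (Dc c <= s)%E.
      rewrite -(cvg_lim _ cv)//; apply: lime_le; first by apply/cvg_ex; eexists; exact: cv.
      by apply: nearW => n; rewrite leNgt; apply/negP => sn; apply: nP; exists n.
    by rewrite leNgt sc.
  move=> [n sn]; set c' := c + n.+1%:R^-1 in sn.
  have cc' : c < c' by rewrite ltrDl invr_gt0 ltr0n.
  have cI : (c'%:E <= I)%E.
    apply: le_ereal_inf_tmp => _ [e [e0 es] <-]; rewrite lee_fin leNgt; apply/negP => ec.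
    move: sn; rewrite ltNge => /negP; apply; apply: le_trans es.
    apply: le_measure; rewrite ?inE//.
    by move=> t [Dt ct]; split=> //; exact: lt_trans ct.
  move: cI; case: I I0 => [i| |//] I0; last by rewrite /= ltry.
  rewrite !lee_fin /= lte_fin -cl => ci; apply: orlicz_lt; first exact: ltW.
  exact: lt_le_trans ci.
rewrite ltNge; apply/negP => cs; move: lI; rewrite ltNge => /negP; apply.
have : (I <= c%:E)%E by apply: ereal_inf_lbound; exists c.
move: I0; case: I => [i| |//]; last by move=> _; rewrite leye_eq.
rewrite (lee_fin 0) (lee_fin i) => i0 ic.
by rewrite (_ : er_map phi i%:E = (phi i)%:E)// lee_fin -cl; exact: orlicz_le.
Qed.

End rearrangement.

(** * Modulars of rearrangements as double integrals over levels *)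

Section rearranged_integral.
Context d (T : measurableType d) (R : realType).
Variables (mu : {sigma_finite_measure set T -> \bar R}) (D : set T).
Hypothesis mD : measurable D.
Variable phi : R -> R.
Hypothesis phiP : orlicz phi.
Context d' (J : measurableType d').
Variables (nu : {sigma_finite_measure set J -> \bar R}) (S : set J).
Variables (kappa w : J -> R).
Hypothesis mS : measurable S.
Hypothesis mkappa : measurable_fun S kappa.
Hypothesis mw : measurable_fun S w.
Hypothesis w_gt0 : forall t, S t -> 0 < w t.
Hypothesis w_decr : forall s t, S s -> S t -> kappa s <= kappa t -> w t <= w s.
Hypothesis nu_initial : forall B, measurable B -> B `<=` D ->
  nu [set t | S t /\ ((kappa t)%:E < mu B)%E] = mu B.

Local Notation leb := (@lebesgue_measure R : {sigma_finite_measure set (measurableTypeR R) -> \bar R}).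
Local Notation M := (@measurable_fun _ _ T R D).
Local Notation ov := (overlevel mu D).

Definition weight_levels (r : measurableTypeR R) : \bar R := overlevel nu S w r.
Local Notation m := weight_levels.
Local Notation W := (weight_integral m).

Lemma weight_levels_measurable : measurable_fun setT m.
Proof. exact: measurable_overlevel. Qed.

Lemma weight_levels_ge0 r : (0 <= m r)%E. Proof. exact: measure_ge0. Qed.

(** [kappa] is the position at which the rearrangement is evaluated: the identity on an interval,
    the index for sequences. This is the initial segment of length [s]. *)
Let initial (s : \bar R) := [set t | S t /\ ((kappa t)%:E < s)%E].

Let minitial s : measurable (initial s).
Proof.
have := measurable_lte mS (f := EFin \o kappa) (g := cst s).
by apply; [exact/measurable_EFinP|exact: measurable_cst].
Qed.

(** The weight decreases with the position, so a level set of [w] and an initial segment are nested,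
    and their intersection has the smaller measure. The length [s] is the measure of some [B] so
    that [nu_initial] applies; for the counting measure it is an integer or infinite. *)
Let nu_level s r : (exists2 B, measurable B /\ B `<=` D & s = mu B) ->
  nu [set t | initial s t /\ 0 < r < w t] = mine (m r) s.
Proof.
move=> [B [mB BD] sB].
have mm : measurable [set t | S t /\ 0 < r < w t] by exact: overlevel_set_measurable.
have [sub|nsub] := pselect ([set t | S t /\ 0 < r < w t] `<=` initial s).
  rewrite (_ : [set t | _] = [set t | S t /\ 0 < r < w t]).
    rewrite -/(overlevel nu S w r) -/(m r) min_l// sB -(nu_initial mB BD) -sB.
    by apply: le_measure; rewrite ?inE//; exact: minitial.
  apply/seteqP; split=> t /=; first by move=> [[St _] rt].
  by move=> [St rt]; split=> //; apply: sub.
have sub : initial s `<=` [set t | S t /\ 0 < r < w t].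
  have [t0 [[St0 /andP[r0 rt0]] nt0]] : exists t0, [set t | S t /\ 0 < r < w t] t0 /\ ~ initial s t0.
    apply: contrapT => nP; apply: nsub => t tr; apply: contrapT => nt.
    by apply: nP; exists t.
  move=> t [St ts]; split=> //; rewrite r0 /=; apply: lt_le_trans rt0 _.
  apply: w_decr => //; rewrite -lee_fin; apply: le_trans (ltW ts) _.
  by rewrite leNgt; apply/negP => t0s; apply: nt0.
rewrite (_ : [set t | _] = initial s).
  rewrite (_ : nu (initial s) = s); last by rewrite sB; exact: nu_initial.
  rewrite min_r// -[leLHS](_ : nu (initial s) = s); last by rewrite sB; exact: nu_initial.
  by apply: le_measure; rewrite ?inE//; exact: minitial.
apply/seteqP; split=> t /=; first by move=> [].
by move=> ts; split=> //; exact: (sub _ ts).2.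
Qed.

Lemma weight_integralE B : measurable B -> B `<=` D ->
  W (mu B) = (\int[nu]_(t in [set t | S t /\ ((kappa t)%:E < mu B)%E]) (w t)%:E)%E.
Proof.
move=> mB BD; set Sb := [set t | _].
have mSb : measurable Sb by exact: minitial.
have SbS : Sb `<=` S by move=> t [].
have mwb : measurable_fun Sb w by apply: measurable_funS mw.
have := layer_cake nu mSb (lexx 0) mwb.
rewrite (_ : (\int[nu]_(t in Sb) _ = \int[nu]_(t in Sb) (w t)%:E)%E); last first.
  by apply: eq_integral => t; rewrite inE => -[St _]; rewrite subr0 max_l// ltW// w_gt0.
move=> <-; rewrite integral_mkcond; apply: eq_integral => r _.
rewrite -nu_level; last by exists B.
have [r0|/negP r0] := pselect (0 < r).
  rewrite [RHS](_ : _ = overlevel nu Sb w r)//.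
  by rewrite patchE mem_set_itv in_itv/= andbT r0.
rewrite [RHS](_ : _ = 0%E); first by apply: overlevel_npos; rewrite leNgt.
by rewrite patchE mem_set_itv in_itv/= andbT (negbTE r0).
Qed.

Lemma weight_integral_infty : W +oo = (\int[nu]_(t in S) (w t)%:E)%E.
Proof.
have := layer_cake nu mS (lexx 0) mw.
rewrite (_ : (\int[nu]_(t in S) _ = \int[nu]_(t in S) (w t)%:E)%E); last first.
  by apply: eq_integral => t; rewrite inE => St; rewrite subr0 max_l// ltW// w_gt0.
move=> <-; rewrite integral_mkcond; apply: eq_integral => r _.
rewrite min_l ?leey// patchE mem_set_itv in_itv/= andbT; case: ifPn => // r0.
by rewrite /m overlevel_npos// leNgt.
Qed.

(** At each [t] the integrand is the area of the rectangle of pairs [(r, l)] with [r] below [w t]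
    and [l] below [a t]. Exchanging the integrals leaves, for fixed [(r, l)], the intersection of a
    weight level and an initial segment, which [nu_level] measures. *)
Lemma rearranged_integral f : M f ->
  (\int[nu]_(t in S) (er_map phi (rearrangement mu D f (kappa t)%:E) * (w t)%:E))%E =
  rho_choquet mu D phi m f.
Proof.
move=> mf; pose h := fun t => phi `|f t|.
have mh : M h.
  apply: (@measurableT_comp _ _ _ _ _ _ (fun x : R => phi `|x|) D f) => //.
  by apply: continuous_measurable_fun; exact: orlicz_norm_continuous.
pose a t := er_map phi (rearrangement mu D f (kappa t)%:E).
have aE t (l : R) : 0 < l -> (l%:E < a t)%E = ((kappa t)%:E < ov h l)%E.
  by move=> l0; exact: er_map_rearrangement_level.
have a0 t : (0 <= a t)%E by exact: er_map_rearrangement_ge0.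
pose A := [set z : J * (measurableTypeR R * measurableTypeR R) |
   S z.1 /\ [/\ 0 < z.2.1 < w z.1, 0 < z.2.2 & ((kappa z.1)%:E < ov h z.2.2)%E]].
have mA : measurable A.
  pose k' := kappa \_ S; pose w' := w \_ S.
  have mk' : measurable_fun setT k' by apply/(measurable_restrictT _ _).1.
  have mw' : measurable_fun setT w' by apply/(measurable_restrictT _ _).1.
  pose Z := (J * (measurableTypeR R * measurableTypeR R))%type.
  have m1 : measurable_fun setT (fst : Z -> J) by exact: measurable_fst.
  have m2 : measurable_fun setT (fun z : Z => z.2.1).
    by apply: measurableT_comp; [exact: measurable_fst|exact: measurable_snd].
  have m3 : measurable_fun setT (fun z : Z => z.2.2).
    by apply: measurableT_comp; [exact: measurable_snd|exact: measurable_snd].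
  have e1 : measurable_fun setT (fun z : Z => (k' z.1)%:E).
    by apply/measurable_EFinP; exact: measurableT_comp.
  have e2 : measurable_fun setT (fun z : Z => (w' z.1)%:E).
    by apply/measurable_EFinP; exact: measurableT_comp.
  have e3 : measurable_fun setT (fun z : Z => (z.2.1)%:E) by exact/measurable_EFinP.
  have e4 : measurable_fun setT (fun z : Z => (z.2.2)%:E) by exact/measurable_EFinP.
  have e5 : measurable_fun setT (fun z : Z => ov h z.2.2).
    by apply: measurableT_comp => //; exact: measurable_overlevel.
  have e0 : measurable_fun setT (cst 0%E : Z -> \bar R) by exact: measurable_cst.
  have A1 := measurable_lte measurableT e0 e3.
  have A2 := measurable_lte measurableT e3 e2.
  have A3 := measurable_lte measurableT e0 e4.
  have A4 := measurable_lte measurableT e1 e5.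
  have A5 : measurable (S `*` [set: measurableTypeR R * measurableTypeR R]) by exact: measurableX.
  rewrite (_ : A = S `*` setT `&` (setT `&` [set z : Z | 0 < (z.2.1)%:E]%E)
      `&` (setT `&` [set z : Z | (z.2.1)%:E < (w' z.1)%:E]%E)
      `&` (setT `&` [set z : Z | 0 < (z.2.2)%:E]%E)
      `&` (setT `&` [set z : Z | (k' z.1)%:E < ov h z.2.2]%E)).
    by do 4! apply: measurableI => //.
  rewrite !setTI; apply/seteqP; split=> [[t [r l]]|[t [r l]]] /=.
    by move=> [St [/andP[r0 rw] l0 kt]]; rewrite !lte_fin /k' /w' !patchE !mem_set.
  rewrite !lte_fin /k' /w' => -[[[[[St _] r0] rw] l0] kt].
  move: rw kt; rewrite !patchE !mem_set// => rw kt.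
  by split=> //; split=> //=; rewrite r0 rw.
have := integral_sections nu (sigma_finite_product leb leb) mA.
rewrite [X in X = _ -> _](_ : _ = (\int[nu]_(t in S) (a t * (w t)%:E))%E); last first.
  rewrite [RHS]integral_mkcond; apply: eq_integral => t _; rewrite patchE.
  case: ifPn => tS; last first.
    rewrite (_ : xsection A t = set0) ?measure0//; apply/seteqP; split=> // z.
    by rewrite /xsection/= inE => -[St]; move: tS; rewrite mem_set.
  move: tS; rewrite inE => St.
  pose L := [set l : measurableTypeR R | 0 < l /\ (l%:E < a t)%E].
  have LE : L = if a t is r%:E then `]0%R, r[%classic else `]0%R, +oo[%classic.
    rewrite /L; move: (a0 t); case: (a t) => [r| |//] _.
      apply/seteqP; split=> l /=; rewrite in_itv/= lte_fin; first by move=> [-> ->].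
      by move=> /andP[-> ->].
    apply/seteqP; split=> l /=; rewrite in_itv/= andbT; first by case.
    by move=> ->; rewrite ltry.
  have -> : xsection A t = `]0%R, w t[%classic `*` L.
    apply/seteqP; split=> [[r l]|[r l]]; rewrite /xsection/= inE /A /= in_itv/=.
      by move=> [_ [-> l0]]; rewrite -aE.
    by move=> [rw [l0 la]]; split=> //; rewrite -aE.
  rewrite [LHS]product_measure1E//; last first.
    by rewrite LE; case: (a t) => *; exact: measurable_itv.
  rewrite /= lebesgue_measure_itv/= lte_fin w_gt0// sube0 muleC; congr (_ * _)%E.
  rewrite LE; move: (a0 t); case: (a t) => [r| |//] r0; rewrite lebesgue_measure_itv/=.
    rewrite lte_fin; case: ifPn => [_|]; first by rewrite sube0.
    by rewrite -leNgt => r0'; rewrite (@le_anti _ _ r 0)// r0' -lee_fin.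
  by rewrite ltry.
move=> ->; apply: eq_integral => z _.
have [z2|z2] := leP z.2 0.
  rewrite overlevel_npos// min_r ?weight_levels_ge0//.
  rewrite (_ : ysection A z = set0) ?measure0//; apply/seteqP; split=> // t.
  by rewrite /ysection/= inE => -[_ [_ + _]]; rewrite /= ltNge z2.
rewrite -nu_level.
  congr (nu _); apply/seteqP; split=> t; rewrite /ysection/= inE /A /=.
    by move=> [St [rw _ kt]].
  by move=> [[St kt] rw].
exists [set t | D t /\ 0 < z.2 < h t] => //; split.
  exact: overlevel_set_measurable.
by move=> t [].
Qed.

End rearranged_integral.

(** * Growth conditions and choice of level sets *)

Section weight_integral_theory.
Context (R : realType) (m : measurableTypeR R -> \bar R).
Hypothesis mm : measurable_fun setT m.
Hypothesis m0 : forall r, (0 <= m r)%E.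
Local Notation W := (weight_integral m).
Local Notation leb := (@lebesgue_measure R : {sigma_finite_measure set (measurableTypeR R) -> \bar R}).

Lemma weight_integral_natmul (n : nat) (s : R) : 0 <= s ->
  (W (n%:R * s)%:E <= n%:R%:E * W s%:E)%E.
Proof.
move=> s0; have W0 : (0 <= W s%:E)%E by apply: weight_integral_ge0; rewrite ?lee_fin.
elim: n => [|n IHn].
  rewrite mul0r mul0e (_ : W _ = 0%E)//.
  by apply: integral0_eq => r _; rewrite min_r.
rewrite -natr1 mulrDl mul1r EFinD; apply: le_trans (weight_integral_subadditive mm m0 _ _) _.
- by rewrite lee_fin mulr_ge0.
- by rewrite lee_fin.
by rewrite EFinD ge0_muleDl ?lee_fin// mul1e; apply: leeD.
Qed.

(** [W] is subadditive, hence at most linear along multiples of [s0]: one finite value suffices. *)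
Lemma weight_integral_fin (s0 : R) : 0 < s0 -> (W s0%:E < +oo)%E ->
  forall s, (0 <= s < +oo)%E -> (W s < +oo)%E.
Proof.
move=> s00 Ws0 [s| |]; rewrite ?ltxx ?andbF// => /andP[s0' _].
have [n sn] : exists n : nat, s <= n%:R * s0.
  exists (Num.truncn (s / s0)).+1; rewrite -ler_pdivrMr//.
  by apply/ltW/truncnS_gt.
apply: le_lt_trans (weight_integral_le mm m0 s0' (_ : _ <= (n%:R * s0)%:E)%E) _.
  by rewrite lee_fin.
apply: le_lt_trans (weight_integral_natmul n (ltW s00)) _.
by apply: lte_mul_pinfty => //; rewrite lee_fin.
Qed.

Lemma weight_integral_gt0 (r0 : R) : 0 < r0 ->
  (forall r, 0 < r -> r <= r0 -> (m r0 <= m r)%E) -> (0 < m r0)%E ->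
  forall s, (0 < s)%E -> (0 < W s)%E.
Proof.
move=> r00 mr mr0 s s0.
have : (\int[leb]_r (cst (mine (m r0) s) \_ `]0%R, r0]) r <= W s)%E.
  apply: ge0_le_integral => //.
  - by move=> r _; apply: erestrict_ge0 => *; rewrite le_min m0 ltW.
  - by apply/(measurable_restrictT _ _).1.
  - exact: measurable_mine.
  move=> r _; rewrite patchE mem_set_itv in_itv/=; case: ifPn => [/andP[r1 r2]|_].
    by rewrite le_min !ge_min mr// lexx orbT.
  by rewrite le_min m0 ltW.
apply: lt_le_trans; rewrite -integral_mkcond integral_cst//= lebesgue_measure_itv/= lte_fin r00.
by rewrite sube0; apply: mule_gt0; rewrite ?lte_fin// lt_min mr0.
Qed.

Lemma weight_integral_halving_cvg (s : R) : 0 < s -> (W s%:E < +oo)%E ->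
  W (s * 2^-1 ^+ n)%:E @[n --> \oo] --> 0%E.
Proof.
move=> s0 Ws.
have := @dominated_convergence _ _ _ leb setT measurableT
  (fun n r => mine (m r) (s * 2^-1 ^+ n)%:E) (cst 0%E) (fun r => mine (m r) s%:E).
have -> : (\int[leb]_(x in setT) cst 0%E x = 0)%E by apply: integral0_eq.
have p0 n : 0 <= s * 2^-1 ^+ n by rewrite mulr_ge0 ?exprn_ge0// ltW.
case => //.
- by move=> n; exact: measurable_mine.
- apply: aeW => r _; apply: (@squeeze_cvge _ _ _ _ (cst 0%E) _ (fun n => (s * 2^-1 ^+ n)%:E)).
  + by apply: nearW => n; rewrite le_min m0 lee_fin p0 ge_min lexx orbT.
  + exact: cvg_cst.
  + apply: cvg_EFin; first exact: nearW.
    rewrite -[X in _ --> X](mulr0 s).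
    apply: cvgM; first exact: cvg_cst.
    by apply: cvg_expr; rewrite ger0_norm ?invr_ge0// invf_lt1 ?ltr1n.
- apply/integrableP; split; first exact: measurable_mine.
  rewrite (_ : (\int[_]_x `|_|)%E = W s%:E)//.
  by apply: eq_integral => r _; rewrite gee0_abs// le_min m0 lee_fin ltW.
- apply: aeW => r n _; rewrite gee0_abs ?le_min ?m0 ?lee_fin ?p0//.
  rewrite ge_min lexx /= ge_min; apply/orP; right; rewrite lee_fin.
  by rewrite ler_piMr ?exprn_ile1// ?ltW// invf_lt1 ?ltr1n.
Qed.

(** Halve [s] until [W] first drops to [x] or below. One step earlier [W] was at least [x], and by
    subadditivity halving divides [W] by at most 2. *)
Lemma weight_integral_select (s x : R) : 0 < s -> (W s%:E < +oo)%E -> 0 < x ->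
  (x%:E <= W s%:E)%E ->
  exists t : R, [/\ 0 < t <= s, (W t%:E <= x%:E)%E & (x%:E <= 2%:E * W t%:E)%E].
Proof.
move=> s0 Ws x0 xW.
have p0 n : 0 < s * 2^-1 ^+ n by rewrite mulr_gt0// exprn_gt0// invr_gt0.
have : exists n, (W (s * 2^-1 ^+ n)%:E <= x%:E)%E.
  have x0E : (0 < x%:E)%E by rewrite lte_fin.
  have [n _ nP] := cvge0_near_lt (weight_integral_halving_cvg s0 Ws) x0E.
  by exists n; apply/ltW/nP => /=.
move=> /ex_minnP[[|n] Wn nmin].
  exists s; move: Wn; rewrite expr0 mulr1 => Wn; split => //; first by rewrite s0 lexx.
  apply: le_trans xW _; rewrite -[leLHS]mul1e; apply: lee_wpmul2r; last by rewrite lee_fin ler1n.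
  by apply: weight_integral_ge0; rewrite // lee_fin ltW.
exists (s * 2^-1 ^+ n.+1); split => //.
  by rewrite p0 ler_piMr ?(ltW s0)// exprn_ile1// ?invr_ge0// invf_le1// ler1n.
have xWn : (x%:E <= W (s * 2^-1 ^+ n)%:E)%E.
  by rewrite leNgt; apply/negP => /ltW/nmin; rewrite ltnn.
apply: le_trans xWn _; rewrite (_ : s * 2^-1 ^+ n = 2%:R * (s * 2^-1 ^+ n.+1)); last first.
  by rewrite exprS; field.
by apply: weight_integral_natmul; exact: ltW.
Qed.

End weight_integral_theory.

Section growth.
Context (R : realType) (phi : R -> R).
Hypothesis phiP : orlicz phi.

(** [Delta2_infty] fails beyond every threshold; the threshold [u0] makes [phi u >= b] by linear
    growth. *)
Lemma not_Delta2_infty (K b : R) : ~ Delta2_infty phi -> 0 < K ->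
  exists u, [/\ 0 < u, b <= phi u & K * phi u < phi (2 * u)].
Proof.
move=> nD K0; have p1 : 0 < phi 1 by exact: orlicz_gt0.
set u0 := Num.max 1 (b / phi 1).
have u01 : 1 <= u0 by rewrite le_max lexx.
have [u [u0u Ku]] : exists u, u0 <= u /\ K * phi u < phi (2 * u).
  apply: contrapT => nu; apply: nD; exists K, u0; split=> //; first exact: le_trans u01.
  by move=> u u0u; rewrite leNgt; apply/negP => Ku; apply: nu; exists u.
have u1 : 1 <= u by exact: le_trans u0u.
exists u; split=> //; first exact: lt_le_trans u1.
apply: le_trans (orlicz_ge_linear phiP u1); rewrite -ler_pdivrMr//.
by apply: le_trans u0u; rewrite le_max lexx orbT.
Qed.

Lemma not_Delta2_zero (K e : R) : ~ Delta2_zero phi -> 0 < K -> 0 < e ->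
  exists u, [/\ 0 < u <= 1, phi u <= e & K * phi u < phi (2 * u)].
Proof.
move=> nD K0 e0; have p1 : 0 < phi 1 by exact: orlicz_gt0.
set u0 := Num.min 1 (e / phi 1).
have u00 : 0 < u0 by rewrite lt_min ltr01 divr_gt0.
have [u [u0' uu0 Ku]] : exists u, [/\ 0 < u, u <= u0 & K * phi u < phi (2 * u)].
  apply: contrapT => nu; apply: nD; exists K, u0; split=> // u u0' uu0.
  by rewrite leNgt; apply/negP => Ku; apply: nu; exists u.
have u1 : u <= 1 by apply: le_trans uu0 _; rewrite ge_min lexx.
exists u; split=> //; first by rewrite u0' u1.
apply: le_trans (orlicz_le_linear phiP _) _; first by rewrite (ltW u0') u1.
by rewrite -ler_pdivlMr//; apply: le_trans uu0 _; rewrite ge_min lexx orbT.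
Qed.

(** Between the two thresholds [phi (2 * u)] is at most [phi (2 * b)] and [phi u] at least [phi a],
    so their ratio is bounded. *)
Lemma Delta2_zero_infty : Delta2_zero phi -> Delta2_infty phi -> Delta2 phi.
Proof.
move=> [K [a [K0 a0 Ka]]] [L [b [L0 b0 Lb]]].
have pa : 0 < phi a by exact: orlicz_gt0.
have pb : 0 <= phi (2 * b) by apply: orlicz_ge0 => //; rewrite mulr_ge0.
exists (Num.max K (Num.max L (phi (2 * b) / phi a))); first by rewrite lt_max K0.
move=> u u0; have pu := orlicz_ge0 phiP u0.
have [->|un0] := eqVneq u 0; first by rewrite mulr0 orlicz0// mulr0.
have {un0}u0' : 0 < u by rewrite lt_def un0.
have [ua|au] := leP u a.
  by apply: le_trans (Ka _ u0' ua) _; apply: ler_wpM2r => //; rewrite le_max lexx.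
have [bu|ub] := leP b u.
  by apply: le_trans (Lb _ bu) _; apply: ler_wpM2r => //; rewrite !le_max lexx orbT.
apply: (@le_trans _ _ (phi (2 * b) / phi a * phi u)); last first.
  by apply: ler_wpM2r => //; rewrite !le_max lexx !orbT.
rewrite mulrAC ler_pdivlMr//; apply: ler_pM; rewrite ?(ltW pa)//.
- by apply: orlicz_ge0 => //; rewrite mulr_ge0.
- by apply: orlicz_le => //; [rewrite mulr_ge0|rewrite ler_pM2l// ltW].
- by apply: orlicz_le => //; apply: ltW.
Qed.

End growth.

(** * Choice of the values and sets of the singular function *)

Section selection.
Context d (T : measurableType d) (R : realType).
Variables (mu : {sigma_finite_measure set T -> \bar R}) (D : set T).
Hypothesis mD : measurable D.
Variable phi : R -> R.
Hypothesis phiP : orlicz phi.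
Variable m : measurableTypeR R -> \bar R.
Hypothesis mm : measurable_fun setT m.
Hypothesis m0 : forall r, (0 <= m r)%E.
Local Notation W := (weight_integral m).
Hypothesis W_fin : forall s, (0 <= s < +oo)%E -> (W s < +oo)%E.
Hypothesis W_pos : forall s, (0 < s)%E -> (0 < W s)%E.
Hypothesis W_infty : mu D = +oo%E -> W +oo = +oo%E.

(** The last clause keeps the supremum finite at each point: for fixed [t], the bound
    [0 < g t <= 2^-(n+1)] can hold for finitely many [n] only, and [u] is at most 1 for the
    others. *)
Definition selected (g : T -> R) (n : nat) (K : R) (u : R) (A : set T) :=
  [/\ 0 < u, K * phi u < phi (2 * u),
      [/\ measurable A, A `<=` D & (mu A < +oo)%E],
      (W (mu A) <= (2^-1 ^+ n.+1 / phi u)%:E <= 2%:E * W (mu A))%E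
    & forall t, A t -> u <= 1 \/ 0 < g t <= 2^-1 ^+ n.+1].

Theorem selected_nontrivial_M_ideal (rho : (T -> R) -> \bar R) (g : T -> R) :
  (forall f, (0 <= rho f)%E) ->
  (forall f : T -> R, measurable_fun D f -> rho f = rho_choquet mu D phi m f) ->
  (forall n K, 0 < K -> exists u A, selected g n K u A) ->
  let X := modular_space D (ae_on mu D) rho in
  nontrivial_M_ideal X (order_continuous (ae_on mu D) X).
Proof.
move=> rho_ge0 rhoE sel X.
(* Selection gives [phi u * W (mu A) >= 2^-(n+2)], so this factor raises [phi (2 * u) * W (mu A)] to
   at least [2 * n]; the [+ 1] keeps [K 0] positive. *)
pose K n : R := n.*2%:R * 2 ^+ n.+2 + 1.
have K0 n : 0 < K n by rewrite ltr_wpDl// mulr_ge0// exprn_ge0.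
have /choice[uA uAP] n : exists uA, selected g n (K n) uA.1 uA.2.
  by have [u [A uA]] := sel n _ (K0 n); exists (u, A).
pose u n := (uA n).1; pose A n := (uA n).2.
have Wge n : (0 <= W (mu (A n)))%E by apply: weight_integral_ge0; rewrite ?measure_ge0.
have WE n : W (mu (A n)) = (fine (W (mu (A n))))%:E.
  rewrite fineK// ge0_fin_numE//; apply: W_fin; rewrite measure_ge0/=.
  by case: (uAP n) => _ _ [].
pose w n := fine (W (mu (A n))).
have pu n : 0 < phi (u n) by apply: orlicz_gt0 => //; case: (uAP n).
apply: (rho_choquet_nontrivial_M_ideal mD phiP mm m0 W_fin W_pos W_infty
  rho_ge0 rhoE (u := u) (w := w) (A := A)).
- by move=> n; case: (uAP n) => /ltW.
- by move=> n; case: (uAP n) => _ _ [mA AD Afin] _ _; split.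
- move=> n; case: (uAP n) => _ _ _ /andP[+ _] _.
  by rewrite -/(A n) -/(u n) WE lee_fin ler_pdivlMr// mulrC.
- move=> n; case: (uAP n) => u0 /ltW Ku _ /andP[_ +] _.
  rewrite -/(A n) -/(u n) WE -EFinM lee_fin -/(w n) ler_pdivrMr// => h.
  have w0 : 0 <= w n by exact: fine_ge0.
  apply: le_trans (ler_wpM2r w0 Ku); rewrite -/(u n) /K mulrDl mul1r mulrDl.
  rewrite -[leLHS]addr0; apply: lerD; last by rewrite mulr_ge0// ltW.
  move: h; rewrite exprVn (exprS _ n.+1); have : 0 < (2 : R) ^+ n.+1 by exact: exprn_gt0.
  move: (2 ^+ n.+1) => p p0 h; rewrite -!mulrA; apply: ler_peMr; first by [].
  move: h; rewrite -[leLHS]mulr1 ler_pdivrMl// => h.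
  by apply: le_trans h _; rewrite le_eqVlt; apply/orP; left; apply/eqP; ring.
- move=> t; have [gt0|gt0] := leP (g t) 0.
    exists 1 => n At; case: (uAP n) => _ _ _ _ /(_ t At)[//|].
    by rewrite ltNge gt0.
  have cv : (2^-1 : R) ^+ n.+1 @[n --> \oo] --> (0 : R).
    by rewrite (cvg_shiftS (fun n => (2^-1 : R) ^+ n)); apply: cvg_expr; rewrite ger0_norm ?invf_lt1 ?ltr1n.
  have [N _ NP] : \forall n \near \oo, (2^-1 : R) ^+ n.+1 < g t.
    by apply: cvgr_lt cv _ gt0.
  (* From [N] on, [2^-(n+1) < g t], so only values at most 1 occur; the sum bounds the finitely many
     others. *)
  exists (1 + \sum_(i < N) u i) => n At.
  have s0 (r : pred 'I_N) : 0 <= \sum_(i < N | r i) u i.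
    by apply: sumr_ge0 => i _; case: (uAP i) => /ltW.
  have [nN|Nn] := ltnP n N.
    by rewrite (bigD1 (Ordinal nN))//= addrCA lerDl addr_ge0.
  case: (uAP n) => _ _ _ _ /(_ t At)[un|]; first by apply: le_trans un _; rewrite lerDl.
  by rewrite leNgt => /andP[_]; rewrite NP.
Qed.

End selection.

Section rearranged_modular.
Context d (T : measurableType d) (R : realType).
Variables (mu : {sigma_finite_measure set T -> \bar R}) (D : set T).
Hypothesis mD : measurable D.
Variable phi : R -> R.
Hypothesis phiP : orlicz phi.
Context d' (J : measurableType d').
Variables (nu : {sigma_finite_measure set J -> \bar R}) (S : set J).
Variables (kappa w : J -> R).
Hypothesis mS : measurable S.
Hypothesis mkappa : measurable_fun S kappa.
Hypothesis mw : measurable_fun S w.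
Hypothesis w_gt0 : forall t, S t -> 0 < w t.
Hypothesis w_decr : forall s t, S s -> S t -> kappa s <= kappa t -> w t <= w s.
Hypothesis nu_initial : forall B, measurable B -> B `<=` D ->
  nu [set t | S t /\ ((kappa t)%:E < mu B)%E] = mu B.

Local Notation m := (weight_levels nu S w).
Local Notation W := (weight_integral m).

Definition rearranged_modular (f : T -> R) : \bar R :=
  (\int[nu]_(t in S) (er_map phi (rearrangement mu D f (kappa t)%:E) * (w t)%:E))%E.

Lemma rearranged_modular_ge0 f : (0 <= rearranged_modular f)%E.
Proof.
apply: integral_ge0 => t St; apply: mule_ge0; last by rewrite lee_fin ltW ?w_gt0.
exact: er_map_rearrangement_ge0.
Qed.

Theorem rearranged_modular_nontrivial_M_ideal (s0 r0 : R) (g : T -> R) :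
  0 < s0 -> (W s0%:E < +oo)%E -> 0 < r0 -> (0 < m r0)%E ->
  (mu D = +oo%E -> (\int[nu]_(t in S) (w t)%:E)%E = +oo%E) ->
  (forall n K, 0 < K -> exists u A, selected mu D phi m g n K u A) ->
  let X := modular_space D (ae_on mu D) rearranged_modular in
  nontrivial_M_ideal X (order_continuous (ae_on mu D) X).
Proof.
move=> s00 Ws0 r00 mr0 Wi sel X.
have mm : measurable_fun setT m by exact: weight_levels_measurable.
have m0 r : (0 <= m r)%E by exact: weight_levels_ge0.
apply: (selected_nontrivial_M_ideal mD phiP mm m0 _ _ _ rearranged_modular_ge0 _ sel).
- exact: weight_integral_fin Ws0.
- apply: (weight_integral_gt0 mm m0 r00 _ mr0) => r rp rr0.
  rewrite /weight_levels; apply: le_measure; rewrite ?inE; [exact: overlevel_set_measurable..|].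
  move=> t [St /andP[_ rt]]; split=> //; rewrite rp /=; exact: le_lt_trans rt.
- by move=> muD; rewrite weight_integral_infty// Wi.
- by move=> f mf; exact: rearranged_integral.
Qed.

End rearranged_modular.

(** * Sequence spaces *)

Section counting_measure.
Context (R : realType).

Definition sigma_finite_counting_measure : {sigma_finite_measure set nat -> \bar R} :=
  HB.pack (@counting nat R)
    (Measure_isSigmaFinite.Build _ nat R (@counting nat R) (sigma_finite_counting R)).

Lemma counting_II (n : nat) : counting `I_n = n%:R%:E :> \bar R.
Proof.
by rewrite /counting asboolT ?(card_fset_set (card_eqxx _))//; exact: finite_II.
Qed.

(** Positions start at 0, so exactly [n] of them lie strictly below [n]. *)
Lemma counting_initial (B : set nat) :
  counting [set i | setT i /\ (i%:R%:E < counting B :> \bar R)%E] = counting B :> \bar R.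
Proof.
have [[n Bn]|Binf] := pselect (finite_set B).
  have -> : counting B = n%:R%:E :> \bar R.
    by rewrite /counting asboolT ?(card_fset_set Bn)//; exists n.
  rewrite -[RHS]counting_II; congr counting; apply/seteqP; split=> i /=.
    by move=> [_]; rewrite lte_fin ltr_nat.
  by rewrite lte_fin ltr_nat.
have -> : counting B = +oo%E :> \bar R by rewrite /counting asboolF.
rewrite (_ : [set i | _] = setT).
  rewrite /counting asboolF//; exact: infinite_nat.
by apply/seteqP; split=> i //= _; rewrite ltry.
Qed.

Lemma ae_on_counting : ae_on sigma_finite_counting_measure setT = globally [set: nat].
Proof.
apply/funext => P; apply/propext; split=> [[B [_ B0 PB]] i _|PT]; last first.
  by apply: aeW => i _; exact: PT.
apply: contrapT => Pi; have : (counting [set i] <= counting B :> \bar R)%E.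
  by apply: le_measure; rewrite ?inE// => _ ->; apply: PB => /(_ I).
have -> : counting [set i] = 1%:R%:E :> \bar R.
  by rewrite /counting asboolT// fset_set1 finmap.cardfs1.
by rewrite [counting B]B0 lee_fin ler10.
Qed.

(** A counting value is an integer or infinite, so being less than [i + 1] is the same as being at
    most [i]. *)
Lemma rearr_seqE (x : nat -> R) (i : nat) :
  rearr_seq x i = rearrangement (@counting nat R) setT x i%:R%:E.
Proof.
rewrite /rearr_seq /rearrangement; congr (ereal_inf [set _ | _ in _]).
apply/seteqP; split=> c /=.
  move=> [c0 ci]; split=> //; move: ci; rewrite /distr_seq.
  rewrite (_ : [set t | _ /\ _] = [set t | c < `|x t|]); last first.
    by apply/seteqP; split=> t //= [].
  rewrite /counting; case: asboolP => // _.
  by rewrite lte_fin lee_fin ltr_nat ler_nat ltnS.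
move=> [c0 ci]; split=> //; move: ci; rewrite /distr_seq.
rewrite (_ : [set t | _ /\ _] = [set t | c < `|x t|]); last first.
  by apply/seteqP; split=> t //= [].
rewrite /counting; case: asboolP => // _.
by rewrite lte_fin lee_fin ltr_nat ler_nat ltnS.
Qed.

End counting_measure.

Section sequence_spaces.
Context (R : realType) (phi : R -> R) (w : nat -> R).
Hypothesis phiP : orlicz phi.
Hypothesis wP : weight_seq w.

Local Notation cnt := (sigma_finite_counting_measure R).
Local Notation rho := (rearranged_modular cnt setT phi cnt setT (fun i : nat => i%:R : R) w).
Local Notation W := (weight_integral (weight_levels cnt setT w)).
Local Notation V n := (\sum_(0 <= i < n) w i).

Let w_gt0 i : 0 < w i. Proof. by case: wP. Qed.

Lemma alphaE (x : nat -> R) : alpha phi w x = rho x.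
Proof.
rewrite /rearranged_modular (_ : (\int[cnt]_(t in setT) _ =
  \int[counting]_t (er_map phi (rearrangement cnt setT x t%:R%:E) * (w t)%:E))%E)//.
rewrite ge0_integral_count => [|i].
  by apply: eq_eseriesr => i _; rewrite rearr_seqE.
apply: mule_ge0; last by rewrite lee_fin ltW.
exact: er_map_rearrangement_ge0.
Qed.

Lemma lambdaE : lambda phi w = modular_space setT (globally [set: nat]) rho.
Proof.
rewrite /lambda /modular_space; have -> : alpha phi w = rho by apply/funext => x; exact: alphaE.
congr (PreSpace _ _ _).
  by apply/seteqP; split=> x /=; [move=> h; split|move=> []].
by apply/seteqP; split=> x /= h; [move=> i _; exact: h|move=> i; exact: h].
Qed.

Lemma weight_integral_counting (n : nat) : W n%:R%:E = (V n)%:E.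
Proof.
have := @weight_integralE _ _ R cnt setT _ _ cnt setT
  (fun i : nat => i%:R : R) w.
rewrite -(counting_II R n) => -> //; last 2 first.
- by move=> s t _ _; rewrite ler_nat; have [_ + _] := wP; apply.
- by move=> B _ _; exact: counting_initial.
rewrite [cnt _](counting_II R n) integral_mkcond.
rewrite (_ : (\int[cnt]_t _ t = \int[counting]_t ((EFin \o w) \_ `I_n) t)%E); last first.
  congr (integral _ _ _); congr (_ \_ _); apply/seteqP; split=> i /=.
    by rewrite lte_fin ltr_nat => -[].
  by rewrite lte_fin ltr_nat.
rewrite ge0_integral_count => [|i]; last first.
  by rewrite patchE; case: ifPn => // _; rewrite lee_fin ltW.
rewrite (nneseries_split _ n) => [|i _]; last first.
  by rewrite patchE; case: ifPn => // _; rewrite lee_fin ltW.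
rewrite add0n [X in (_ + X)%E]eseries0 => [|i ni _]; last first.
  by rewrite patchE memNset//=; apply/negP; rewrite -leqNgt.
rewrite adde0 -sumEFin; apply: eq_big_nat => i /andP[_ ni].
by rewrite patchE mem_set.
Qed.

Lemma partial_sums_unbounded (x : R) : exists n, x < V n.
Proof.
apply: contrapT => h; have [_ _ winf] := wP.
have : (\sum_(0 <= i <oo) (w i)%:E <= x%:E)%E.
  apply: lime_le; first by apply: is_cvg_nneseries => i _ _; rewrite lee_fin ltW.
  apply: nearW => n; rewrite sumEFin lee_fin leNgt; apply/negP => xn.
  by apply: h; exists n.
by rewrite winf.
Qed.

(** Stop at the last partial sum not exceeding [x]. The next term is at most [w 0], hence at most
    that sum, so adding it at most doubles the sum. The hypothesis [w 0 <= x] provides a nonempty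
    sum. *)
Lemma partial_sums_select (x : R) : w 0%N <= x ->
  exists n, V n <= x <= 2 * V n.
Proof.
move=> wx; have x0 : 0 < x by exact: lt_le_trans wx.
have : exists n, x < V n.+1.
  by have [[|n]] := partial_sums_unbounded x; [rewrite big_geq// ltNge ltW|exists n].
move=> /ex_minnP[[|k] xk kmin].
  by move: xk; rewrite big_nat1 ltNge wx.
have Vk : V k.+1 <= x by rewrite leNgt; apply/negP => /kmin; rewrite ltnn.
exists k.+1; rewrite Vk /=; apply: le_trans (ltW xk) _.
rewrite big_nat_recr//= mulr2n mulrDl mul1r lerD2l.
have [_ wdecr _] := wP; apply: le_trans (wdecr _ _ (leq0n k.+1)) _.
by rewrite big_nat_recl//= lerDl sumr_ge0// => i _; exact: ltW.
Qed.

Theorem lambda_nontrivial_M_ideal : ~ Delta2_zero phi ->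
  nontrivial_M_ideal (lambda phi w) (lambda_a phi w).
Proof.
move=> nD; have [_ wdecr winf] := wP.
rewrite /lambda_a lambdaE -(ae_on_counting R).
have W1 := weight_integral_counting 1.
(* The level [w 0 / 2] lies strictly below the first weight. Only values [u <= 1] will be selected,
   so a constant [g] serves. *)
apply: (@rearranged_modular_nontrivial_M_ideal _ _ R cnt setT measurableT phi phiP
  _ _ cnt setT (fun i : nat => i%:R : R) w measurableT _ _ _ _ _ 1 (w 0%N / 2) (cst 1)) => //.
- by move=> s t _ _; rewrite ler_nat; exact: wdecr.
- by move=> B _ _; exact: counting_initial.
- by rewrite W1 ltry.
- by rewrite divr_gt0.
- apply: (@lt_le_trans _ _ (counting `I_1)); first by rewrite counting_II lte_fin.
  apply: le_measure; rewrite ?inE// => -[|//] _ /=; split=> //.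
  by rewrite divr_gt0//= ltr_pdivrMr// ltr_pMr// ltr1n.
- by move=> _; rewrite -winf; apply: ge0_integral_count => i; rewrite lee_fin ltW.
(* This bound on [phi u] is the condition [w 0 <= 2^-(n+1) / phi u] of [partial_sums_select]: [u]
   must be small because no nonempty set of integers has weight below one term. *)
move=> n K K0; have e0 : 0 < 2^-1 ^+ n.+1 / w 0%N by rewrite divr_gt0// exprn_gt0.
have [u [/andP[u0 u1] ue Ku]] := not_Delta2_zero phiP nD K0 e0.
have pu : 0 < phi u by exact: orlicz_gt0.
have [|k /andP[k1 k2]] := @partial_sums_select (2^-1 ^+ n.+1 / phi u).
  by rewrite ler_pdivlMr// mulrC -ler_pdivlMr.
exists u, `I_k; split=> //.
- by split=> //; rewrite [X in (X < _)%E](counting_II R k) ltry.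
- rewrite [cnt _](counting_II R k) weight_integral_counting -EFinM !lee_fin.
  by rewrite k1.
- by move=> t _; left.
Qed.

End sequence_spaces.

(** * Function spaces *)

Section function_spaces.
Context (R : realType) (phi : R -> R) (gamma : \bar R) (w : R -> R).
Hypothesis phiP : orlicz phi.
Hypothesis gamma_gt0 : (0 < gamma)%E.
Hypothesis wP : weight gamma w.

Local Notation leb := (@lebesgue_measure R : {sigma_finite_measure set (measurableTypeR R) -> \bar R}).
Local Notation mu := (@completed_lebesgue_measure R : {sigma_finite_measure set (@Leb R) -> \bar R}).
Local Notation D := (I_ gamma : set (@Leb R)).
Local Notation S := (Io_ gamma : set (measurableTypeR R)).
Local Notation m := (weight_levels leb S w).
Local Notation W := (weight_integral m).

Lemma LambdaE : Lambda phi gamma w =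
  modular_space D (ae_on mu D) (rearranged_modular mu D phi leb S id w).
Proof. by []. Qed.

Let measurable_below (A : set R) : is_interval A -> measurable (A : set (@Leb R)).
Proof. by move=> Ai; apply: sub_caratheodory; exact: is_interval_measurable. Qed.

Let I_interval : is_interval (I_ gamma).
Proof.
move=> s t [s0 _] [_ tg] u /andP[su ut]; split; first exact: le_trans su.
by apply: le_lt_trans tg; rewrite lee_fin.
Qed.

Let Io_interval : is_interval (Io_ gamma).
Proof.
move=> s t [s0 _] [_ tg] u /andP[su ut]; split; first exact: lt_le_trans su.
by apply: le_lt_trans tg; rewrite lee_fin.
Qed.

Let S_nonempty : exists t, Io_ gamma t.
Proof.
move: gamma_gt0; rewrite /Io_; case: gamma => [g| |//]; last by exists 1; rewrite /= ltry.
rewrite lte_fin => g0; exists (g / 2); split; first by rewrite divr_gt0.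
by rewrite lte_fin ltr_pdivrMr// ltr_pMr// ltr1n.
Qed.

Let mD : measurable D. Proof. exact: measurable_below. Qed.

Let mS : measurable S. Proof. exact: is_interval_measurable. Qed.

Let w_gt0 t : S t -> 0 < w t. Proof. by case: wP => + _ _ _; apply. Qed.

Let w_decr s t : S s -> S t -> s <= t -> w t <= w s.
Proof. by case: wP => _ + _ _; apply. Qed.

(** The superlevel sets of a monotone function are intervals. *)
Let mw : measurable_fun S w.
Proof.
apply: (measurability (@RGenCInfty.G R)) => [|/= _ [_] [r] -> <-].
  exact: RGenCInfty.measurableE.
apply: is_interval_measurable => s t/=.
rewrite !in_itv/= !andbT => -[Ss fs] [St ft] u sut; have Su := Io_interval Ss St sut.
by split=> //; rewrite in_itv/= andbT (le_trans ft)// w_decr//; case/andP: sut.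
Qed.

Let mu_itv (r : R) : mu [set t | 0 <= t < r] = (Num.max r 0)%:E.
Proof.
(* The completed measure and [lebesgue_measure] are the same set function on two sigma-algebras,
   hence convertible. *)
rewrite -[LHS]/(lebesgue_measure [set t | 0 <= t < r]).
rewrite (_ : [set t | _] = `[0, r[%classic); last by apply/seteqP; split=> t /=; rewrite in_itv.
rewrite lebesgue_measure_itv/= lte_fin; have [r0|r0] := ltP; first by rewrite sube0.
by [].
Qed.

Let mu_D_le : (mu D <= gamma)%E.
Proof.
move: gamma_gt0; rewrite /I_; case: gamma => [g| |//] g0; last by rewrite leey.
rewrite (_ : [set t | _] = [set t | 0 <= t < g]); first by rewrite mu_itv max_l// ltW.
by apply/seteqP; split=> t /=; rewrite lte_fin; [move=> [-> ->]|move=> /andP[-> ->]].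
Qed.

(** Since [mu B] is at most [gamma], the interval from 0 to [mu B] fits into the domain of the
    weight. *)
Let nu_initial B : measurable B -> B `<=` D ->
  leb [set t | S t /\ (t%:E < mu B)%E] = mu B.
Proof.
move=> mB BD; have : (mu B <= mu D)%E by apply: le_measure; rewrite ?inE.
move=> /le_trans /(_ mu_D_le).
have : (0 <= mu B)%E by exact: measure_ge0.
case: (mu B) => [r| |//] r0 rg.
  rewrite (_ : [set t | _] = `]0%R, r[%classic).
    rewrite -[LHS]/(lebesgue_measure `]0%R, r[%classic) lebesgue_measure_itv/= lte_fin; have [_|r0'] := ltP; first by rewrite sube0.
    by congr EFin; apply/le_anti; rewrite r0' -lee_fin r0.
  apply/seteqP; split=> t /=; rewrite in_itv/= lte_fin; first by move=> [[-> _] ->].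
  move=> /andP[t0 tr]; split=> //; split=> //; apply: lt_le_trans rg.
  by rewrite lte_fin.
rewrite (_ : [set t | _] = `]0%R, +oo[%classic).
  by rewrite -[LHS]/(lebesgue_measure `]0%R, +oo[%classic) lebesgue_measure_itv/= ltry.
move: rg; rewrite leye_eq => /eqP ->.
apply/seteqP; split=> t /=; rewrite /Io_ /= in_itv/= andbT; first by case=> [[]].
by move=> t0; rewrite !ltry.
Qed.

Let A (s : R) : set (@Leb R) := [set t | 0 < t < s].

Let mA s : measurable (A s).
Proof.
apply: measurable_below => x y /= /andP[x0 _] /andP[_ ys] z /andP[xz zy].
by apply/andP; split; [exact: (lt_le_trans x0 xz)|exact: (le_lt_trans zy ys)].
Qed.

Let A_sub s : S s -> A s `<=` D.
Proof.
move=> [_ sg] t /andP[t0 ts]; split; first exact: ltW.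
by apply: lt_trans sg; rewrite lte_fin.
Qed.

Let mu_A s : 0 < s -> mu (A s) = s%:E.
Proof.
move=> s0; rewrite -[LHS]/(lebesgue_measure (A s)).
rewrite (_ : A s = `]0, s[%classic); last by apply/seteqP; split=> t /=; rewrite in_itv.
by rewrite lebesgue_measure_itv/= lte_fin s0 sube0.
Qed.

Lemma weight_integral_function s : S s ->
  W s%:E = (\int[lebesgue_measure]_(t in `]0%R, s[) (w t)%:E)%E.
Proof.
move=> Ss; have [s0 sg] := Ss.
have := weight_integralE (mu := mu) (D := D) (nu := leb) (kappa := id) mS _ mw w_gt0 w_decr nu_initial
  (mA s) (A_sub Ss).
rewrite (mu_A s0) => ->//.
congr (integral _ _ _); apply/seteqP; split=> t /=; rewrite in_itv/= lte_fin.
  by move=> [[-> _] ->].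
move=> /andP[t0 ts]; split=> //; split=> //.
by apply: lt_trans sg; rewrite lte_fin.
Qed.

Let mm : measurable_fun setT m. Proof. exact: weight_levels_measurable. Qed.
Let m0 r : (0 <= m r)%E. Proof. exact: weight_levels_ge0. Qed.

Let Wfin s : S s -> (W s%:E < +oo)%E.
Proof. by move=> Ss; rewrite weight_integral_function//; case: wP => _ _ + _; apply. Qed.

Lemma weight_levels_function t : S t -> (0 < m (w t / 2)%R)%E.
Proof.
move=> St; have [t0 tg] := St; apply: (@lt_le_trans _ _ (leb `]0%R, t[%classic)).
  rewrite -[X in (_ < X)%E]/(lebesgue_measure `]0%R, (t : R)[%classic).
  by rewrite lebesgue_measure_itv/= lte_fin t0 sube0 lte_fin.
apply: le_measure; rewrite ?inE; [exact: measurable_itv|exact: overlevel_set_measurable|].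
move=> s /=; rewrite in_itv/= => /andP[s0 st]; have Ss : S s.
  by split=> //; apply: lt_trans tg; rewrite lte_fin.
split=> //; rewrite divr_gt0 ?w_gt0//= ltr_pdivrMr//.
apply: le_lt_trans (w_decr Ss St (ltW st)) _; rewrite ltr_pMr ?w_gt0//.
by rewrite ltr1n.
Qed.

Let Wpos s : (0 < s)%E -> (0 < W s)%E.
Proof.
move=> s0; have [t St] := S_nonempty.
have wt : 0 < w t / 2 by rewrite divr_gt0 ?w_gt0.
apply: (weight_integral_gt0 mm m0 wt _ (weight_levels_function St)) s0 => r rp rr0.
rewrite /weight_levels; apply: le_measure; rewrite ?inE; [exact: overlevel_set_measurable..|].
by move=> u [Su /andP[_ rt]]; split=> //; rewrite rp /=; exact: le_lt_trans rt.
Qed.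

Lemma weight_integral_unbounded (x : R) : gamma = +oo%E ->
  exists2 s, 0 < s & (x%:E <= W s%:E)%E.
Proof.
move=> g; apply: contrapT => h; have [_ _ _ /(_ g) winf] := wP.
have Sn (n : nat) : S n.+1%:R by split=> //; rewrite g ltry.
have := @ge0_nondecreasing_set_cvg_integral _ _ R (fun n => `]0%R, (n.+1%:R : R)[%classic : set (measurableTypeR R)) (EFin \o w) leb.
rewrite (_ : \bigcup_i _ = S); last first.
  apply/seteqP; split=> t /=.
    by move=> [n _]; rewrite /= in_itv/= => /andP[t0 _]; split=> //; rewrite g ltry.
  move=> [t0 _]; exists (Num.truncn t) => //=; rewrite in_itv/= t0; exact: truncnS_gt.
have sub n : `]0%R, n.+1%:R[%classic `<=` S.
  by move=> t /=; rewrite in_itv/= => /andP[t0 _]; split=> //; rewrite g ltry.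
rewrite winf => cv.
have [N _ /(_ N (leqnn N))] : \forall n \near \oo,
    (x%:E <= \int[leb]_(t in `]0%R, (n.+1%:R : R)[) (w t)%:E)%E.
  have /cvgeyPge : (\int[leb]_(t in `]0%R, (n.+1%:R : R)[) (w t)%:E)%E @[n --> \oo] --> +oo%E.
    apply: cv => [i j ij|i|i|i t /sub St].
    - apply/subsetPset => t /=; rewrite !in_itv/= => /andP[-> /lt_le_trans]; apply.
      by rewrite ler_nat.
    - exact: measurable_itv.
    - by apply/measurable_EFinP; apply: measurable_funS (@sub i) mw.
    - by rewrite lee_fin ltW// w_gt0.
  by apply.
rewrite /= => xN; apply: h; exists N.+1%:R => //.
by rewrite weight_integral_function.
Qed.

(** The set is an initial interval ]0, s[ of suitable weight. When [phi u >= 1], each [t] in it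
    satisfies [W t <= W s <= 2^-(n+1) / phi u <= 2^-(n+1)], so [W] itself is the function [g]
    controlling how often a point is met. *)
Lemma function_selected (x u : R) (n : nat) (K : R) (s1 : R) :
  S s1 -> 0 < u -> K * phi u < phi (2 * u) ->
  ((2^-1 ^+ n.+1 / phi u)%:E <= W s1%:E)%E -> u <= 1 \/ 1 <= phi u ->
  exists u A, selected mu D phi m (fun t => fine (W t%:E)) n K u A.
Proof.
move=> Ss1 u0 Ku xW uP; have pu : 0 < phi u by exact: orlicz_gt0.
have [|s [/andP[s0 ss1] sx xs]] := weight_integral_select mm m0 Ss1.1 (Wfin Ss1) _ xW.
  by rewrite divr_gt0// exprn_gt0.
have Ss : S s by split=> //; apply: le_lt_trans Ss1.2; rewrite lee_fin.
exists u, (A s); split=> //.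
- by split=> //; [exact: (A_sub Ss)|rewrite mu_A// ltry].
- by rewrite mu_A// sx.
move=> t /andP[t0 ts]; case: uP => [|pu1]; [by left|right].
have St : S t by split=> //; apply: lt_trans Ss.2; rewrite lte_fin.
have WE : W t%:E = (fine (W t%:E))%:E by rewrite fineK// ge0_fin_numE ?Wfin//; apply/ltW/Wpos.
rewrite -lte_fin -lee_fin -WE Wpos ?lte_fin//=.
apply: (@le_trans _ _ (W s%:E)).
  by apply: weight_integral_le => //; rewrite lee_fin ltW.
apply: le_trans sx _; rewrite lee_fin ler_pdivrMr// ler_peMr// exprn_ge0//.
Qed.

Theorem Lambda_nontrivial_M_ideal :
  (gamma = +oo%E /\ ~ Delta2 phi) \/ ((gamma < +oo)%E /\ ~ Delta2_infty phi) ->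
  nontrivial_M_ideal (Lambda phi gamma w) (Lambda_a phi gamma w).
Proof.
move=> hD; rewrite /Lambda_a LambdaE -[ae_I gamma]/(ae_on mu D).
have [t St] := S_nonempty.
apply: (@rearranged_modular_nontrivial_M_ideal _ _ R mu D mD phi phiP
  _ _ leb S id w mS _ mw w_gt0 w_decr nu_initial t (w t / 2) (fun s => fine (W s%:E))).
- exact: measurable_id.
- exact: St.1.
- exact: Wfin.
- by rewrite divr_gt0 ?w_gt0.
- exact: weight_levels_function.
- move=> muD; have g : gamma = +oo%E.
    by apply/eqP; rewrite -leye_eq -muD.
  by case: wP => _ _ _; apply.
move=> n K K0; have [nI|nI] := pselect (Delta2_infty phi); last first.
  have Wt : 0 < fine (W t%:E) by rewrite fine_gt0// Wpos ?Wfin// lte_fin St.1.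
  (* Demanding [phi u >= 1 / W t] makes the target weight [2^-(n+1) / phi u] at most [W t],
     available on the fixed interval ]0, t[ even when [gamma] is finite. *)
  have [u [u0 ub Ku]] := @not_Delta2_infty _ _ phiP K (Num.max 1 (fine (W t%:E))^-1) nI K0.
  move: ub; rewrite ge_max => /andP[u1 uW].
  apply: (@function_selected 0 u n K t) => //; last by right.
  rewrite -[W t%:E]fineK ?ge0_fin_numE ?Wfin//; last by apply/ltW/Wpos; rewrite lte_fin St.1.
  rewrite lee_fin ler_pdivrMr; last exact: lt_le_trans u1.
  apply: (@le_trans _ _ 1); first by rewrite exprn_ile1 ?invr_ge0// invf_le1// ler1n.
  by rewrite -ler_pdivrMl// mulr1.
have g : gamma = +oo%E by case: hD => [[]|[_]].
have nZ : ~ Delta2_zero phi.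
  by move=> dZ; case: hD => [[_]|[_]]; apply => //; exact: Delta2_zero_infty.
(* Here [phi u] may be tiny and the target weight large; [gamma = +oo] and the divergence of the
   weight provide an interval that carries it. *)
have [u [/andP[u0 u1] _ Ku]] := not_Delta2_zero phiP nZ K0 ltr01.
have [s s0 sW] := weight_integral_unbounded (2^-1 ^+ n.+1 / phi u) g.
apply: (@function_selected 0 u n K s) => //; last by left.
by split=> //; rewrite g ltry.
Qed.

End function_spaces.

Theorem corollary3p4 (R : realType) (phi : R -> R) (hphi : orlicz phi) :
  (forall (gamma : \bar R) (w : R -> R),
     (0 < gamma)%E -> weight gamma w ->
     (gamma = +oo%E /\ ~ Delta2 phi) \/
     ((gamma < +oo)%E /\ ~ Delta2_infty phi) ->
     nontrivial_M_ideal (Lambda phi gamma w) (Lambda_a phi gamma w)) /\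
  (forall w : nat -> R,
     weight_seq w -> ~ Delta2_zero phi ->
     nontrivial_M_ideal (lambda phi w) (lambda_a phi w)).
Proof.
split=> [gamma w gamma0 wP hD|w wP hD].
  exact: Lambda_nontrivial_M_ideal.
exact: lambda_nontrivial_M_ideal.
Qed.
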